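(* Let $P\subseteq\mathbb{R}^l$ be a convex polyhedral set, let $g:\mathbb{R}^n\to\mathbb{R}^l$ and $b:\mathbb{R}^n\to\mathbb{R}^{l\times m}$ be twice continuously differentiable, and let $$\Omega:=\{(x,b(x)^T\eta)\mid\eta\in N_P(g(x))\}\subseteq\mathbb{R}^n\times\mathbb{R}^m.$$ Let $\bar x\in g^{-1}(P)$ and $\bar d^*\in N_P(g(\bar x))$ be given and assume that $$\nabla g(\bar x)^Td^*=0,\ d^*\in\big(N_P(g(\bar x))\big)^+\Rightarrow d^*=0,\qquad\qquad b(\bar x)^Td^*=0,\ d^*\in\big(N_P(g(\bar x))\big)^+\Rightarrow d^*=0.$$ Put $\bar\omega:=(\bar x,b(\bar x)^T\bar d^* )$. Then the following hold. (i) $T_\Omega(\bar\omega)=\Big\{\big(u,(\nabla b(\bar x)u)^T\bar d^*+b(\bar x)^Te^*\big)\ \Big|\ (\nabla g(\bar x)u,e^* )\in T_{\mathrm{gph}\,N_P}(g(\bar x),\bar d^* )\Big\}.$ (ii) Let $\eta\in T_\Omega(\bar\omega)$ and let $(u,e^* )$ denote the element fulfilling $$\eta=\big(u,(\nabla b(\bar x)u)^T\bar d^*+b(\bar x)^Te^*\big)\quad\text{and}\quad(\nabla g(\bar x)u,e^* )\in T_{\mathrm{gph}\,N_P}(g(\bar x),\bar d^* ).\qquad(1)$$ Then $$N_\Omega(\bar\omega;\eta)=\Big\{\big(-\nabla(b^T\bar d^* )(\bar x)^Tr+\nabla g(\bar x)^Tf^*,\,r\big)\ \Big|\ (f^*,b(\bar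 x)r)\in N_{\mathrm{gph}\,N_P}\big((g(\bar x),\bar d^* );(\nabla g(\bar x)u,e^* )\big)\Big\},$$ and $$T^2_\Omega(\bar\omega;\eta)=\Big\{\big(\zeta,\ 2(\nabla b(\bar x)u)^Te^*+(\nabla b(\bar x)\zeta+\nabla^2b(\bar x)(u,u))^T\bar d^*+b(\bar x)^T\xi^*\big)\ \Big|\ \big(\nabla g(\bar x)\zeta+\nabla^2g(\bar x)(u,u),\xi^*\big)\in T^2_{\mathrm{gph}\,N_P}\big((g(\bar x),\bar d^* );(\nabla g(\bar x)u,e^* )\big)\Big\}.$$ (iii) Let $\eta\in T_\Omega(\bar\omega)$ and let $(u,e^* )$ satisfy (1). Then $$\mathrm{dom}\,\sigma_{T^2_\Omega(\bar\omega;\eta)}=\widehat N^p_\Omega(\bar\omega;\eta)=\Big\{\big(-\nabla(b^T\bar d^* )(\bar x)^Tr+\nabla g(\bar x)^Tf^*,\,r\big)\ \Big|\ (f^*,b(\bar x)r)\in\widehat N_{T_{\mathrm{gph}\,N_P}(g(\bar x),\bar d^* )}(\nabla g(\bar x)u,e^* )\Big\},$$ $$\mathrm{dom}\,\hat\sigma_{T^2_\Omega(\bar\omega;\eta)}=N_\Omega(\bar\omega;\eta).$$ (iv) Let $\eta\in T_\Omega(\bar\omega)$ and let $(u,e^* )$ satisfy (1). For every $\omega^*\in\mathrm{dom}\,\sigma_{T^2_\Omega(\bar\omega;\eta)}$ (respectively $\omega^*\in\mathrm{dom}\,\hat\sigma_{T^2_\Omega(\bar\omega;\eta)}$) let $(r,f^*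 )$ denote the elements fulfilling $$\omega^*=\big(-\nabla(b^T\bar d^* )(\bar x)^Tr+\nabla g(\bar x)^Tf^*,\,r\big)$$ and $$(f^*,b(\bar x)r)\in\widehat N_{T_{\mathrm{gph}\,N_P}(g(\bar x),\bar d^* )}(\nabla g(\bar x)u,e^* )\quad\Big(\text{respectively } N_{\mathrm{gph}\,N_P}\big((g(\bar x),\bar d^* );(\nabla g(\bar x)u,e^* )\big)\Big).$$ Then $$\sigma_{T^2_\Omega(\bar\omega;\eta)}(\omega^* )\ \big(\text{respectively }\hat\sigma_{T^2_\Omega(\bar\omega;\eta)}(\omega^* )\big)=\big\langle r,2(\nabla b(\bar x)u)^Te^*+\nabla^2b(\bar x)(u,u)^T\bar d^*\big\rangle-\langle f^*,\nabla^2g(\bar x)(u,u)\rangle,$$ and $\mathrm{d}^2\delta_\Omega(\bar\omega;\omega^* )(\eta)=-\sigma_{T^2_\Omega(\bar\omega;\eta)}(\omega^* )$.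
   Context: $N_P$ is the normal cone mapping of convex analysis of $P$ (empty outside $P$), $\mathrm{gph}\,N_P=\{(p,p^* )\mid p^*\in N_P(p)\}$, and $C^+:=\mathrm{span}(C-C)$ for a set $C$. For a closed set $C$ and $z\in C$: $T_C(z)=\{u\mid\exists t_k\downarrow0,u_k\to u: z+t_ku_k\in C\}$; for $u\in T_C(z)$ the outer second-order tangent set is $T_C^2(z;u)=\{w\mid\exists t_k\downarrow0,w_k\to w: z+t_ku+\frac12t_k^2w_k\in C\}$; $\widehat N_C(z)=\{v\mid\langle v,z'-z\rangle\le o(\|z'-z\|)\ \forall z'\in C\}$ (empty if $z\notin C$); $N_C(z)$ is the limiting (Mordukhovich) normal cone; $N_C(z;u)=\{v\mid\exists t_k\downarrow0,u_k\to u,v_k\to v: v_k\in\widehat N_C(z+t_ku_k)\}$. Directional proximal normal cone: for $u\in T_C(z)$ let $\hat{\mathcal N}^p_C(z;u)$ be the set of $z^*$ for which there are $\delta,\rho,\gamma>0$ with $\langle z^*,z'-z\rangle\le\gamma\|z'-z\|^2$ for all $z'\in C\cap(z+V_{\delta,\rho}(u))$, where $V_{\delta,\rho}(u)=\{u'\mid\|u'\|<\delta,\ \big\|\|u\|u'-\|u'\|u\big\|\le\rho\|u'\|\|u\|\}$; then $\widehat N^p_C(z;u):=\hat{\mathcal N}^p_C(z;u)\cap\{u\}^\perp$. Support function $\sigma_C(\lambda)=\sup_{u\in C}\langle\lambda,u\rangle$ ($=-\infty$ if $C=\emptyset$). Lower generalized support function: for $C\neq\emptyset$ closed, $\hat\sigma_C(\lambda)=\liminf_{\tilde\lambda\to\lambda}\inf_u\{\langle\tilde\lambda,u\rangle\mid\tilde\lambda\in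 N_C(u)\}$ (with $\inf\emptyset=+\infty$, and $\tilde\lambda=\lambda$ allowed in the liminf); $\hat\sigma_\emptyset\equiv-\infty$. The domain $\mathrm{dom}$ of an extended-real-valued function is the set where it is $<+\infty$. Second subderivative of the indicator function $\delta_C$ at $z\in C$: $\mathrm{d}^2\delta_C(z;z^* )(u)=\liminf_{t\downarrow0,\,u'\to u,\,z+tu'\in C}\frac{-2\langle z^*,u'\rangle}{t}$. Derivatives: $\nabla b(x)u\in\mathbb{R}^{l\times m}$ is the directional derivative of $b$ along $u$; $\nabla^2b(x)(u,u)\in\mathbb{R}^{l\times m}$ is the entrywise second derivative; $\nabla(b^T\bar d^* )(x)\in\mathbb{R}^{m\times n}$ is the Jacobian of $x\mapsto b(x)^T\bar d^*$; $\nabla^2g(x)(u,u)$ has components $u^T\nabla^2g_i(x)u$. *)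

(* Defs.v *)
From mathcomp Require Import all_boot all_order all_algebra.
From mathcomp Require Import all_classical all_reals all_analysis.
Import Order.TTheory GRing.Theory Num.Theory.
Import numFieldNormedType.Exports.

Set Implicit Arguments.
Unset Strict Implicit.
Unset Printing Implicit Defensive.

Local Open Scope classical_set_scope.
Local Open Scope ring_scope.

(** Vectors of [R^k] are row vectors ['rV[R]_k] and a pair [(x, y)] in
    [R^p x R^q] is [row_mx x y : 'rV[R]_(p + q)].  A product [A^T v] of the
    column-vector convention thus reads [v *m A], and [A v] reads [v *m A^T].
    The library's ['J f x] is the transpose of the usual Jacobian matrix:
    [Df(x) u] reads [u *m 'J f x] and [Df(x)^T v] reads [v *m ('J f x)^T]. *)

Section EuclideanSpace.
Context {R : realType} {k : nat}.
Implicit Types (C : set 'rV[R]_k) (u v : 'rV[R]_k).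

Definition dotp u v : R := \sum_(i < k) u 0 i * v 0 i.

(** The library's norm on matrices is the maximum norm, which induces the same
    topology. *)
Definition enorm u : R := Num.sqrt (dotp u u).

Definition polyhedral C : Prop :=
  exists (q : nat) (a : 'I_q -> 'rV[R]_k) (c : 'I_q -> R),
    C = [set y | forall i, dotp (a i) y <= c i].

Definition linear_span C : set 'rV[R]_k :=
  [set v | exists (q : nat) (a : 'I_q -> R) (x : 'I_q -> 'rV[R]_k),
     (forall i, C (x i)) /\ v = \sum_(i < q) a i *: x i].

Definition set_diff C : set 'rV[R]_k := [set u - v | u in C & v in C].

Definition span_diff C : set 'rV[R]_k := linear_span (set_diff C).

End EuclideanSpace.

Section Smoothness.
Context {R : realType}.

(** In finite dimension, continuity of the derivative is continuity of all
    directional derivatives. *)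
Definition contdiff {V W : normedModType R} (f : V -> W) : Prop :=
  (forall x, differentiable f x) /\
  (forall v, continuous (fun x => 'D_v f x)).

Definition twice_contdiff {V W : normedModType R} (f : V -> W) : Prop :=
  contdiff f /\ forall v, contdiff (fun x => 'D_v f x).

Definition hessian {n} (f : 'rV[R]_n -> R) (x : 'rV[R]_n) : 'M[R]_n :=
  \matrix_(i, j)
    'D_(delta_mx 0 i : 'rV[R]_n) (fun y => 'D_(delta_mx 0 j : 'rV[R]_n) f y) x.

(** [D^2 F(x)(u, u)]; used with [p = 1] for a vector-valued [F]. *)
Definition second_deriv {n p q} (F : 'rV[R]_n -> 'M[R]_(p, q))
    (x u : 'rV[R]_n) : 'M[R]_(p, q) :=
  \matrix_(i, j) dotp u (u *m (hessian (fun y => F y i j) x)^T).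

End Smoothness.

Section VariationalAnalysis.
Context {R : realType} {k : nat}.
Implicit Types (C : set 'rV[R]_k) (z u : 'rV[R]_k).

Definition convex_normal_cone C z : set 'rV[R]_k :=
  [set v | C z /\ forall z', C z' -> dotp v (z' - z) <= 0].

(** [t_k] decreasing to [0], in the sense of [t_k > 0] and [t_k --> 0]. *)
Definition to0p (t : nat -> R) : Prop :=
  (forall i, 0 < t i) /\ t i @[i --> \oo] --> (0 : R).

Definition tangent_cone C z : set 'rV[R]_k :=
  [set u | exists (t : nat -> R) (us : nat -> 'rV[R]_k),
     [/\ to0p t, us i @[i --> \oo] --> u
       & forall i, C (z + t i *: us i)]].

Definition second_tangent_set C z u : set 'rV[R]_k :=
  [set w | exists (t : nat -> R) (ws : nat -> 'rV[R]_k),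
     [/\ to0p t, ws i @[i --> \oo] --> w
       & forall i, C (z + t i *: u + (2^-1 * t i ^+ 2) *: ws i)]].

Definition regular_normal_cone C z : set 'rV[R]_k :=
  [set v | C z /\ forall e : R, 0 < e ->
     \forall z' \near z, C z' -> dotp v (z' - z) <= e * enorm (z' - z)].

Definition limiting_normal_cone C z : set 'rV[R]_k :=
  [set v | C z /\ exists zs vs : nat -> 'rV[R]_k,
     [/\ zs i @[i --> \oo] --> z, vs i @[i --> \oo] --> v
       & forall i, regular_normal_cone C (zs i) (vs i)]].

Definition directional_normal_cone C z u : set 'rV[R]_k :=
  [set v | exists (t : nat -> R) (us vs : nat -> 'rV[R]_k),
     [/\ to0p t, us i @[i --> \oo] --> u, vs i @[i --> \oo] --> v
       & forall i, regular_normal_cone C (z + t i *: us i) (vs i)]].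

Definition directional_nbhd (delta rho : R) u : set 'rV[R]_k :=
  [set u' | enorm u' < delta /\
     enorm (enorm u *: u' - enorm u' *: u) <= rho * enorm u' * enorm u].

(** Only meaningful for [u] in [tangent_cone C z]. *)
Definition directional_proximal_prenormal_cone C z u : set 'rV[R]_k :=
  [set v | exists delta rho gamma : R,
     [/\ 0 < delta, 0 < rho, 0 < gamma
       & forall z', C z' -> directional_nbhd delta rho u (z' - z) ->
         dotp v (z' - z) <= gamma * enorm (z' - z) ^+ 2]].

Definition directional_proximal_normal_cone C z u : set 'rV[R]_k :=
  directional_proximal_prenormal_cone C z u `&` [set v | dotp v u = 0].

Definition support_fun C (v : 'rV[R]_k) : \bar R :=
  ereal_sup [set (dotp v u)%:E | u in C].

(** The liminf is over full neighbourhoods: the point [v] is not excluded. *)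
Definition lower_support_fun C (v : 'rV[R]_k) : \bar R :=
  if C == set0 then -oo%E else
  limf_einf (fun v' : 'rV[R]_k =>
    ereal_inf [set (dotp v' u)%:E | u in [set u | limiting_normal_cone C u v']])
    (nbhs v).

Definition edom (f : 'rV[R]_k -> \bar R) : set 'rV[R]_k :=
  [set v | (f v < +oo)%E].

Definition second_subderivative_indicator C z v u : \bar R :=
  limf_einf (fun p : R * 'rV[R]_k => (- 2 * dotp v p.2 / p.1)%:E)
    (within [set p | C (z + p.1 *: p.2)] (filter_prod (0 : R)^'+ (nbhs u))).

End VariationalAnalysis.

Definition gph {R : realType} {p q} (F : 'rV[R]_p -> set 'rV[R]_q) :
    set 'rV[R]_(p + q) :=
  [set w | exists x y, w = row_mx x y /\ F x y].

Definition Omega {R : realType} {n m l} (P : set 'rV[R]_l)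
    (g : 'rV[R]_n -> 'rV[R]_l) (b : 'rV[R]_n -> 'M[R]_(l, m)) :
    set 'rV[R]_(n + m) :=
  [set w | exists x eta,
     w = row_mx x (eta *m b x) /\ convex_normal_cone P (g x) eta].

(* Main.v *)
(** The set [gph N_P] is closed and conic around each of its points, because by
    Fourier-Motzkin elimination membership in it is decided by the signs of
    finitely many affine functions.  Its tangent cone [T] at [(g(xbar), dbar)],
    the tangent cone [W] of [T] at [q] and all normals involved therefore only
    see the row space of a matrix [B] whose rows span [N_P(g(xbar))^+], and the
    two constraint qualifications say that [B Dg(xbar)] and [B b(xbar)] have
    full row rank.  The first rank condition lifts points of [gph N_P] to
    [Omega] by a Lyusternik-Graves argument; the second recovers multipliers
    continuously.  This yields chain rules for the second-order tangent set and
    the normals of any set [{(x, a(x) + b(x)^T v) | (g(x), v) in G}].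
    The second-order tangent set of [Omega] is a translate of a set of the
    same kind built from [W], [Dg(xbar)] and [b(xbar)], which is a cone, so both
    support functions are linear on their domains; a compactness argument then
    identifies these domains and the second subderivative. *)

From HB Require Import structures.
Require Import Defs.
From mathcomp Require Import all_boot all_order all_algebra.
From mathcomp Require Import all_classical all_reals all_analysis.
From mathcomp Require Import ring lra.
Import Order.TTheory GRing.Theory Num.Theory.
Import numFieldNormedType.Exports.

Set Implicit Arguments.
Unset Strict Implicit.
Unset Printing Implicit Defensive.

Local Open Scope classical_set_scope.
Local Open Scope ring_scope.

(** * Matrices, scalar products and sequences *)

(** The first qualification makes only [B Dg(xbar)] surjective, so a point of [gph N_P] can be
    lifted to [Omega] only modulo the kernel of [B]. This is harmless because moving the first
    component along that kernel changes, locally, neither membership in the graph nor the regular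
    normals. Likewise [v b(x)] determines [v] only inside the row space of [B]; multipliers at
    nearby points stay there since [N_P(y)] is contained in [N_P(g(xbar))] for [y] in [P] close to
    [g(xbar)]. Both facts are isolated as alignment. For the second subderivative and the proximal
    normals, the pairing of a covector with a difference quotient of [Omega], divided by the step,
    splits into a term converging to half the support value and the pairing of a normal of [T] at
    [q] with a difference quotient of [gph N_P]. That quotient eventually lies in [T] itself, where
    the pairing is nonpositive near [q] without any error term. For the lower support function,
    every limiting normal of a cone is one at its vertex, and those form a closed set, so passing to
    the liminf creates no new finite values. *)

Section MatrixTopology.
Context {R : realType}.

Lemma mx_entry_le m n (A : 'M[R]_(m, n)) i j : `|A i j| <= `|A|.
Proof. by rewrite [leRHS]/Num.Def.normr /= mx_normrE; exact: (le_bigmax _ _ (i, j)). Qed.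

Lemma mx_norm_leP m n (A : 'M[R]_(m, n)) (c : R) :
  0 <= c -> (forall i j, `|A i j| <= c) -> `|A| <= c.
Proof. by move=> c0 Ac; rewrite /Num.Def.normr /= mx_normrE bigmax_le// => -[i j] _; exact: Ac. Qed.

Lemma mulmx_norm_le m n p (A : 'M[R]_(m, n)) (B : 'M[R]_(n, p)) :
  `|A *m B| <= n%:R * `|A| * `|B|.
Proof.
apply: mx_norm_leP => [|i j]; first by rewrite !mulr_ge0.
rewrite mxE (le_trans (ler_norm_sum _ _ _))//.
rewrite -mulrA mulr_natl -[X in _ *+ X]card_ord -sumr_const ler_sum// => k _.
by rewrite normrM ler_pM// mx_entry_le.
Qed.

Lemma cvg_mxP {T} {F : set_system T} {FF : Filter F} m n
    (u : T -> 'M[R]_(m, n)) (A : 'M[R]_(m, n)) :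
  (forall i j, u k i j @[k --> F] --> A i j) -> u k @[k --> F] --> A.
Proof.
move=> uA; apply/cvgrPdist_le => e e0.
have : \forall k \near F, forall i j, `|A i j - u k i j| <= e.
  apply: filter_forall => i; apply: filter_forall => j.
  by have /cvgrPdist_le/(_ _ e0) := uA i j.
apply: filterS => k H; apply: mx_norm_leP (ltW e0) _ => i j.
by rewrite !mxE H.
Qed.

Lemma cvg_matrixP {T} {F : set_system T} {FF : Filter F} m n
    (a : T -> 'I_m -> 'I_n -> R) (b : 'I_m -> 'I_n -> R) :
  (forall i j, a k i j @[k --> F] --> b i j) ->
  (\matrix_(i, j) a k i j) @[k --> F] --> \matrix_(i, j) b i j.
Proof.
move=> ab; apply: cvg_mxP => i j; rewrite mxE; under eq_fun do rewrite mxE.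
exact: ab.
Qed.

Lemma cvg_entry {T} {F : set_system T} {FF : Filter F} m n
    (u : T -> 'M[R]_(m, n)) (A : 'M[R]_(m, n)) i j :
  u k @[k --> F] --> A -> u k i j @[k --> F] --> A i j.
Proof.
by move=> uA; apply: (cvg_comp u (fun M : 'M[R]_(m, n) => M i j) uA); exact: coord_continuous.
Qed.

Lemma cvg_mulmx {T} {F : set_system T} {FF : Filter F} m n p
    (u : T -> 'M[R]_(m, n)) (v : T -> 'M[R]_(n, p))
    (A : 'M[R]_(m, n)) (B : 'M[R]_(n, p)) :
  u k @[k --> F] --> A -> v k @[k --> F] --> B ->
  u k *m v k @[k --> F] --> A *m B.
Proof.
move=> uA vB; apply: cvg_mxP => i j; rewrite mxE.
under eq_fun do rewrite mxE.
apply: cvg_big => [|k _]; first exact: add_continuous.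
by apply: cvgM; exact: cvg_entry.
Qed.

Lemma cvg_trmx {T} {F : set_system T} {FF : Filter F} m n
    (u : T -> 'M[R]_(m, n)) (A : 'M[R]_(m, n)) :
  u k @[k --> F] --> A -> (u k)^T @[k --> F] --> A^T.
Proof.
move=> uA; apply: cvg_mxP => i j; rewrite mxE; under eq_fun do rewrite mxE.
exact: cvg_entry.
Qed.

Lemma cvg_row_mx {T} {F : set_system T} {FF : Filter F} m n p
    (u : T -> 'M[R]_(m, n)) (v : T -> 'M[R]_(m, p))
    (A : 'M[R]_(m, n)) (B : 'M[R]_(m, p)) :
  u k @[k --> F] --> A -> v k @[k --> F] --> B ->
  row_mx (u k) (v k) @[k --> F] --> row_mx A B.
Proof.
move=> uA vB; apply: cvg_mxP => i j; rewrite mxE; under eq_fun do rewrite mxE.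
by case: (fintype.split j) => h; exact: cvg_entry.
Qed.

Lemma cvg_lsubmx {T} {F : set_system T} {FF : Filter F} m n p
    (u : T -> 'M[R]_(m, n + p)) (A : 'M[R]_(m, n + p)) :
  u k @[k --> F] --> A -> lsubmx (u k) @[k --> F] --> lsubmx A.
Proof.
move=> uA; apply: cvg_mxP => i j; rewrite mxE; under eq_fun do rewrite mxE.
exact: cvg_entry.
Qed.

Lemma cvg_rsubmx {T} {F : set_system T} {FF : Filter F} m n p
    (u : T -> 'M[R]_(m, n + p)) (A : 'M[R]_(m, n + p)) :
  u k @[k --> F] --> A -> rsubmx (u k) @[k --> F] --> rsubmx A.
Proof.
move=> uA; apply: cvg_mxP => i j; rewrite mxE; under eq_fun do rewrite mxE.
exact: cvg_entry.
Qed.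

Lemma lsubmx_norm_le m n p (A : 'M[R]_(m, n + p)) : `|lsubmx A| <= `|A|.
Proof. by apply: mx_norm_leP => // i j; rewrite mxE mx_entry_le. Qed.

End MatrixTopology.

Section DotProduct.
Context {R : realType}.

Lemma dotpE n (u v : 'rV[R]_n) : dotp u v = (u *m v^T) 0 0.
Proof. by rewrite mxE; apply: eq_bigr => i _; rewrite mxE. Qed.

Lemma dotpC n (u v : 'rV[R]_n) : dotp u v = dotp v u.
Proof. by apply: eq_bigr => i _; rewrite mulrC. Qed.

Lemma dotpDl n (u v w : 'rV[R]_n) : dotp (u + v) w = dotp u w + dotp v w.
Proof. by rewrite !dotpE mulmxDl mxE. Qed.

Lemma dotpNl n (u w : 'rV[R]_n) : dotp (- u) w = - (dotp u w).
Proof. by rewrite !dotpE mulNmx mxE. Qed.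

Lemma dotpZl n a (u w : 'rV[R]_n) : dotp (a *: u) w = a * dotp u w.
Proof. by rewrite !dotpE -scalemxAl mxE. Qed.

Lemma dotpDr n (u v w : 'rV[R]_n) : dotp u (v + w) = dotp u v + dotp u w.
Proof. by rewrite ![dotp u _]dotpC dotpDl. Qed.

Lemma dotpNr n (u w : 'rV[R]_n) : dotp u (- w) = - (dotp u w).
Proof. by rewrite ![dotp u _]dotpC dotpNl. Qed.

Lemma dotpZr n a (u w : 'rV[R]_n) : dotp u (a *: w) = a * dotp u w.
Proof. by rewrite ![dotp u _]dotpC dotpZl. Qed.

Lemma dotp0l n (u : 'rV[R]_n) : dotp 0 u = 0.
Proof. by rewrite dotpE mul0mx mxE. Qed.

Lemma dotp0r n (u : 'rV[R]_n) : dotp u 0 = 0.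
Proof. by rewrite dotpC dotp0l. Qed.

Lemma dotp_mulmxl n p (u : 'rV[R]_n) (A : 'M[R]_(n, p)) v :
  dotp (u *m A) v = dotp u (v *m A^T).
Proof. by rewrite !dotpE trmx_mul trmxK mulmxA. Qed.

Lemma dotp_mulmxr n p (u : 'rV[R]_p) (A : 'M[R]_(n, p)) v :
  dotp u (v *m A) = dotp (u *m A^T) v.
Proof. by rewrite dotpC dotp_mulmxl dotpC. Qed.

Lemma dotp_row_mx n p (u u' : 'rV[R]_n) (v v' : 'rV[R]_p) :
  dotp (row_mx u v) (row_mx u' v') = dotp u u' + dotp v v'.
Proof. by rewrite !dotpE tr_row_mx mul_row_col mxE. Qed.

Lemma dotp_delta n (u : 'rV[R]_n) i : dotp u (delta_mx 0 i) = u 0 i.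
Proof.
rewrite /dotp (bigD1 i)//= big1 => [|j ji]; rewrite !mxE ?eqxx ?mulr1 ?addr0//.
by rewrite (negbTE ji) andbF mulr0.
Qed.

Lemma cvg_dotp {T} {F : set_system T} {FF : Filter F} n
    (u v : T -> 'rV[R]_n) (a b : 'rV[R]_n) :
  u k @[k --> F] --> a -> v k @[k --> F] --> b ->
  dotp (u k) (v k) @[k --> F] --> dotp a b.
Proof.
move=> ua vb; rewrite dotpE; under eq_fun do rewrite dotpE.
by apply: cvg_entry; apply: cvg_mulmx => //; exact: cvg_trmx.
Qed.

Lemma dotp_norm_le n (u v : 'rV[R]_n) : `|dotp u v| <= n%:R * `|u| * `|v|.
Proof.
rewrite /dotp (le_trans (ler_norm_sum _ _ _))//.
rewrite -mulrA mulr_natl -[X in _ *+ X]card_ord -sumr_const ler_sum// => k _.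
by rewrite normrM ler_pM// mx_entry_le.
Qed.

Lemma enorm_ge0 n (u : 'rV[R]_n) : 0 <= enorm u.
Proof. exact: sqrtr_ge0. Qed.

Lemma enormZ n a (u : 'rV[R]_n) : enorm (a *: u) = `|a| * enorm u.
Proof.
by rewrite /enorm dotpZl dotpZr mulrA -expr2 sqrtrM ?sqr_ge0// sqrtr_sqr.
Qed.

Lemma enorm0 n : enorm (0 : 'rV[R]_n) = 0.
Proof. by rewrite /enorm dotp0l sqrtr0. Qed.

Lemma norm_le_enorm n (u : 'rV[R]_n) : `|u| <= enorm u.
Proof.
apply: mx_norm_leP (enorm_ge0 u) _ => i j; rewrite ord1 -sqrtr_sqr.
rewrite ler_wsqrtr// /dotp (bigD1 j)//= -expr2 lerDl.
by apply: sumr_ge0 => k _; rewrite -expr2 sqr_ge0.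
Qed.

Lemma enorm_eq0 n (u : 'rV[R]_n) : enorm u = 0 -> u = 0.
Proof. by move=> u0; apply/normr0_eq0/le_anti; rewrite normr_ge0 -u0 norm_le_enorm. Qed.

Lemma enorm_gt0 n (u : 'rV[R]_n) : u != 0 -> 0 < enorm u.
Proof. by rewrite lt0r enorm_ge0 andbT; apply: contra => /eqP/enorm_eq0 ->. Qed.

Lemma cvg_enorm {T} {F : set_system T} {FF : Filter F} n (u : T -> 'rV[R]_n) (a : 'rV[R]_n) :
  u k @[k --> F] --> a -> enorm (u k) @[k --> F] --> enorm a.
Proof. by move=> ua; apply: cvg_comp (cvg_dotp ua ua) _; exact: sqrt_continuous. Qed.

End DotProduct.

Section Sequences.
Context {R : realType}.

Lemma increasing_seq_ge (f : nat -> nat) :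
  {mono f : n m / (n <= m)%N >-> (n <= m)%N} -> forall n, (n <= f n)%N.
Proof.
move=> fi; elim=> // n IH; apply: leq_ltn_trans IH _.
by rewrite ltnNge fi -ltnNge.
Qed.

Lemma cvg_subseq (f : nat -> nat) : (forall n, (n <= f n)%N) ->
  f k @[k --> \oo] --> \oo.
Proof.
move=> fge A [N _ NA]; exists N => // n /= Nn.
by apply: NA => /=; exact: leq_trans (fge n).
Qed.

Lemma cvg_seq_subseq {T : topologicalType} (u : nat -> T) (l : T) (f : nat -> nat) :
  (forall n, (n <= f n)%N) -> u k @[k --> \oo] --> l ->
  u (f k) @[k --> \oo] --> l.
Proof. by move=> /cvg_subseq fo ul; exact: cvg_comp fo ul. Qed.

(** Bolzano-Weierstrass is applied to one coordinate after another; a further subsequence does not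
    destroy the convergence already obtained. *)
Lemma bounded_seq_subseq n (u : nat -> 'rV[R]_n) (M : R) :
  (forall k, `|u k| <= M) ->
  exists (f : nat -> nat) (l : 'rV[R]_n),
    (forall k, (k <= f k)%N) /\ u (f k) @[k --> \oo] --> l.
Proof.
move=> uM.
have [f fi fc] : exists2 f : nat -> nat,
    {mono f : n m / (n <= m)%N >-> (n <= m)%N} &
    forall i, i \in enum 'I_n -> cvgn (fun k => u (f k) 0 i).
  elim: (enum 'I_n) => [|i s [f fi fc]]; first by exists id.
  have [|h hi hc] := @bolzano_weierstrass R (fun k => u (f k) 0 i).
    exists M; split => [|x Mx k _ /=]; first exact: num_real.
    by apply: le_trans (mx_entry_le _ _ _) _; exact: le_trans (uM _) (ltW Mx).
  exists (f \o h) => [a b|j]; first by rewrite /= fi; exact: hi.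
  rewrite inE => /predU1P[->//|js].
  have /cvg_ex[l fl] := fc j js.
  apply/cvg_ex; exists l; apply: (@cvg_seq_subseq _ (fun k => u (f k) 0 j)) => //.
  exact: increasing_seq_ge.
exists f, (\row_i limn (fun k => u (f k) 0 i)); split.
  exact: increasing_seq_ge.
apply: cvg_mxP => i j; rewrite ord1 mxE.
by apply: fc; rewrite mem_enum.
Qed.

Lemma cvg_harmonicE : (k.+1%:R^-1 : R) @[k --> \oo] --> 0.
Proof. exact: cvg_harmonic. Qed.

(** Turns the failure of a local property into a violating sequence, the starting point of the
    compactness arguments. *)
Lemma not_near_seq (V : normedModType R) (a : V) (P : set V) :
  ~ (\forall z \near a, P z) ->
  exists z : nat -> V, z k @[k --> \oo] --> a /\ forall k, ~ P (z k).
Proof.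
move=> nP.
have /choice[z zP] (k : nat) : exists z, `|a - z| < k.+1%:R^-1 /\ ~ P z.
  apply: contrapT => nz; apply: nP.
  apply/nbhs_normP; exists k.+1%:R^-1 => [|z /= az] /=; first by rewrite invr_gt0.
  by apply: contrapT => nPz; apply: nz; exists z.
exists z; split => [|k]; last by case: (zP k).
apply/cvgrPdist_lt => e e0.
have /cvgrPdist_lt/(_ _ e0) := cvg_harmonicE.
apply: filterS => k; rewrite sub0r normrN gtr0_norm ?invr_gt0//.
by apply: lt_trans; case: (zP k).
Qed.

Lemma cvg_shift {T : topologicalType} (u : nat -> T) (l : T) N :
  u k @[k --> \oo] --> l -> u (k + N)%N @[k --> \oo] --> l.
Proof. by move=> ul; apply: cvg_seq_subseq ul => n; rewrite leq_addr. Qed.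

Lemma to0p_shift (t : nat -> R) N : to0p t -> to0p (fun k => t (k + N)%N).
Proof. by move=> [t0 tc]; split=> //; exact: (cvg_shift (u := t)). Qed.

Lemma to0p_subseq (t : nat -> R) f :
  (forall k, (k <= f k)%N) -> to0p t -> to0p (fun k => t (f k)).
Proof. by move=> fge [t0 tc]; split=> //; exact: (cvg_seq_subseq (u := t)). Qed.

Lemma to0p_harmonic (c : R) : 0 < c -> to0p (fun k => c * k.+1%:R^-1).
Proof.
move=> c0; split=> [k|]; first by rewrite mulr_gt0// invr_gt0.
rewrite -(mulr0 c); apply: cvgM cvg_harmonicE; exact: cvg_cst.
Qed.

End Sequences.

(** * Second-order expansions *)

Section Differentiation.
Context {R : realType} {n : nat}.
Implicit Types (x h u : 'rV[R]_n).

Lemma derivable_entry p q (f : 'rV[R]_n -> 'M[R]_(p, q)) x i j :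
  differentiable f x -> differentiable (fun y => f y i j) x.
Proof.
move=> fx; apply: (@differentiable_comp _ _ _ _ f (fun M : 'M[R]_(p, q) => M i j)) => //.
exact: differentiable_coord.
Qed.

Lemma derive_entry p q (f : 'rV[R]_n -> 'M[R]_(p, q)) x v i j :
  differentiable f x -> 'D_v (fun y => f y i j) x = ('D_v f x) i j.
Proof. by move=> fx; rewrite derive_mx ?mxE//; exact: diff_derivable. Qed.

Lemma contdiff_entry p q (f : 'rV[R]_n -> 'M[R]_(p, q)) i j :
  contdiff f -> contdiff (fun x => f x i j).
Proof.
move=> [df cf]; split=> [x|v x]; first exact: derivable_entry.
rewrite /continuous_at derive_entry//.
under eq_fun do rewrite derive_entry//.
apply: (@cvg_entry R _ (nbhs x) _ p q ('D_v f) ('D_v f x) i j).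
exact: cf.
Qed.

Lemma twice_contdiff_entry p q (f : 'rV[R]_n -> 'M[R]_(p, q)) i j :
  twice_contdiff f -> twice_contdiff (fun x => f x i j).
Proof.
move=> [cf c2f]; split=> [|v]; first exact: contdiff_entry.
have -> : (fun x => 'D_v (fun x0 => f x0 i j) x) = (fun x => ('D_v f x) i j).
  by apply/funext => x; rewrite derive_entry//; case: cf.
exact: (contdiff_entry i j (c2f v)).
Qed.

Lemma derive_zero (W : normedModType R) (f : 'rV[R]_n -> W) x :
  differentiable f x -> 'D_0 f x = 0.
Proof. by move=> fx; rewrite deriveE// linear0. Qed.

Lemma derive_scale (W : normedModType R) (f : 'rV[R]_n -> W) x a u :
  differentiable f x -> 'D_(a *: u) f x = a *: 'D_u f x.
Proof. by move=> fx; rewrite !deriveE// linearZ. Qed.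

Lemma derive_scaler (phi : 'rV[R]_n -> R) x a u :
  differentiable phi x -> 'D_(a *: u) phi x = a * 'D_u phi x.
Proof. exact: derive_scale. Qed.

Lemma derive_add (W : normedModType R) (f : 'rV[R]_n -> W) x u v :
  differentiable f x -> 'D_(u + v) f x = 'D_u f x + 'D_v f x.
Proof. by move=> fx; rewrite !deriveE// linearD. Qed.

Definition grad (phi : 'rV[R]_n -> R) x : 'rV[R]_n :=
  \row_i 'D_(delta_mx 0 i : 'rV[R]_n) phi x.

Lemma derive_grad (phi : 'rV[R]_n -> R) x h :
  differentiable phi x -> 'D_h phi x = dotp h (grad phi x).
Proof.
move=> fx; rewrite deriveE// [in LHS](row_sum_delta h) linear_sum.
by apply: eq_bigr => i _; rewrite linearZ/= mxE deriveE.
Qed.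

Lemma cvg_grad {T} {F : set_system T} {FF : Filter F} (phi : 'rV[R]_n -> R)
    (y : T -> 'rV[R]_n) x :
  contdiff phi -> y k @[k --> F] --> x -> grad phi (y k) @[k --> F] --> grad phi x.
Proof.
move=> [_ cf] yx; apply: cvg_mxP => i j; rewrite mxE.
under eq_fun do rewrite mxE.
by apply: (cvg_comp y ('D_(delta_mx 0 j : 'rV[R]_n) phi) yx); exact: cf.
Qed.

(** [contdiff] gives continuity for one fixed direction at a time. Writing each entry as a scalar
    product with [grad], which involves finitely many fixed directions, makes it joint in point and
    direction. *)
Lemma cvg_derive {T} {F : set_system T} {FF : Filter F} p q
    (f : 'rV[R]_n -> 'M[R]_(p, q)) (y h : T -> 'rV[R]_n) x u :
  contdiff f -> y k @[k --> F] --> x -> h k @[k --> F] --> u ->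
  'D_(h k) f (y k) @[k --> F] --> 'D_u f x.
Proof.
move=> cf yx hu; apply: cvg_mxP => i j.
have [df _] := cf.
rewrite -derive_entry// derive_grad; last exact: derivable_entry.
have E k : ('D_(h k) f (y k)) i j = dotp (h k) (grad (fun z => f z i j) (y k)).
  by rewrite -derive_entry// derive_grad//; exact: derivable_entry.
under eq_fun do rewrite E.
by apply: cvg_dotp => //; apply: cvg_grad => //; exact: contdiff_entry.
Qed.

Lemma is_derive_line (phi : 'rV[R]_n -> R) x h (s : R) :
  differentiable phi (x + s *: h) ->
  is_derive s 1 (fun r : R => phi (x + r *: h)) ('D_h phi (x + s *: h)).
Proof.
move=> fx.
have E : (fun t : R => t^-1 *: (((fun r : R => phi (x + r *: h)) \o shift s) (t *: 1)
     - phi (x + s *: h))) = (fun t => t^-1 *: ((phi \o shift (x + s *: h)) (t *: h)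
     - phi (x + s *: h))).
  apply/funext => t /=; congr (_ *: (phi _ - _)).
  by rewrite [t *: 1]mulr1 scalerDl addrCA.
have dh : derivable phi (x + s *: h) h by exact: diff_derivable.
split; first by rewrite /derivable E.
by rewrite /derive E.
Qed.

Lemma mean_value (phi : 'rV[R]_n -> R) x h : (forall y, differentiable phi y) ->
  exists2 s, 0 < s < 1 & phi (x + h) - phi x = 'D_h phi (x + s *: h).
Proof.
move=> df.
have dl (s : R) : is_derive s 1 (fun r : R => phi (x + r *: h)) ('D_h phi (x + s *: h)).
  exact: is_derive_line.
have dl' (s : R) : s \in `]0, 1[%R -> is_derive s 1 (fun r : R => phi (x + r *: h))
    ('D_h phi (x + s *: h)) by [].
have cl : {within `[0, 1], continuous (fun r : R => phi (x + r *: h))}.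
  by apply: derivable_within_continuous => s _; have [] := dl s.
have [s] := MVT ltr01 dl' cl.
rewrite in_itv/= => s01; rewrite subr0 mulr1 scale1r scale0r addr0 => E.
by exists s.
Qed.

Lemma taylor_lagrange2 (phi : 'rV[R]_n -> R) x h : twice_contdiff phi ->
  exists2 s, 0 < s < 1 &
    phi (x + h) = phi x + 'D_h phi x + 2^-1 * 'D_h ('D_h phi) (x + s *: h).
Proof.
move=> [[df _] /(_ h)[ddf _]].
pose a (s : R) : R := phi (x + s *: h); pose b (s : R) : R := 'D_h phi (x + s *: h).
have da (s : R) : is_derive s 1 a (b s) by exact: is_derive_line.
have db (s : R) : is_derive s 1 b ('D_h ('D_h phi) (x + s *: h)) by exact: is_derive_line.
(* [K] is chosen to make [psi 0 = psi 1]. Since [psi' s = (1 - s) (b' s - 2 K)], the zero given by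
   Rolle identifies [2 K] as a second derivative. *)
pose K := a 1 - a 0 - b 0.
pose om (s : R) : R := 1 - s.
pose psi : R -> R := a + om * b + K \*: (om ^+ 2).
have dpsi (s : R) : is_derive s 1 psi ((1 - s) * ('D_h ('D_h phi) (x + s *: h)) - 2 * K * (1 - s)).
  have d1 : is_derive s 1 om (-1) by rewrite -[-1]sub0r; exact: is_deriveB.
  have d2 := @is_deriveM _ _ om b s 1 _ _ d1 (db s).
  have d3 := @is_deriveZ _ _ _ (om ^+ 2) K s 1 _ (@is_deriveX _ _ om 2 s 1 _ d1).
  apply: (is_derive_eq (is_deriveD (is_deriveD (da s) d2) d3)).
  have scE (c d : R) : c *: (d : R^o) = c * d by [].
  rewrite /= expr1 !scE /om; ring.
have dpsi' (s : R) : s \in `]0, 1[%R -> derivable psi s 1 by have [] := dpsi s.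
have cpsi : {within `[0, 1], continuous psi}.
  by apply: derivable_within_continuous => s _; have [] := dpsi s.
have psiE (s : R) : psi s = a s + (1 - s) * b s + K * (1 - s) ^+ 2 by [].
have [|s] := Rolle ltr01 dpsi' cpsi.
  by rewrite !psiE /K subr0 subrr; ring.
rewrite in_itv/= => s01 d0; exists s => //.
have E : 0 = (1 - s) * 'D_h ('D_h phi) (x + s *: h) - 2 * K * (1 - s).
  by case: d0 => _ <-; case: (dpsi s) => _ ->.
have s1 : 1 - s != 0 by rewrite subr_eq0 eq_sym lt_eqF//; case/andP: s01.
have E2 : 'D_h ('D_h phi) (x + s *: h) = 2 * K.
  by apply: (mulfI s1); move/esym/eqP : E; rewrite subr_eq0 => /eqP ->; ring.
rewrite E2 mulKf ?pnatr_eq0// /K /a /b scale1r scale0r addr0; ring.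
Qed.

Lemma derive2_hessian (phi : 'rV[R]_n -> R) x h : twice_contdiff phi ->
  'D_h ('D_h phi) x = dotp h (h *m (hessian phi x)^T).
Proof.
move=> [[df _] ddf].
have -> : 'D_h phi = \sum_i (fun y => h 0 i *: 'D_(delta_mx 0 i : 'rV[R]_n) phi y).
  apply/funext => y; rewrite derive_grad// fct_sumE.
  by apply: eq_bigr => i _; rewrite mxE.
rewrite derive_sum; last first.
  by move=> i; apply: derivableZ; apply: diff_derivable; case: (ddf (delta_mx 0 i)).
rewrite (eq_bigr (fun i => h 0 i * dotp h (grad ('D_(delta_mx 0 i : 'rV[R]_n) phi) x))); last first.
  move=> i _; have dd : differentiable ('D_(delta_mx 0 i : 'rV[R]_n) phi) x.
    by case: (ddf (delta_mx 0 i)).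
  by rewrite deriveZ ?derive_grad//; exact: diff_derivable.
rewrite -dotp_mulmxl dotpC; apply: eq_bigr => i _; rewrite mxE; congr (_ * _).
by apply: eq_bigr => j _; rewrite /grad !mxE.
Qed.

Lemma cvg_hessian {T} {F : set_system T} {FF : Filter F} (phi : 'rV[R]_n -> R)
    (y : T -> 'rV[R]_n) x : twice_contdiff phi ->
  y k @[k --> F] --> x -> hessian phi (y k) @[k --> F] --> hessian phi x.
Proof.
move=> [_ c2] yx.
apply: (@cvg_matrixP _ _ F _ n n (fun k i j => 'D_(delta_mx 0 i : 'rV[R]_n)
    ('D_(delta_mx 0 j : 'rV[R]_n) phi) (y k))).
move=> i j; apply: (cvg_comp y ('D_(delta_mx 0 i : 'rV[R]_n)
  ('D_(delta_mx 0 j : 'rV[R]_n) phi)) yx).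
by case: (c2 (delta_mx 0 j)) => _; exact.
Qed.

Lemma cvg_segment_point (y h : nat -> 'rV[R]_n) (s t : nat -> R) x u :
  y k @[k --> \oo] --> x -> h k @[k --> \oo] --> u -> to0p t ->
  (forall k, 0 < s k < 1) ->
  y k + s k *: (t k *: h k) @[k --> \oo] --> x.
Proof.
move=> yx hu [t0 tc] s01.
rewrite -[X in _ --> X]addr0; apply: cvgD => //.
under eq_fun do rewrite scalerA; rewrite -(scale0r u); apply: cvgZ => //.
apply/cvgrPdist_lt => e e0.
have /cvgrPdist_lt/(_ _ e0) := tc; apply: filterS => k.
rewrite !sub0r !normrN normrM; apply: le_lt_trans.
by rewrite ler_piMl//; case/andP: (s01 k) => a b; rewrite gtr0_norm// ltW.
Qed.

(** The mean value theorem is scalar, so the intermediate points depend on the entry; they all tend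
    to [x], where the gradients are continuous. *)
Lemma first_order_quotient p q (f : 'rV[R]_n -> 'M[R]_(p, q))
    (y h : nat -> 'rV[R]_n) (t : nat -> R) x u :
  contdiff f -> y k @[k --> \oo] --> x -> h k @[k --> \oo] --> u -> to0p t ->
  (t k)^-1 *: (f (y k + t k *: h k) - f (y k)) @[k --> \oo] --> 'D_u f x.
Proof.
move=> cf yx hu tp; have [df _] := cf; apply: cvg_mxP => i j.
have dij z : differentiable (fun y => f y i j) z by exact: derivable_entry.
have /choice[s sP] k : exists s : R, 0 < s < 1 /\
    f (y k + t k *: h k) i j - f (y k) i j =
    'D_(t k *: h k) (fun y => f y i j) (y k + s *: (t k *: h k)).
  by have [s ? ?] := @mean_value (fun y => f y i j) (y k) (t k *: h k) dij; exists s.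
have E k : ((t k)^-1 *: (f (y k + t k *: h k) - f (y k))) i j =
    'D_(h k) (fun y => f y i j) (y k + s k *: (t k *: h k)).
  have [_ E] := sP k; rewrite !mxE E derive_scale// mulKf// gt_eqF//.
  by case: tp.
under eq_fun do rewrite E derive_grad//.
rewrite -derive_entry// derive_grad//.
apply: cvg_dotp => //; apply: cvg_grad; first exact: contdiff_entry.
by apply: (cvg_segment_point yx hu tp) => k; case: (sP k).
Qed.

(** The linear term is taken along the moving direction [h k]: with [u] in its place a remainder
    [2 D_(h k - u) f / t k] would be left, which need not converge. *)
Lemma second_order_quotient p q (f : 'rV[R]_n -> 'M[R]_(p, q))
    (h : nat -> 'rV[R]_n) (t : nat -> R) x u :
  twice_contdiff f -> h k @[k --> \oo] --> u -> to0p t ->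
  (2 * (t k)^-1 ^+ 2) *: (f (x + t k *: h k) - f x - t k *: 'D_(h k) f x)
     @[k --> \oo] --> second_deriv f x u.
Proof.
move=> cf hu tp; have [[df _] _] := cf; apply: cvg_mxP => i j.
have cij : twice_contdiff (fun y => f y i j) by exact: twice_contdiff_entry.
have dij z : differentiable (fun y => f y i j) z by exact: derivable_entry.
have /choice[s sP] k : exists s : R, 0 < s < 1 /\
    f (x + t k *: h k) i j = f x i j + 'D_(t k *: h k) (fun y => f y i j) x +
      2^-1 * 'D_(t k *: h k) ('D_(t k *: h k) (fun y => f y i j)) (x + s *: (t k *: h k)).
  by have [s ? ?] := taylor_lagrange2 x (t k *: h k) cij; exists s.
have E k : ((2 * (t k)^-1 ^+ 2) *: (f (x + t k *: h k) - f x - t k *: 'D_(h k) f x)) i j =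
    dotp (h k) (h k *m (hessian (fun y => f y i j) (x + s k *: (t k *: h k)))^T).
  have [_ E] := sP k; rewrite !mxE E derive_scaler// -derive_entry//.
  rewrite derive2_hessian// -scalemxAl dotpZl dotpZr.
  have tk : t k != 0 by rewrite gt_eqF//; case: tp.
  by field.
under eq_fun do rewrite E; rewrite mxE.
apply: cvg_dotp => //; apply: cvg_mulmx => //; apply: cvg_trmx.
apply: cvg_hessian => //; apply: (cvg_segment_point (cvg_cst x) hu tp) => k.
by case: (sP k).
Qed.

Lemma strict_diff p q (f : 'rV[R]_n -> 'M[R]_(p, q)) x (e : R) :
  contdiff f -> 0 < e ->
  exists2 d : R, 0 < d & forall y z, `|y - x| < d -> `|z - x| < d ->
    `|f y - f z - 'D_(y - z) f x| <= e * `|y - z|.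
Proof.
move=> cf e0; have [df _] := cf.
(* [dotp_norm_le] loses a factor [n]; dividing by [n.+1] compensates it and stays meaningful for
   [n = 0]. *)
have H i j : \forall z \near x, `|grad (fun y => f y i j) x -
    grad (fun y => f y i j) z| < e / n.+1%:R.
  have cg : grad (fun y => f y i j) z @[z --> x] --> grad (fun y => f y i j) x.
    exact: (@cvg_grad _ (nbhs x) _ (fun y => f y i j) id x (contdiff_entry i j cf) cvg_id).
  by move/cvgrPdist_lt : cg; apply; rewrite divr_gt0.
have : \forall z \near x, forall i j, `|grad (fun y => f y i j) x -
    grad (fun y => f y i j) z| < e / n.+1%:R.
  apply: (@filter_forall _ 'I_p _ (nbhs x)) => i.
  by apply: (@filter_forall _ 'I_q _ (nbhs x)) => j; exact: H.
move=> /nbhs_normP[d /= d0 dP].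
exists d => // y z yx zx.
apply: mx_norm_leP => [|i j]; first by rewrite mulr_ge0// ltW.
have dij w : differentiable (fun y => f y i j) w by exact: derivable_entry.
have [s /andP[s0 s1] E] := @mean_value (fun y => f y i j) z (y - z) dij.
rewrite (addrC z) subrK in E.
have -> : (f y - f z - 'D_(y - z) f x) i j = f y i j - f z i j - ('D_(y - z) f x) i j.
  by rewrite !mxE.
rewrite -derive_entry// E !derive_grad// -dotpNr -dotpDr.
set w := grad _ _ + _.
have xi : `|x - (z + s *: (y - z))| < d.
  rewrite (_ : x - _ = (1 - s) *: (x - z) + s *: (x - y)); last first.
    by apply/rowP => k; rewrite !mxE; ring.
  rewrite (le_lt_trans (ler_normD _ _))// !normrZ (gtr0_norm s0) gtr0_norm ?subr_gt0//.
  rewrite -[ltRHS]mul1r -[X in _ < X * d](subrK s) [ltRHS]mulrDl.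
  by rewrite ltrD// ltr_pM2l ?subr_gt0// distrC.
have wd : `|w| <= e / n.+1%:R by rewrite /w -normrN opprB ltW//; exact: dP.
apply: le_trans (dotp_norm_le _ _) _.
apply: (@le_trans _ _ (n%:R * `|y - z| * (e / n.+1%:R))).
  by rewrite ler_wpM2l// mulr_ge0.
rewrite [leLHS](_ : _ = n%:R / n.+1%:R * (e * `|y - z|)); last by ring.
by rewrite ler_piMl ?mulr_ge0 ?(ltW e0)// ler_pdivrMr// mul1r ler_nat.
Qed.

Lemma jacobianE p (g : 'rV[R]_n -> 'rV[R]_p) x u :
  differentiable g x -> u *m 'J g x = 'D_u g x.
Proof. by move=> dg; rewrite deriveEjacobian. Qed.

Lemma cvg_jacobian {T} {F : set_system T} {FF : Filter F} p
    (g : 'rV[R]_n -> 'rV[R]_p) (y : T -> 'rV[R]_n) x :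
  contdiff g -> y k @[k --> F] --> x -> 'J g (y k) @[k --> F] --> 'J g x.
Proof.
move=> cg yx; have [dg _] := cg.
have E z : 'J g z = \matrix_(i, j) ('D_(delta_mx 0 i : 'rV[R]_n) g z) 0 j.
  by apply/matrixP => i j; rewrite [RHS]mxE -jacobianE// -rowE [RHS]mxE.
rewrite (E x) (_ : (fun k => 'J g (y k)) = (fun k =>
  \matrix_(i, j) ('D_(delta_mx 0 i : 'rV[R]_n) g (y k)) 0 j)); last exact/funext.
apply: cvg_matrixP => i j.
by apply: cvg_entry; apply: cvg_derive => //; exact: cvg_cst.
Qed.

End Differentiation.

(** * Stability of full row rank and local solvability *)

Section LinearAlgebra.
Context {R : realType}.

Lemma row_free_kernel m n (A : 'M[R]_(m, n)) :
  (forall u : 'rV[R]_m, u *m A = 0 -> u = 0) -> row_free A.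
Proof.
move=> Ai; rewrite -kermx_eq0; apply/eqP/row_matrixP => i; rewrite row0.
by apply: Ai; rewrite -row_mul mulmx_ker row0.
Qed.

Lemma norm_trmx m n (A : 'M[R]_(m, n)) : `|A^T| = `|A|.
Proof.
have H p q (M : 'M[R]_(p, q)) : `|M^T| <= `|M|.
  by apply: mx_norm_leP => // i j; rewrite mxE mx_entry_le.
by apply/le_anti; rewrite H -{1}(trmxK A) H.
Qed.

(** With the factor [s] of [mulmx_norm_le], the assumption says that multiplication by [1 - X]
    halves the maximum norm. *)
Lemma near_id_unitmx s (X : 'M[R]_s) : s%:R * `|1%:M - X| <= 2^-1 ->
  X \in unitmx /\ forall u : 'rV[R]_s, `|u| <= 2 * `|u *m X|.
Proof.
move=> X1.
have H (u : 'rV[R]_s) : `|u| <= 2 * `|u *m X|.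
  have : `|u| <= `|u *m X| + 2^-1 * `|u|.
    rewrite -{1}[u](mulmx1) -{1}(subrK X 1%:M) addrC mulmxDr.
    apply: le_trans (ler_normD _ _) _; rewrite lerD2l.
    apply: le_trans (mulmx_norm_le _ _) _.
    by rewrite mulrAC ler_wpM2r.
  by lra.
split=> //; rewrite -row_free_unit; apply: row_free_kernel => u uX.
by apply/normr0_eq0/le_anti; rewrite normr_ge0 (le_trans (H u))// uX normr0 mulr0.
Qed.

(** A right inverse [N] of [A] makes [a k *m N] close to the identity, hence invertible with inverse
    bounded by 2. One constant then serves both injectivity of [a k] and bounded solvability with
    its transpose, uniformly near the limit. *)
Lemma row_free_stable {T} {F : set_system T} {FF : Filter F} s m
    (A : 'M[R]_(s, m)) (a : T -> 'M[R]_(s, m)) :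
  row_free A -> a k @[k --> F] --> A ->
  exists2 kap : R, 0 < kap & \forall k \near F,
    (forall u : 'rV[R]_s, `|u| <= kap * `|u *m a k|) /\
    (forall e : 'rV[R]_s, exists2 d : 'rV[R]_m, d *m (a k)^T = e & `|d| <= kap * `|e|).
Proof.
move=> /row_freeP[N AN] aA.
(* The first summand bounds the inverse, the second the size of solutions, and the last keeps the
   constant positive. *)
exists (2 * (m%:R * `|N|) + 2 * (s%:R * `|N|) + 1).
  by rewrite ltr_wpDl// addr_ge0// !mulr_ge0.
have aN : a k *m N @[k --> F] --> (1%:M : 'M[R]_s) by rewrite -AN; apply: cvg_mulmx => //; exact: cvg_cst.
have e0 : 0 < (2 * s.+1%:R)^-1 :> R by rewrite invr_gt0 mulr_gt0.
have := (cvgrPdist_lt _ _).1 aN _ e0 => /(_ FF).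
apply: filterS => k ak.
have X1 : s%:R * `|1%:M - a k *m N| <= 2^-1.
  apply: (@le_trans _ _ (s%:R * (2 * s.+1%:R)^-1)); first by rewrite ler_wpM2l// ltW.
  by rewrite invfM mulrCA ler_piMr// ler_pdivrMr// mul1r ler_nat.
have X1' : s%:R * `|1%:M - (a k *m N)^T| <= 2^-1.
  by rewrite -[1%:M]trmx1 -linearB/= norm_trmx.
have [_ H] := near_id_unitmx X1; have [U H'] := near_id_unitmx X1'.
split=> [u|e].
  apply: le_trans (H u) _; rewrite mulmxA -!addrA [leRHS]mulrDl.
  apply: (@le_trans _ _ (2 * (m%:R * `|N|) * `|u *m a k|)).
    by rewrite -mulrA ler_wpM2l// (le_trans (mulmx_norm_le _ _))// mulrAC.
  by rewrite lerDl mulr_ge0// addr_ge0// !mulr_ge0.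
exists (e *m invmx (a k *m N)^T *m N^T).
  by rewrite -mulmxA -trmx_mul mulmxKV.
set u := e *m _.
have ue : `|u| <= 2 * `|e| by rewrite (le_trans (H' u))// mulmxKV.
apply: le_trans (mulmx_norm_le _ _) _; rewrite norm_trmx.
apply: (@le_trans _ _ (s%:R * (2 * `|e|) * `|N|)).
  by rewrite ler_wpM2r// ler_wpM2l.
rewrite (_ : s%:R * _ * _ = 2 * (s%:R * `|N|) * `|e|); last by ring.
rewrite ler_wpM2r// -addrA [leRHS]addrCA lerDl addr_ge0// !mulr_ge0//.
Qed.

(** Joins completeness to the normed structure of matrices, as the Banach fixed point theorem in
    [local_solve] requires. *)
HB.instance Definition _ (m n : nat) :=
  Uniform_isComplete.Build 'M[R]_(m, n) cauchy_cvg.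

(** Lyusternik-Graves estimate, uniform in the starting point [x]. The correction is sought in the
    row space of a right inverse [E] of the projected derivative, which leaves a fixed point problem
    in dimension [s]. *)
Lemma local_solve n l s (g : 'rV[R]_n -> 'rV[R]_l) (B : 'M[R]_(s, l)) x0 :
  contdiff g -> row_free (B *m ('J g x0)^T) ->
  exists kap del : R, [/\ 0 < kap, 0 < del & forall (x : 'rV[R]_n) (y : 'rV[R]_l),
    `|x - x0| < del -> `|y - g x| < del ->
    exists2 x' : 'rV[R]_n, `|x' - x| <= kap * `|y - g x| & g x' *m B^T = y *m B^T].
Proof.
move=> cg /row_freeP[N BJN].
have [dg _] := cg.
set E := N^T.
have EJ : E *m 'J g x0 *m B^T = 1%:M.
  by apply: trmx_inj; rewrite !trmx_mul !trmxK trmx1 mulmxA BJN.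
set K : R := s%:R * `|E|; set L : R := l%:R * `|B^T|.
have K0 : 0 <= K by rewrite mulr_ge0.
have L0 : 0 <= L by rewrite mulr_ge0.
have LK0 : 0 <= L * K by rewrite mulr_ge0.
(* Makes [L * K * e] at most one half; this product will be the Lipschitz constant of [F]. *)
pose e := (2 * (L * K + 1))^-1.
have e0 : 0 < e by rewrite invr_gt0 mulr_gt0// ltr_wpDl.
have := strict_diff x0 cg e0.
move=> [d d0 dP].
have kap0 : 0 < 2 * (L * K) + 1 by rewrite ltr_wpDl// mulr_ge0.
(* The fixed point satisfies [|z E| <= 2 L K be], whence the first constant. The second leaves half
   of [d] for [x - x0] and half for [z E]. *)
exists (2 * (L * K) + 1), (d / (2 * (2 * (L * K) + 1))); split=> //.
  by rewrite divr_gt0// mulr_gt0.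
set del := d / _ => x y xx0 yx.
have del2 : del <= d / 2.
  rewrite ler_wpM2l ?(ltW d0)// lef_pV2 ?posrE// ?mulr_gt0//.
  by rewrite ler_peMr// lerDr mulr_ge0.
set be := `|y - g x|; have be0 : 0 <= be by exact: normr_ge0.
(* The radius is twice the bound [L * be] on [|F 0|], so that a map contracting by one half sends
   this ball into itself. *)
pose U := [set z : 'rV[R]_s | `|z| <= 2 * (L * be)].
have zE (z : 'rV[R]_s) : U z -> `|z *m E| <= 2 * (L * K) * be.
  move=> Uz; apply: le_trans (mulmx_norm_le _ _) _.
  rewrite mulrAC -/K (_ : 2 * (L * K) * be = K * (2 * (L * be))); last by ring.
  by rewrite ler_wpM2l.
have zEd (z : 'rV[R]_s) : U z -> `|x + z *m E - x0| < d.
  move=> Uz; rewrite addrAC (le_lt_trans (ler_normD _ _))// [ltRHS](splitr d) ltr_leD//.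
    exact: lt_le_trans xx0 del2.
  apply: le_trans (zE z Uz) _.
  apply: (@le_trans _ _ ((2 * (L * K) + 1) * del)).
    by rewrite ler_pM ?mulr_ge0// ?lerDl// ltW.
  rewrite (_ : _ * del = d / 2)// /del; field.
  by rewrite gt_eqF.
(* Newton iteration with the derivative frozen at [x0], where [E] turns it into the identity; fixed
   points solve the projected equation. *)
pose F z := z - (g (x + z *m E) *m B^T - y *m B^T).
have Flip z z' : U z -> U z' -> `|F z - F z'| <= 2^-1 * `|z - z'|.
  move=> Uz Uz'.
  have -> : F z - F z' = - ((g (x + z *m E) - g (x + z' *m E) -
      'D_((x + z *m E) - (x + z' *m E)) g x0) *m B^T).
    rewrite -jacobianE// (_ : _ - (x + _) = (z - z') *m E); last first.
      by rewrite mulmxBl opprD addrACA subrr add0r.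
    rewrite mulmxBl -2!(mulmxA (z - z')) EJ mulmx1 mulmxBl /F.
    by apply/rowP => j; rewrite !mxE; ring.
  rewrite normrN; apply: le_trans (mulmx_norm_le _ _) _.
  rewrite mulrAC -/L; apply: (@le_trans _ _ (L * (e * (K * `|z - z'|)))).
    rewrite ler_wpM2l//; apply: le_trans (dP _ _ (zEd z Uz) (zEd z' Uz')) _.
    rewrite ler_wpM2l ?(ltW e0)//.
    rewrite (_ : _ - (x + _) = (z - z') *m E); last first.
      by rewrite mulmxBl opprD addrACA subrr add0r.
    by rewrite /K mulrAC mulmx_norm_le.
  rewrite (_ : L * _ = (L * K * e) * `|z - z'|); last by ring.
  rewrite ler_wpM2r// /e invfM mulrCA ler_piMr ?invr_ge0//.
  by rewrite ler_pdivrMr ?ltr_wpDl// mul1r lerDl.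
have U0 : U 0 by rewrite /U /= normr0 !mulr_ge0.
have F0 : `|F 0| <= L * be.
  rewrite /F mul0mx addr0 sub0r opprB -mulmxBl.
  by apply: le_trans (mulmx_norm_le _ _) _; rewrite mulrAC.
have FU : set_fun U U F.
  move=> z Uz; rewrite /U /= -(subrK (F 0) (F z)) (le_trans (ler_normD _ _))//.
  have := Flip z 0 Uz U0; rewrite subr0 => Fz.
  have := Uz; rewrite /U /= => Uz'; lra.
have ctr : is_contraction (mkfun FU : {fun U >-> U}).
  have h0 : 0 <= 2^-1 :> R by [].
  exists (NngNum h0); split => /=; first by lra.
  by move=> -[z z'] [Uz Uz'] /=; exact: Flip.
have clU : closed U.
  have -> : U = closed_ball_ Num.Def.normr 0 (2 * (L * be)).
    by apply/seteqP; split=> z; rewrite /U /closed_ball_ /= sub0r normrN.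
  exact: closed_closed_ball_.
have [z Uz Fz] := banach_fixed_point ctr clU (ex_intro _ _ U0).
exists (x + z *m E).
  rewrite addrC addKr (le_trans (zE z Uz))// ler_wpM2r// lerDl.
  exact: ler01.
apply/eqP; rewrite -subr_eq0; apply/eqP.
by move: Fz; rewrite /= /F => /eqP; rewrite eq_sym subr_eq addrC -subr_eq subrr eq_sym => /eqP.
Qed.

End LinearAlgebra.

(** * Tangent and normal cones of conic sets *)

Section SequentialClosedness.
Context {R : realType} {k : nat}.
Implicit Types (C D : set 'rV[R]_k) (z u v p q : 'rV[R]_k).

Lemma near0_scale (e : R) (t : nat -> R) (us : nat -> 'rV[R]_k) u : 0 < e ->
  to0p t -> us i @[i --> \oo] --> u -> \forall i \near \oo, `|t i *: us i| < e.
Proof.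
move=> e0 [_ tc] usu; have : t i *: us i @[i --> \oo] --> (0 *: u).
  exact: cvgZ.
by rewrite scale0r => /cvgr0_norm_lt; exact.
Qed.

Lemma closed_seq C u (us : nat -> 'rV[R]_k) : closed C ->
  us i @[i --> \oo] --> u -> (\forall i \near \oo, C (us i)) -> C u.
Proof. by move=> cC usu Cus; exact: (@closed_cvg nat _ \oo _ us C cC Cus u usu). Qed.

Lemma seq_closed C :
  (forall (us : nat -> 'rV[R]_k) u, us i @[i --> \oo] --> u ->
     (forall i, C (us i)) -> C u) -> closed C.
Proof.
move=> H p clp.
have [us [usp Cus]] : exists us : nat -> 'rV[R]_k, us i @[i --> \oo] --> p /\
    forall i, ~ ~ C (us i).
  apply: (@not_near_seq _ _ p (fun z => ~ C z)) => nC.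
  by have [z [/= Cz nCz]] := clp _ nC.
by apply: (H us p usp) => i; apply: contrapT.
Qed.

End SequentialClosedness.

Section Cones.
Context {R : realType} {k : nat}.
Implicit Types (C D T W : set 'rV[R]_k) (z u v p q : 'rV[R]_k).

(** The definitions ask for membership at every index, while the arguments yield it eventually; here
    and in the next two lemmas the initial terms are dropped. *)
Lemma tangent_coneI C z u (t : nat -> R) (us : nat -> 'rV[R]_k) :
  to0p t -> us i @[i --> \oo] --> u ->
  (\forall i \near \oo, C (z + t i *: us i)) -> tangent_cone C z u.
Proof.
move=> tp usu [N _ NC]; exists (fun i => t (i + N)%N), (fun i => us (i + N)%N).
split; [exact: to0p_shift|exact: (cvg_shift (u := us))|move=> i].
by apply: NC; rewrite /= leq_addl.
Qed.

Lemma second_tangent_setI C z u w (t : nat -> R) (ws : nat -> 'rV[R]_k) :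
  to0p t -> ws i @[i --> \oo] --> w ->
  (\forall i \near \oo, C (z + t i *: u + (2^-1 * t i ^+ 2) *: ws i)) ->
  second_tangent_set C z u w.
Proof.
move=> tp usu [N _ NC]; exists (fun i => t (i + N)%N), (fun i => ws (i + N)%N).
split; [exact: to0p_shift|exact: (cvg_shift (u := ws))|move=> i].
by apply: NC; rewrite /= leq_addl.
Qed.

Lemma directional_normalI C z u v (t : nat -> R) (us vs : nat -> 'rV[R]_k) :
  to0p t -> us i @[i --> \oo] --> u -> vs i @[i --> \oo] --> v ->
  (\forall i \near \oo, regular_normal_cone C (z + t i *: us i) (vs i)) ->
  directional_normal_cone C z u v.
Proof.
move=> tp usu vsv [N _ NC].
exists (fun i => t (i + N)%N), (fun i => us (i + N)%N), (fun i => vs (i + N)%N).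
split; [exact: to0p_shift|exact: (cvg_shift (u := us))|exact: (cvg_shift (u := vs))|].
by move=> i; apply: NC; rewrite /= leq_addl.
Qed.

Lemma tangent_cone_scale C z u (c : R) : 0 < c ->
  tangent_cone C z u -> tangent_cone C z (c *: u).
Proof.
move=> c0 [t [us [tp usu Cus]]].
exists (fun i => t i / c), (fun i => c *: us i); split.
- case: tp => t0 tc; split=> [i|]; first by rewrite divr_gt0.
  by rewrite -(mul0r c^-1); apply: cvgM => //; exact: cvg_cst.
- by apply: cvgZ => //; exact: cvg_cst.
- by move=> i; rewrite scalerA divfK ?gt_eqF.
Qed.

Lemma tangent_cone_scaleE C z u (c : R) : 0 < c ->
  tangent_cone C z (c *: u) <-> tangent_cone C z u.
Proof.
move=> c0; split; last exact: tangent_cone_scale.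
move=> /(tangent_cone_scale (c := c^-1)); rewrite invr_gt0 => /(_ c0).
by rewrite scalerA mulVf ?gt_eqF// scale1r.
Qed.

Lemma tangent_cone0 C z : C z -> tangent_cone C z 0.
Proof.
move=> Cz; exists (fun i => 1 * i.+1%:R^-1), (fun=> 0); split.
- exact: to0p_harmonic.
- exact: cvg_cst.
- by move=> i; rewrite scaler0 addr0.
Qed.

(* Lets the chain rule for second-order tangent sets cover tangent cones. *)
Lemma tangent_second C z : tangent_cone C z = second_tangent_set C z 0.
Proof.
apply/seteqP; split=> u [t [us [[t0 tc] usu Cus]]].
  exists (fun i => Num.sqrt (2 * t i)), us; split=> //.
    split=> [i|]; first by rewrite sqrtr_gt0 mulr_gt0.
    rewrite -(@sqrtr0 R) -(mulr0 2).
    apply: (cvg_comp (fun i => 2 * t i) Num.sqrt); last exact: sqrt_continuous.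
    by apply: cvgM => //; exact: cvg_cst.
  by move=> i; rewrite scaler0 addr0 sqr_sqrtr ?mulKf// mulr_ge0// ltW.
exists (fun i => 2^-1 * t i ^+ 2), us; split=> //.
  split=> [i|]; first by rewrite mulr_gt0// exprn_gt0.
  rewrite -(mulr0 2^-1) -(mulr0 0); apply: cvgM; first exact: cvg_cst.
  exact: cvgM.
by move=> i; have := Cus i; rewrite scaler0 addr0.
Qed.

(** If the first-order inequality fails along a sequence, the normalised differences have a
    convergent subsequence, whose limit is a tangent with positive product with [v]. All
    computations with regular normals are reduced to tangent cones through this duality. *)
Lemma regular_normal_polar C z v : regular_normal_cone C z v <->
  C z /\ forall u, tangent_cone C z u -> dotp v u <= 0.
Proof.
split=> [[Cz Nv]|[Cz polv]]; split=> //.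
  move=> u [t [us [tp usu Cus]]].
  suff H (e : R) : 0 < e -> dotp v u <= e * enorm u.
    have := enorm_ge0 u; rewrite le_eqVlt => /predU1P[eu0|eu0].
      by rewrite (enorm_eq0 (esym eu0)) dotp0r.
    rewrite leNgt; apply/negP => vu0.
    have := H (dotp v u / 2 / enorm u); rewrite divfK ?gt_eqF// !divr_gt0// => /(_ isT).
    by lra.
  move=> e0.
  apply: (@ler_cvg_to _ \oo _ _ (fun i => dotp v (us i)) (fun i => e * enorm (us i))).
  - by apply: cvg_dotp => //; exact: cvg_cst.
  - by apply: cvgM; [exact: cvg_cst|exact: cvg_enorm].
  - have zc : z + t i *: us i @[i --> \oo] --> z.
      rewrite -[X in _ --> X]addr0; apply: cvgD; first exact: cvg_cst.
      by rewrite -(scale0r u); apply: cvgZ => //; case: tp.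
    have : \forall i \near \oo, C (z + t i *: us i) ->
        dotp v (z + t i *: us i - z) <= e * enorm (z + t i *: us i - z).
      exact: (zc _ (Nv e e0)).
    apply: filterS => i /(_ (Cus i)).
    have t0 : 0 < t i by case: tp.
    rewrite addrC addKr dotpZr enormZ gtr0_norm// mulrCA.
    by rewrite ler_pM2l.
move=> e e0; apply: contrapT => /not_near_seq[zs [zsz H]].
have Hk i : C (zs i) /\ e * enorm (zs i - z) < dotp v (zs i - z).
  move: (H i) => /not_implyP[? /negP]; by rewrite -ltNge.
have dz i : 0 < `|zs i - z|.
  rewrite normr_gt0; apply/eqP => zz; have [_] := Hk i.
  by rewrite zz enorm0 dotp0r mulr0 ltxx.
pose us i := `|zs i - z|^-1 *: (zs i - z).
have us1 i : `|us i| = 1.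
  by rewrite /us normrZ normfV normr_id mulVf// gt_eqF.
have [f [u [fge usu]]] : exists f u, (forall k, (k <= f k)%N) /\
    us (f i) @[i --> \oo] --> u.
  by apply: (@bounded_seq_subseq _ _ us 1) => i; rewrite us1.
have Tu : tangent_cone C z u.
  exists (fun i => `|zs (f i) - z|), (fun i => us (f i)); split=> //.
    split=> [i|]; first exact: dz.
    rewrite -[0](@normr0 _ 'rV[R]_k) -(subrr z).
    apply: cvg_norm; apply: cvgB; last exact: cvg_cst.
    exact: (cvg_seq_subseq (u := zs)).
  move=> i; rewrite /us scalerA mulfV ?gt_eqF// scale1r addrC subrK.
  by case: (Hk (f i)).
have u1 : `|u| = 1.
  have c1 : `|us (f i)| @[i --> \oo] --> (1 : R).
    by under eq_fun do rewrite us1; exact: cvg_cst.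
  by apply: (@cvg_unique _ _ (`|us (f i)| @[i --> \oo])) => //; exact: cvg_norm.
have : e * enorm u <= dotp v u.
  apply: (@ler_cvg_to _ \oo _ _ (fun i => e * enorm (us (f i))) (fun i => dotp v (us (f i)))).
  - by apply: cvgM; [exact: cvg_cst|exact: cvg_enorm].
  - by apply: cvg_dotp => //; exact: cvg_cst.
  - near=> i; rewrite enormZ dotpZr mulrCA normfV normr_id.
    by rewrite ler_pM2l ?invr_gt0//; apply: ltW; case: (Hk (f i)).
have := polv u Tu; have := norm_le_enorm u; rewrite u1 => h1 h2 h3.
have : 0 < e * enorm u by rewrite mulr_gt0// (lt_le_trans _ h1).
by lra.
Unshelve. all: by end_near. Qed.

(** Regular normals depend only on the germ of the set up to positive scaling. The factor [s] serves
    to compare [C] at [z + t q] with its tangent cone at [q]. *)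
Lemma regular_normal_local C D z z' (s : R) v : 0 < s ->
  (exists2 e : R, 0 < e & forall p, `|p| < e -> (C (z + s *: p) <-> D (z' + p))) ->
  regular_normal_cone C z v <-> regular_normal_cone D z' v.
Proof.
move=> s0 [e e0 H].
have CD : C z <-> D z'.
  by have := H 0; rewrite normr0 scaler0 !addr0; exact.
have TT u : tangent_cone C z u <-> tangent_cone D z' u.
  split=> -[t [us [tp usu Cus]]].
    have tp' : to0p (fun i => t i / s).
      case: tp => t0 tc; split=> [i|]; first by rewrite divr_gt0.
      by rewrite -(mul0r s^-1); apply: cvgM => //; exact: cvg_cst.
    apply: (tangent_coneI tp' usu).
    have := near0_scale e0 tp' usu; apply: filterS => i /H[+ _]; apply.
    by rewrite scalerA mulrC divfK ?gt_eqF.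
  have tp' : to0p (fun i => s * t i).
    case: tp => t0 tc; split=> [i|]; first by rewrite mulr_gt0.
    by rewrite -(mulr0 s); apply: cvgM => //; exact: cvg_cst.
  apply: (tangent_coneI tp' usu).
  have := near0_scale e0 tp usu; apply: filterS => i /H[_ +].
  by rewrite scalerA; apply.
rewrite !regular_normal_polar; split=> -[Cz pol]; (split; first exact/CD) => u /TT;
  exact: pol.
Qed.

Lemma cone_regular_normal_perp D p v :
  (forall (s : R) x, 0 < s -> D x -> D (s *: x)) ->
  regular_normal_cone D p v -> dotp v p = 0.
Proof.
move=> Ds /regular_normal_polar[Dp pol].
(* The factor one half keeps [1 - t] positive also at the first index, so that both [p] and [- p]
   are tangent to the cone at [p]. *)
have tp : to0p (fun i => 2^-1 * i.+1%:R^-1 : R) by exact: to0p_harmonic.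
have t1 i : (2^-1 * i.+1%:R^-1 : R) < 1.
  rewrite mulrC ltr_pdivrMr// mul1r (@le_lt_trans _ _ 1) ?ltr1n//.
  by rewrite invf_le1// ler1n.
have Tp : tangent_cone D p p.
  exists (fun i => 2^-1 * i.+1%:R^-1), (fun=> p); split=> //; first exact: cvg_cst.
  move=> i; rewrite -{1}[p]scale1r -scalerDl; apply: Ds => //.
have TNp : tangent_cone D p (- p).
  exists (fun i => 2^-1 * i.+1%:R^-1), (fun=> - p); split=> //; first exact: cvg_cst.
  move=> i; rewrite scalerN -{1}[p]scale1r -scalerBl; apply: Ds => //.
  by rewrite subr_gt0.
apply/le_anti; rewrite pol//= -oppr_le0 -dotpNr; exact: pol.
Qed.

(** Says that [C - z] agrees with a cone near the origin: factors [s <= 1] never leave the ball, and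
    the equivalence covers enlarging as well as shrinking. *)
Definition conic_at C z := exists2 e : R, 0 < e &
  forall p (s : R), `|p| < e -> 0 < s <= 1 -> (C (z + p) <-> C (z + s *: p)).

(** Conicity removes the factor [t i] from [z + t i *: us i]; closedness then lets [us i] tend to
    [p]. *)
Lemma conic_tangent C z : closed C -> conic_at C z ->
  exists2 e : R, 0 < e & forall p, `|p| < e -> (C (z + p) <-> tangent_cone C z p).
Proof.
move=> cC [e e0 cone]; exists e => // p pe; split=> [Czp|[t [us [tp usp Cus]]]].
  exists (fun i => 1 * i.+1%:R^-1), (fun=> p); split=> [||i].
  - exact: to0p_harmonic.
  - exact: cvg_cst.
  - by apply: (iffLR (cone p _ pe _)) => //; rewrite mul1r invr_gt0 ltr0n/= invf_le1// ler1n.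
apply: (@closed_seq _ _ C (z + p) (fun i => z + us i) cC).
  by apply: cvgD => //; exact: cvg_cst.
have [t0 tc] := tp.
have h1 : \forall i \near \oo, `|us i| < e.
  exact: (cvgr_norm_lt _ usp).
have h2 : \forall i \near \oo, t i < 1 by apply: (cvgr_lt _ tc); exact: ltr01.
near=> i; apply/(cone (us i) (t i)) => //.
- by near: i.
- by rewrite t0 ltW//; near: i.
Unshelve. all: by end_near. Qed.

Lemma scale_small p (e : R) : 0 < e -> exists2 s : R, 0 < s <= 1 & s * `|p| < e.
Proof.
move=> e0; exists (Num.min 1 (e / (`|p| + 1))).
  by rewrite lt_min ltr01/= divr_gt0 ?ltr_wpDl//= ge_min lexx.
apply: (@le_lt_trans _ _ (e / (`|p| + 1) * `|p|)).
  by rewrite ler_wpM2r// ge_min lexx orbT.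
rewrite mulrAC ltr_pdivrMr ?ltr_wpDl// ltr_pM2l// ltrDl; exact: ltr01.
Qed.

Lemma tangent_cone_closed C z : closed C -> conic_at C z ->
  closed (tangent_cone C z).
Proof.
move=> cC /(conic_tangent cC)[e e0 CT]; apply: seq_closed => us u usu Tus.
have [s /andP[s0 s1] sp] := scale_small u e0.
have su : `|s *: u| < e by rewrite normrZ gtr0_norm.
apply/(tangent_cone_scaleE _ _ _ s0); apply/CT => //.
have ssu : s *: us i @[i --> \oo] --> s *: u by apply: cvgZ => //; exact: cvg_cst.
apply: (@closed_seq _ _ C _ (fun i => z + s *: us i) cC).
  by apply: cvgD => //; exact: cvg_cst.
have : \forall i \near \oo, `|s *: us i| < e by exact: (cvgr_norm_lt _ ssu).
by apply: filterS => i sue; apply/CT => //; exact: tangent_cone_scale.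
Qed.

(** As [q] may be large, it is first scaled to [s q], inside the ball where [C - z] and the tangent
    cone coincide; conicity at [q] is then that of [C] at [z + s q]. *)
Lemma tangent_cone_conic C z q : closed C -> (forall z', conic_at C z') ->
  conic_at (tangent_cone C z) q.
Proof.
move=> cC Ccon; have [e e0 CT] := conic_tangent cC (Ccon z).
have [s /andP[s0 s1] sq] := scale_small q (divr_gt0 e0 (@ltr0n R 2)).
have [e' e'0 con'] := Ccon (z + s *: q).
exists (Num.min (e / 2) e') => [|p r pm r01]; first by rewrite lt_min e'0 divr_gt0.
have pe : `|p| < e / 2 by apply: lt_le_trans pm _; rewrite ge_min lexx.
have pe' : `|p| < e' by apply: lt_le_trans pm _; rewrite ge_min lexx orbT.
have H (w : 'rV[R]_k) : `|w| < e / 2 -> tangent_cone C z (q + w) <-> C (z + s *: q + s *: w).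
  move=> we; rewrite -(tangent_cone_scaleE C z (q + w) s0) scalerDr -addrA; apply: iff_sym.
  apply: CT; rewrite (le_lt_trans (ler_normD _ _))// !normrZ gtr0_norm// [ltRHS]splitr.
  by rewrite ltrD// (le_lt_trans _ we)// ler_piMl.
have [r0 r1] := andP r01.
rewrite H// H; last first.
  by rewrite normrZ gtr0_norm// (le_lt_trans _ pe)// ler_piMl.
rewrite [s *: (r *: p)]scalerA mulrC -scalerA; apply: con' => //.
by rewrite normrZ gtr0_norm// (le_lt_trans _ pe')// ler_piMl.
Qed.

(** A parabolic arc is [z + t (q + (t / 2) w)]: dividing by [t] passes from [C] to [T], dividing by
    [t / 2] passes from [T] at [q] to [W]. For small [t] membership is thus equivalent to [W w]. *)
Lemma second_tangent_conic C z q : closed C -> (forall z', conic_at C z') ->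
  second_tangent_set C z q = tangent_cone (tangent_cone C z) q.
Proof.
move=> cC Ccon; set T := tangent_cone C z; set W := tangent_cone T q.
have cT : closed T by exact: tangent_cone_closed.
have Tcon : conic_at T q by exact: tangent_cone_conic.
have [e1 e10 CT] := conic_tangent cC (Ccon z).
have [e2 e20 TW] := conic_tangent cT Tcon.
have cW : closed W by exact: tangent_cone_closed.
have H (t : nat -> R) (ws : nat -> 'rV[R]_k) (w : 'rV[R]_k) : to0p t -> ws i @[i --> \oo] --> w ->
    \forall i \near \oo, C (z + t i *: q + (2^-1 * t i ^+ 2) *: ws i) <-> W (ws i).
  move=> tp wsw; have [t0 tc] := tp.
  have tw : (2^-1 * t i) *: ws i @[i --> \oo] --> (0 : 'rV[R]_k).
    rewrite -(scale0r w) -(mulr0 2^-1); apply: cvgZ => //.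
    by apply: cvgM => //; exact: cvg_cst.
  have qtw : q + (2^-1 * t i) *: ws i @[i --> \oo] --> q.
    by rewrite -[X in _ --> X]addr0; apply: cvgD => //; exact: cvg_cst.
  have h1 := near0_scale e10 tp qtw.
  have h2 : \forall i \near \oo, `|(2^-1 * t i) *: ws i| < e2.
    by move/cvgr0_norm_lt : tw; apply.
  near=> i.
  have -> : z + t i *: q + (2^-1 * t i ^+ 2) *: ws i =
      z + t i *: (q + (2^-1 * t i) *: ws i).
    by apply/rowP => j; rewrite !mxE; ring.
  rewrite CT; last by near: i.
  rewrite tangent_cone_scaleE// -/T TW; last by near: i.
  by rewrite /W tangent_cone_scaleE// mulr_gt0.
apply/seteqP; split=> [w [t [ws [tp wsw Cws]]]|w Ww].
  apply: (closed_seq cW wsw); have := H t ws w tp wsw.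
  by apply: filterS => i [+ _]; exact.
have tp : to0p (fun i => 1 * i.+1%:R^-1 : R) by exact: to0p_harmonic.
apply: (second_tangent_setI tp (cvg_cst w)).
have wc : (fun=> w) i @[i --> \oo] --> w by exact: cvg_cst.
by have := H _ (fun=> w) w tp wc; apply: filterS => i [_]; exact.
Unshelve. all: by end_near. Qed.

(** The two rescalings of the second-order case, applied to germs. The radii are halved to leave
    room for the perturbations that a germ involves. *)
Lemma directional_normal_conic C z q : closed C -> (forall z', conic_at C z') ->
  directional_normal_cone C z q =
  directional_normal_cone (tangent_cone (tangent_cone C z) q) 0 0.
Proof.
move=> cC Ccon; set T := tangent_cone C z; set W := tangent_cone T q.
have cT : closed T by exact: tangent_cone_closed.
have Tcon : conic_at T q by exact: tangent_cone_conic.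
have [e1 e10 CT] := conic_tangent cC (Ccon z).
have [e2 e20 TW] := conic_tangent cT Tcon.
have H (t : nat -> R) (ps : nat -> 'rV[R]_k) : to0p t -> ps i @[i --> \oo] --> (0 : 'rV[R]_k) ->
    \forall i \near \oo, forall v, regular_normal_cone C (z + t i *: (q + ps i)) v <->
      regular_normal_cone W (0 + t i *: ps i) v.
  move=> tp ps0; have [t0 tc] := tp.
  have qps : q + ps i @[i --> \oo] --> q.
    by rewrite -[X in _ --> X]addr0; apply: cvgD => //; exact: cvg_cst.
  have h1 := near0_scale (divr_gt0 e10 (@ltr0n R 2)) tp qps.
  have h2 : \forall i \near \oo, `|ps i| < e2 / 2.
    by move/cvgr0_norm_lt : ps0; apply; rewrite divr_gt0.
  near=> i => v.
  have h1' : `|t i *: (q + ps i)| < e1 / 2 by near: i.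
  have h2' : `|ps i| < e2 / 2 by near: i.
  rewrite (@regular_normal_local C T _ (q + ps i) (t i))//; last first.
    exists (e1 / 2 / t i) => [|p pe]; first by rewrite !divr_gt0.
    rewrite -addrA -scalerDr CT ?tangent_cone_scaleE//.
    rewrite scalerDr (le_lt_trans (ler_normD _ _))// [ltRHS]splitr ltrD//.
    by rewrite normrZ gtr0_norm// mulrC -ltr_pdivlMr.
  rewrite (@regular_normal_local T W _ (ps i) 1)//; last first.
    exists (e2 / 2) => [|p pe]; first by rewrite divr_gt0.
    rewrite scale1r -addrA TW//.
    by rewrite (le_lt_trans (ler_normD _ _))// [ltRHS]splitr ltrD.
  (* Normals of the cone [W] are constant along rays, so the base point [ps i] may be replaced by
     [t i *: ps i], the form required at the origin. *)
  apply: iff_sym; apply: (@regular_normal_local _ _ _ _ (t i)) => //.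
  exists 1 => [|p _]; first exact: ltr01.
  by rewrite add0r -scalerDr; exact: tangent_cone_scaleE.
apply/seteqP; split=> v [t [us [vs [tp usq vsv Nvs]]]].
  have us0 : us i - q @[i --> \oo] --> (0 : 'rV[R]_k).
    by rewrite -(subrr q); apply: cvgB => //; exact: cvg_cst.
  apply: (directional_normalI tp us0 vsv).
  by have := H _ _ tp us0; apply: filterS => i <-; rewrite (addrC q) subrK.
have qus : q + us i @[i --> \oo] --> q.
  by rewrite -[X in _ --> X]addr0; apply: cvgD => //; exact: cvg_cst.
apply: (directional_normalI tp qus vsv).
by have := H _ _ tp usq; apply: filterS => i ->.
Unshelve. all: by end_near. Qed.

Lemma conic_directional_normal_perp C z q v : closed C -> (forall z', conic_at C z') ->
  directional_normal_cone C z q v -> dotp v q = 0.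
Proof.
move=> cC Ccon [t [us [vs [tp usq vsv Nvs]]]].
have [e e0 CT] := conic_tangent cC (Ccon z); have [t0 _] := tp.
have : \forall i \near \oo, dotp (vs i) (us i) = 0.
  have := near0_scale (divr_gt0 e0 (@ltr0n R 2)) tp usq.
  apply: filterS => i h1; have := Nvs i.
  rewrite (@regular_normal_local C (tangent_cone C z) _ (us i) (t i))//; last first.
    exists (e / 2 / t i) => [|p pe]; first by rewrite !divr_gt0.
    rewrite -addrA -scalerDr CT ?tangent_cone_scaleE//.
    rewrite scalerDr (le_lt_trans (ler_normD _ _))// [ltRHS]splitr ltrD//.
    by rewrite normrZ gtr0_norm// mulrC -ltr_pdivlMr.
  by apply: cone_regular_normal_perp => s x s0; exact: tangent_cone_scale.
move=> vu0.
have vu : dotp (vs i) (us i) @[i --> \oo] --> dotp v q by exact: cvg_dotp.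
apply/le_anti; rewrite (cvgr_to_le vu)/= ?(cvgr_to_ge vu)//.
  by apply: filterS vu0 => i ->.
by apply: filterS vu0 => i ->.
Qed.

End Cones.

(** * Sets invariant along the kernel of a matrix, and multipliers for them *)

Section Aligned.
Context {R : realType} {l s : nat} (B : 'M[R]_(s, l)).
Implicit Types (C T : set 'rV[R]_(l + l)) (z p q : 'rV[R]_(l + l)).

Lemma submx_perp (f : 'rV[R]_l) :
  (forall d : 'rV[R]_l, d *m B^T = 0 -> dotp f d = 0) -> (f <= B)%MS.
Proof.
move=> H; rewrite submxE; apply/eqP/rowP => j; rewrite mxE [RHS]mxE.
have BK : (col j (cokermx B))^T *m B^T = 0.
  by rewrite -trmx_mul colE mulmxA mulmx_coker mul0mx trmx0.
by rewrite -[RHS](H _ BK) /dotp; apply: eq_bigr => i _; rewrite !mxE.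
Qed.

Lemma perp_submx (f d : 'rV[R]_l) : (f <= B)%MS -> d *m B^T = 0 -> dotp f d = 0.
Proof. by move=> /submxP[c ->] dB; rewrite dotp_mulmxl dB dotp0r. Qed.

Lemma cvg_submx {I : Type} {F : set_system I} {FF : ProperFilter F} (u : I -> 'rV[R]_l) (a : 'rV[R]_l) :
  u k @[k --> F] --> a -> (\forall k \near F, (u k <= B)%MS) -> (a <= B)%MS.
Proof.
move=> ua uB; apply/submxP; exists (a *m pinvmx B).
apply: (@cvg_unique _ _ (u k @[k --> F])) => //.
have : u k *m pinvmx B *m B @[k --> F] --> a *m pinvmx B *m B.
  by apply: cvg_mulmx; [apply: cvg_mulmx => //|]; exact: cvg_cst.
apply: cvg_trans; apply: near_eq_cvg; apply: filterS uB => k uB.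
by rewrite mulmxKpV.
Qed.

(* Near [(g(xbar), dbar)] the only features of [gph N_P] that the chain rules use
   are these: second components lie in the row space of [B], and membership
   depends on the first component only through its products with the rows
   of [B]. *)
Definition aligned_at C z := exists2 e : R, 0 < e &
  (forall p, `|lsubmx p - lsubmx z| < e -> C p -> (rsubmx p <= B)%MS) /\
  (forall p p', `|p - z| < e -> `|p' - z| < e -> lsubmx p *m B^T = lsubmx p' *m B^T ->
     rsubmx p = rsubmx p' -> C p -> C p').

Definition aligned T := (forall p, T p -> (rsubmx p <= B)%MS) /\
  (forall p p', lsubmx p *m B^T = lsubmx p' *m B^T ->
     rsubmx p = rsubmx p' -> T p -> T p').

Lemma aligned_atT T z : aligned T -> aligned_at T z.
Proof.
move=> [TB TT]; exists 1; first exact: ltr01.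
by split=> [p _|p p' _ _]; [exact: TB|exact: TT].
Qed.

Lemma aligned_near C z (zs : nat -> 'rV[R]_(l + l)) : aligned_at C z ->
  zs k @[k --> \oo] --> z -> \forall k \near \oo, aligned_at C (zs k).
Proof.
move=> [e e0 [CB CC]] zsz.
have e2 : 0 < e / 2 by rewrite divr_gt0.
have : \forall k \near \oo, `|zs k - z| < e / 2.
  by move/cvgrPdist_lt : zsz => /(_ _ e2); apply: filterS => k; rewrite distrC.
apply: filterS => k zk; exists (e / 2) => //.
have tri (u v w : 'rV[R]_(l + l)) : `|u - v| < e / 2 -> `|v - w| < e / 2 -> `|u - w| < e.
  move=> uv vw; rewrite -(subrK v u) -addrA (le_lt_trans (ler_normD _ _))//.
  by rewrite [ltRHS]splitr ltrD.
split=> [p pz|p p' pz p'z].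
  apply: CB; rewrite -(subrK (lsubmx (zs k)) (lsubmx p)) -addrA.
  rewrite (le_lt_trans (ler_normD _ _))// [ltRHS]splitr ltrD//.
  by rewrite -linearB/= (le_lt_trans (lsubmx_norm_le _)).
by apply: CC; [exact: tri zk|exact: tri zk].
Qed.

Lemma aligned_tangent C z : C z -> aligned_at C z -> aligned (tangent_cone C z).
Proof.
move=> Cz [e e0 [CB CC]].
have zB : (rsubmx z <= B)%MS by apply: CB => //; rewrite subrr normr0.
have zw (w : 'rV[R]_(l + l)) : z + w - z = w by rewrite addrC addKr.
split=> [p [t [us [tp usp Cus]]]|p p' pp' pp2 [t [us [tp usp Cus]]]].
  have rus : rsubmx (us k) @[k --> \oo] --> rsubmx p by exact: cvg_rsubmx.
  apply: (cvg_submx rus).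
  have : \forall k \near \oo, `|t k *: us k| < e by exact: (near0_scale e0 tp usp).
  apply: filterS => k tu.
  have := CB _ _ (Cus k); rewrite -linearB/= zw => /(_ (le_lt_trans (lsubmx_norm_le _) tu)).
  rewrite linearD linearZ/= => zuB.
  have : (t k *: rsubmx (us k) <= B)%MS by rewrite -[_ *: _](addKr (rsubmx z)) addmx_sub// eqmx_opp.
  by have [t0 _] := tp; rewrite (eqmx_scale _ (lt0r_neq0 (t0 k))).
have usp' : us k + (p' - p) @[k --> \oo] --> p'.
  have : us k + (p' - p) @[k --> \oo] --> p + (p' - p).
    by apply: cvgD => //; exact: cvg_cst.
  by rewrite [X in _ --> X](addrC p) subrK.
apply: (tangent_coneI tp usp').
have h1 := near0_scale e0 tp usp; have h2 := near0_scale e0 tp usp'.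
near=> k.
apply: (CC (z + t k *: us k)); rewrite ?zw//.
- by near: k.
- by near: k.
- rewrite scalerDr addrA [in RHS]linearD/= mulmxDl linearZ/= linearB/= -scalemxAl.
  by rewrite mulmxBl pp' subrr scaler0 addr0.
- by rewrite scalerDr addrA [in RHS]linearD/= linearZ/= linearB/= pp2 subrr scaler0 addr0.
Unshelve. all: by end_near. Qed.

(** The tangent cone contains [(d, 0)] for all [d] with [d *m B^T = 0], with both signs, so [f] is
    orthogonal to these [d]. Its second components lie in the row space of [B], so only [v *m B^T]
    enters the pairing. This freedom in [v] is what lets normals be transported to nearby points. *)
Lemma aligned_regular_normal C z (f v v' : 'rV[R]_l) : C z -> aligned_at C z ->
  regular_normal_cone C z (row_mx f v) ->
  (f <= B)%MS /\ (v *m B^T = v' *m B^T -> regular_normal_cone C z (row_mx f v')).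
Proof.
move=> Cz Cal /regular_normal_polar[_ pol].
have [TB TT] := aligned_tangent Cz Cal.
split=> [|vv'].
  apply: submx_perp => d dB.
  have H (c : R) : c * dotp f d <= 0.
    have := pol (row_mx (c *: d) 0); rewrite dotp_row_mx dotp0r addr0 dotpZr; apply.
    apply: (TT 0); last exact: tangent_cone0.
      by rewrite linear0 row_mxKl mul0mx -scalemxAl dB scaler0.
    by rewrite linear0 row_mxKr.
  have := H 1; have := H (-1); lra.
apply/regular_normal_polar; split=> // u Tu.
apply: le_trans (pol u Tu); rewrite -(hsubmxK u) !dotp_row_mx lerD2l.
have /submxP[c ->] := TB u Tu.
by rewrite !dotp_mulmxr vv'.
Qed.

(** A multiplier rule without separation theorems. A point [z0] with [z0 *m A] equal to [- a] modulo
    the kernel of [B] removes the shift, and scaling turns the bound [c] into [0]. Then [w] vanishes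
    where [zeta *m A] lies in that kernel, hence factors through [B *m A^T]. The case [a = 0],
    [c = 0] yields regular normals, the general case the domain of the support function. *)
Lemma covector_bounded n (T : set 'rV[R]_(l + l)) (A : 'M[R]_(n, l)) (a v : 'rV[R]_l)
    (w : 'rV[R]_n) (c : R) :
  T 0 -> (forall (r : R) p, 0 < r -> T p -> T (r *: p)) -> aligned T ->
  row_free (B *m A^T) ->
  (forall zeta xi, T (row_mx (zeta *m A + a) xi) -> dotp w zeta + dotp v xi <= c) ->
  exists f : 'rV[R]_l, [/\ (f <= B)%MS, w = f *m A^T &
    forall p, T p -> dotp (row_mx f v) p <= 0].
Proof.
move=> T0 Ts [TB TT] /row_freeP[N BAN] bnd.
have solve (y : 'rV[R]_l) : exists zeta : 'rV[R]_n, zeta *m A *m B^T = y *m B^T.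
  exists (y *m B^T *m N^T); rewrite -!mulmxA.
  have -> : N^T *m (A *m B^T) = 1%:M by apply: trmx_inj; rewrite !trmx_mul !trmxK BAN trmx1.
  by rewrite mulmx1.
have [z0 z0P] := solve (- a).
have bnd0 zeta xi : T (row_mx (zeta *m A) xi) -> dotp w zeta + dotp v xi <= 0.
  move=> Tz; rewrite leNgt; apply/negP => pos.
  set d := dotp w zeta + dotp v xi in pos.
  (* Then [r * d] exceeds [c - dotp w z0], so [r *: zeta + z0] violates the assumed bound. *)
  pose r := (`|c - dotp w z0| + 1) / d.
  have r0 : 0 < r by rewrite divr_gt0// ltr_wpDl.
  have := bnd (r *: zeta + z0) (r *: xi).
  rewrite dotpDr !dotpZr addrAC -mulrDr -/d divfK ?gt_eqF//.
  move=> /(_ _)/le_trans; have := ler_norm (c - dotp w z0) => h1 h2.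
  have : `|c - dotp w z0| + 1 + dotp w z0 <= c.
    apply: h2 => //; apply: (TT (row_mx (r *: zeta *m A) (r *: xi))).
    - by rewrite !row_mxKl (mulmxDl (r *: zeta)) -addrA [RHS]mulmxDl [(_ + a) *m _]mulmxDl z0P mulNmx addNr addr0.
    - by rewrite !row_mxKr.
    - by have := Ts r _ r0 Tz; rewrite scale_row_mx scalemxAl.
  by lra.
have wP (z : 'rV[R]_n) : z *m (B *m A^T)^T = 0 -> dotp w z = 0.
  rewrite trmx_mul trmxK mulmxA => zA.
  have H (r : R) : r * dotp w z <= 0.
    have := bnd0 (r *: z) 0; rewrite dotp0r addr0 dotpZr; apply.
    apply: (TT 0) => //; rewrite ?linear0 ?row_mxKl ?row_mxKr//.
    by rewrite mul0mx -!scalemxAl zA scaler0.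
  have := H 1; have := H (-1); lra.
have /submxP[mu wE] : (w <= B *m A^T)%MS.
  rewrite submxE; apply/eqP/rowP => j; rewrite mxE [RHS]mxE.
  have BK : (col j (cokermx (B *m A^T)))^T *m (B *m A^T)^T = 0.
    by rewrite -trmx_mul colE mulmxA mulmx_coker mul0mx trmx0.
  by rewrite -[RHS](wP _ BK) /dotp; apply: eq_bigr => i _; rewrite !mxE.
exists (mu *m B); split; rewrite ?submxMl// ?wE ?mulmxA// => p Tp.
rewrite -(hsubmxK p) dotp_row_mx.
have [zeta zP] := solve (lsubmx p).
have -> : dotp (mu *m B) (lsubmx p) = dotp w zeta.
  by rewrite wE mulmxA dotp_mulmxl -zP -dotp_mulmxl dotp_mulmxr.
apply: bnd0; apply: (TT p) => //; rewrite ?row_mxKl ?row_mxKr//.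
Qed.

End Aligned.

(** * Chain rules *)

Section ParametrizedGraph.
Context {R : realType} {n m l s : nat}.
Variables (G : set 'rV[R]_(l + l)) (g : 'rV[R]_n -> 'rV[R]_l)
  (b : 'rV[R]_n -> 'M[R]_(l, m)) (a : 'rV[R]_n -> 'rV[R]_m) (B : 'M[R]_(s, l)).
Hypothesis g2 : twice_contdiff g.
Hypothesis b2 : twice_contdiff b.
Hypothesis a2 : twice_contdiff a.

(* [Omega] is the case [a = 0]; a linear [a] is needed for the second-order
   tangent set of [Omega]. *)
Definition param_graph : set 'rV[R]_(n + m) :=
  [set w | exists x v, w = row_mx x (a x + v *m b x) /\ G (row_mx (g x) v)].

Definition dir_deriv (x : 'rV[R]_n) (v : 'rV[R]_l) (u : 'rV[R]_n) : 'rV[R]_m :=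
  'D_u a x + v *m 'D_u b x.

Definition param_jacobian (x : 'rV[R]_n) (v : 'rV[R]_l) : 'M[R]_(n, m) :=
  \matrix_(i, j) (dir_deriv x v (delta_mx 0 i)) 0 j.

(** Adjoint of the linearised parametrisation: it is made so that [covec_dotp] reduces its pairing
    with a tangent of the parametrized graph to the pairing of [(f, r *m (b x)^T)] with the
    corresponding tangent of [G]. *)
Definition covec (x : 'rV[R]_n) (v : 'rV[R]_l) (r : 'rV[R]_m) (f : 'rV[R]_l) :
    'rV[R]_(n + m) :=
  row_mx (- (r *m (param_jacobian x v)^T) + f *m ('J g x)^T) r.

(** The qualification at a point. It persists at all nearby points of [G] ([good_near]), which is
    what makes limits of normals accessible. *)
Definition good (x : 'rV[R]_n) (v : 'rV[R]_l) : Prop :=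
  [/\ G (row_mx (g x) v), aligned_at B G (row_mx (g x) v),
      row_free (B *m ('J g x)^T) & row_free (B *m b x)].

Let dg x : differentiable g x. Proof. by case: g2 => -[]. Qed.
Let db x : differentiable b x. Proof. by case: b2 => -[]. Qed.
Let da x : differentiable a x. Proof. by case: a2 => -[]. Qed.
Let cg : continuous g. Proof. by move=> x; exact: differentiable_continuous. Qed.
Let cb : continuous b. Proof. by move=> x; exact: differentiable_continuous. Qed.
Let ca : continuous a. Proof. by move=> x; exact: differentiable_continuous. Qed.

Lemma dir_derivE x v u : u *m param_jacobian x v = dir_deriv x v u.
Proof.
rewrite [in RHS](row_sum_delta u) /dir_deriv !deriveE// !linear_sum -big_split/=.
apply/rowP => j; rewrite mxE summxE; apply: eq_bigr => i _.
have -> : 'd a x (u 0 i *: delta_mx 0 i) = u 0 i *: 'd a x (delta_mx 0 i) by rewrite linearZ.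
have -> : 'd b x (u 0 i *: delta_mx 0 i) = u 0 i *: 'd b x (delta_mx 0 i) by rewrite linearZ.
rewrite -scalemxAr -scalerDr [RHS]mxE; congr (_ * _).
by rewrite /param_jacobian mxE /dir_deriv !deriveE.
Qed.

Lemma cvg_param_jacobian (x : nat -> 'rV[R]_n) (v : nat -> 'rV[R]_l)
    (x0 : 'rV[R]_n) (v0 : 'rV[R]_l) :
  x k @[k --> \oo] --> x0 -> v k @[k --> \oo] --> v0 ->
  param_jacobian (x k) (v k) @[k --> \oo] --> param_jacobian x0 v0.
Proof.
move=> xx0 vv0; apply: cvg_matrixP => i j; apply: cvg_entry; apply: cvgD.
  by apply: cvg_derive => //; [case: a2|exact: cvg_cst].
apply: cvg_mulmx => //; apply: cvg_derive => //; [by case: b2|exact: cvg_cst].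
Qed.

(** Write [e k = c k *m B]. Stability of full row rank bounds [c k], and with a right inverse [N] of
    [B *m A0] one has [c k = e k *m A k *m N - c k *m (B *m (A k - A0) *m N)], whose last term tends
    to zero. *)
Lemma injective_cvg p (A : nat -> 'M[R]_(l, p)) (A0 : 'M[R]_(l, p))
    (e : nat -> 'rV[R]_l) (y : 'rV[R]_p) :
  row_free (B *m A0) -> A k @[k --> \oo] --> A0 ->
  (\forall k \near \oo, (e k <= B)%MS) -> e k *m A k @[k --> \oo] --> y ->
  exists e0 : 'rV[R]_l, [/\ (e0 <= B)%MS, e k @[k --> \oo] --> e0 & e0 *m A0 = y].
Proof.
move=> BA AA0 eB eAy.
have /row_freeP[N BAN] := BA.
have BAA : B *m A k @[k --> \oo] --> B *m A0 by apply: cvg_mulmx => //; exact: cvg_cst.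
have [kap kap0 H] := row_free_stable BA BAA.
pose c k := e k *m pinvmx B.
have cB : \forall k \near \oo, c k *m B = e k.
  by apply: filterS eB => k eB; rewrite /c mulmxKpV.
have small : c k *m (B *m (A k - A0) *m N) @[k --> \oo] --> (0 : 'rV[R]_s).
  apply/cvgr0Pnorm_le => eps eps0.
  have M0 : B *m (A k - A0) *m N @[k --> \oo] --> (0 : 'M[R]_s).
    rewrite -[X in _ --> X](mul0mx _ N) -[X in _ --> X *m N](mulmx0 _ B) -(subrr A0).
    apply: cvg_mulmx; [apply: cvg_mulmx|]; [exact: cvg_cst| |exact: cvg_cst].
    by apply: cvgB => //; exact: cvg_cst.
  have K0 : 0 < s%:R * (kap * (`|y| + 1)) + 1.
    by rewrite ltr_wpDl// !mulr_ge0 ?ler0n ?(ltW kap0)// addr_ge0.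
  have h1 : \forall k \near \oo, `|B *m (A k - A0) *m N| < eps / (s%:R * (kap * (`|y| + 1)) + 1).
    by move/cvgr0_norm_lt : M0; apply; rewrite divr_gt0.
  have h2 : \forall k \near \oo, `|e k *m A k| < `|y| + 1.
    by apply: (cvgr_norm_lt _ eAy); rewrite ltrDl.
  near=> k.
  have [Hk _] : (forall u : 'rV[R]_s, `|u| <= kap * `|u *m (B *m A k)|) /\
    (forall e : 'rV[R]_s, exists2 d : 'rV[R]_p, d *m (B *m A k)^T = e & `|d| <= kap * `|e|).
    by near: k.
  have ck : `|c k| <= kap * (`|y| + 1).
    rewrite (le_trans (Hk _))// ler_wpM2l ?(ltW kap0)// mulmxA.
    have -> : c k *m B = e k by near: k.
    by rewrite ltW//; near: k.
  apply: le_trans (mulmx_norm_le _ _) _.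
  apply: (@le_trans _ _ (s%:R * (kap * (`|y| + 1)) * (eps / (s%:R * (kap * (`|y| + 1)) + 1)))).
    apply: ler_pM => //; first by rewrite ler_wpM2l.
    by rewrite ltW//; near: k.
  by rewrite mulrCA ler_piMr ?(ltW eps0)// ler_pdivrMr// mul1r lerDl ler01.
have ccv : c k @[k --> \oo] --> y *m N.
  have H1 : e k *m A k *m N - c k *m (B *m (A k - A0) *m N) @[k --> \oo] --> y *m N.
    rewrite -[X in _ --> X]subr0; apply: cvgB; last exact: small.
    by apply: cvg_mulmx; [exact: eAy|exact: cvg_cst].
  apply: cvg_trans H1; apply: near_eq_cvg; apply: filterS cB => k ck.
  rewrite mulmxBr mulmxBl mulmxBr BAN mulmx1 !mulmxA ck.
  by rewrite opprB addrC subrK.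
have ecv : e k @[k --> \oo] --> y *m N *m B.
  have H1 : c k *m B @[k --> \oo] --> y *m N *m B by apply: cvg_mulmx => //; exact: cvg_cst.
  by apply: cvg_trans H1; apply: near_eq_cvg; apply: filterS cB => k ck.
exists (y *m N *m B); split=> //; first exact: submxMl.
apply: (@cvg_unique _ _ (e k *m A k @[k --> \oo])) => //.
exact: cvg_mulmx.
Unshelve. all: by end_near. Qed.

Lemma injective_eq p (A : 'M[R]_(l, p)) (e e' : 'rV[R]_l) : row_free (B *m A) ->
  (e <= B)%MS -> (e' <= B)%MS -> e *m A = e' *m A -> e = e'.
Proof.
move=> BA /submxP[c ->] /submxP[c' ->]; rewrite -!mulmxA => cc'.
by rewrite (row_free_inj BA cc').
Qed.

Lemma good_near (x : nat -> 'rV[R]_n) (v : nat -> 'rV[R]_l)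
    (x0 : 'rV[R]_n) (v0 : 'rV[R]_l) : good x0 v0 ->
  x k @[k --> \oo] --> x0 -> v k @[k --> \oo] --> v0 ->
  (\forall k \near \oo, G (row_mx (g (x k)) (v k)) -> good (x k) (v k)).
Proof.
move=> [G0 Gal Jf bf] xx0 vv0.
have gx : g (x k) @[k --> \oo] --> g x0 by apply: (cvg_comp x g xx0); exact: cg.
have bx : b (x k) @[k --> \oo] --> b x0 by apply: (cvg_comp x b xx0); exact: cb.
have Jx : 'J g (x k) @[k --> \oo] --> 'J g x0 by apply: cvg_jacobian => //; case: g2.
have al : \forall k \near \oo, aligned_at B G (row_mx (g (x k)) (v k)).
  by apply: (aligned_near Gal); exact: cvg_row_mx.
have stab p (A : nat -> 'M[R]_(s, p)) (A0 : 'M[R]_(s, p)) : row_free A0 ->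
    A k @[k --> \oo] --> A0 -> \forall k \near \oo, row_free (A k).
  move=> Af AA; have [kap kap0 H] := row_free_stable Af AA.
  apply: filterS H => k [H _]; apply: row_free_kernel => u uA.
  by apply/normr0_eq0/le_anti; rewrite normr_ge0 (le_trans (H u))// uA normr0 mulr0.
have h1 : \forall k \near \oo, row_free (B *m ('J g (x k))^T).
  by apply: stab Jf _; apply: cvg_mulmx; [exact: cvg_cst|exact: cvg_trmx].
have h2 : \forall k \near \oo, row_free (B *m b (x k)).
  by apply: stab bf _; apply: cvg_mulmx => //; exact: cvg_cst.
apply: filterS3 al h1 h2 => k k1 k2 k3 Gk; split; [exact: Gk|exact: k1|exact: k2|exact: k3].
Qed.

(** No bound on the multipliers is known beforehand. They lie in the row space of [B] because the
    first clause of [aligned_at] restricts only the first component, and [injective_cvg] then forces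
    their convergence to [v0]. *)
Lemma param_graph_seq (x0 : 'rV[R]_n) (v0 : 'rV[R]_l) (zs : nat -> 'rV[R]_(n + m)) :
  good x0 v0 -> (forall k, param_graph (zs k)) ->
  zs k @[k --> \oo] --> row_mx x0 (a x0 + v0 *m b x0) ->
  exists v : nat -> 'rV[R]_l, v k @[k --> \oo] --> v0 /\
   forall k, rsubmx (zs k) = a (lsubmx (zs k)) + v k *m b (lsubmx (zs k)) /\
     G (row_mx (g (lsubmx (zs k))) (v k)).
Proof.
move=> [G0 Gal Jf bf] Ozs zsz.
have /choice[v vP] k : exists v,
    rsubmx (zs k) = a (lsubmx (zs k)) + v *m b (lsubmx (zs k)) /\
    G (row_mx (g (lsubmx (zs k))) v).
  by have [x [v [-> Gxv]]] := Ozs k; exists v; rewrite row_mxKl row_mxKr.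
exists v; split=> //.
pose x k := lsubmx (zs k).
have xx0 : x k @[k --> \oo] --> x0 by rewrite -(row_mxKl x0 (a x0 + v0 *m b x0)); exact: cvg_lsubmx.
have gx : g (x k) @[k --> \oo] --> g x0 by apply: (cvg_comp x g xx0); exact: cg.
have bx : b (x k) @[k --> \oo] --> b x0 by apply: (cvg_comp x b xx0); exact: cb.
have ax : a (x k) @[k --> \oo] --> a x0 by apply: (cvg_comp x a xx0); exact: ca.
have [e e0 [GB _]] := Gal.
have vB : \forall k \near \oo, (v k <= B)%MS.
  have /cvgrPdist_lt/(_ _ e0) := gx; apply: filterS => k ge.
  have [_ /GB] := vP k; rewrite !row_mxKl row_mxKr; apply.
  by rewrite distrC.
have v0B : (v0 <= B)%MS.
  by have := GB _ _ G0; rewrite row_mxKr; apply; rewrite subrr normr0.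
have vb : v k *m b (x k) @[k --> \oo] --> v0 *m b x0.
  rewrite (_ : v0 *m b x0 = a x0 + v0 *m b x0 - a x0); last by rewrite addrC addKr.
  have E k : v k *m b (x k) = rsubmx (zs k) - a (x k).
    by rewrite (vP k).1 addrC addKr.
  under eq_fun do rewrite E.
  apply: cvgB => //; rewrite -{1}(row_mxKr x0 (a x0 + v0 *m b x0)); exact: cvg_rsubmx.
have [v1 [v1B vv1 v1b]] := injective_cvg bf bx vB vb.
by rewrite (injective_eq bf v0B v1B (esym v1b)).
Qed.

(** The point is [x0 + t k *: h k] with [h k = u + (t k / 2) z k]; the linear term along [h k]
    splits off [D_zeta f] at second order. *)
Lemma second_expand p q (f : 'rV[R]_n -> 'M[R]_(p, q)) (x0 u zeta : 'rV[R]_n)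
    (t : nat -> R) (z : nat -> 'rV[R]_n) :
  twice_contdiff f -> to0p t -> z k @[k --> \oo] --> zeta ->
  exists F : nat -> 'M[R]_(p, q),
    F k @[k --> \oo] --> 'D_zeta f x0 + second_deriv f x0 u /\
    forall k, f (x0 + t k *: u + (2^-1 * t k ^+ 2) *: z k) =
      f x0 + t k *: 'D_u f x0 + (2^-1 * t k ^+ 2) *: F k.
Proof.
move=> f2 tp zz; have [t0 tc] := tp; have [[df _] _] := f2.
pose h k := u + (2^-1 * t k) *: z k.
have hu : h k @[k --> \oo] --> u.
  rewrite -[X in _ --> X]addr0 -(scale0r zeta) -(mulr0 2^-1); apply: cvgD.
    exact: cvg_cst.
  by apply: cvgZ => //; apply: cvgM => //; exact: cvg_cst.
exists (fun k => 'D_(z k) f x0 + (2 * (t k)^-1 ^+ 2) *: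
  (f (x0 + t k *: h k) - f x0 - t k *: 'D_(h k) f x0)); split.
  apply: cvgD; last exact: second_order_quotient.
  by apply: cvg_derive => //; [case: f2|exact: cvg_cst].
move=> k; have -> : x0 + t k *: u + (2^-1 * t k ^+ 2) *: z k = x0 + t k *: h k.
  by apply/rowP => j; rewrite !mxE; ring.
rewrite /h derive_add// derive_scale//.
have tk : t k != 0 by rewrite gt_eqF.
move: (f (x0 + _)) ('D_(z k) f x0) ('D_u f x0) (f x0) => y1 y2 y3 y4.
by apply/matrixP => i j; rewrite !mxE; field.
Qed.

Lemma cvg_second_point p (x0 u zeta : 'rV[R]_p) (t : nat -> R) (z : nat -> 'rV[R]_p) :
  to0p t -> z k @[k --> \oo] --> zeta ->
  x0 + t k *: u + (2^-1 * t k ^+ 2) *: z k @[k --> \oo] --> x0.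
Proof.
move=> [t0 tc] zz.
have : x0 + t k *: u + (2^-1 * (t k * t k)) *: z k @[k --> \oo] -->
    x0 + 0 *: u + (2^-1 * (0 * 0)) *: zeta.
  apply: cvgD.
    by apply: cvgD; [exact: cvg_cst|apply: cvgZ => //; exact: cvg_cst].
  by apply: cvgZ => //; apply: cvgM; [exact: cvg_cst|exact: cvgM].
by rewrite !mulr0 !scale0r !addr0.
Qed.

(** The factor [b x] of [xi] is not expanded: [injective_cvg] extracts the limit of [xi] from
    exactly this product. *)
Lemma second_order_value (x0 x u : 'rV[R]_n) (v0 e xi : 'rV[R]_l) (t : R)
    (Fa : 'rV[R]_m) (Fb : 'M[R]_(l, m)) :
  a x = a x0 + t *: 'D_u a x0 + (2^-1 * t ^+ 2) *: Fa ->
  b x = b x0 + t *: 'D_u b x0 + (2^-1 * t ^+ 2) *: Fb ->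
  a x + (v0 + t *: e + (2^-1 * t ^+ 2) *: xi) *m b x =
  a x0 + v0 *m b x0 + t *: (dir_deriv x0 v0 u + e *m b x0) +
    (2^-1 * t ^+ 2) *: (Fa + v0 *m Fb + 2 *: (e *m 'D_u b x0) + t *: (e *m Fb) + xi *m b x).
Proof.
move=> aE bE; rewrite !mulmxDl -!scalemxAl; move: (xi *m b x) => y.
rewrite aE bE /dir_deriv !mulmxDr -!scalemxAr.
move: (v0 *m b x0) (v0 *m 'D_u b x0) (v0 *m Fb) (e *m b x0) (e *m 'D_u b x0) (e *m Fb).
move=> y1 y2 y3 y4 y5 y6; apply/rowP => j; by rewrite !mxE; field.
Qed.

Lemma good_sub x v : good x v -> (v <= B)%MS.
Proof.
move=> [G0 [e e0 [GB _]] _ _]; have := GB _ _ G0; rewrite row_mxKr; apply.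
by rewrite subrr normr0.
Qed.

Lemma good_near_sub (x0 : 'rV[R]_n) (v0 : 'rV[R]_l) (x : nat -> 'rV[R]_n)
    (v : nat -> 'rV[R]_l) : good x0 v0 ->
  x k @[k --> \oo] --> x0 -> (forall k, G (row_mx (g (x k)) (v k))) ->
  \forall k \near \oo, (v k <= B)%MS.
Proof.
move=> [G0 [e e0 [GB _]] _ _] xx0 Gk.
have gx : g (x k) @[k --> \oo] --> g x0 by apply: (cvg_comp x g xx0); exact: cg.
have /cvgrPdist_lt/(_ _ e0) := gx; apply: filterS => k ge.
have := GB _ _ (Gk k); rewrite !row_mxKl row_mxKr; apply.
by rewrite distrC.
Qed.

Lemma second_tangent_param_graphP (x0 u : 'rV[R]_n) (v0 e : 'rV[R]_l) th :
  good x0 v0 -> (e <= B)%MS ->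
  second_tangent_set param_graph (row_mx x0 (a x0 + v0 *m b x0))
    (row_mx u (dir_deriv x0 v0 u + e *m b x0)) th ->
  exists (zeta : 'rV[R]_n) (xi : 'rV[R]_l),
    th = row_mx zeta (2 *: (e *m 'D_u b x0) +
      (dir_deriv x0 v0 zeta + (second_deriv a x0 u + v0 *m second_deriv b x0 u)) +
      xi *m b x0) /\
    second_tangent_set G (row_mx (g x0) v0) (row_mx (u *m 'J g x0) e)
      (row_mx (zeta *m 'J g x0 + second_deriv g x0 u) xi).
Proof.
move=> gd eB [t [ws [tp wsth Ows]]]; have [t0 tc] := tp.
set om := row_mx x0 _ in Ows; set eta := row_mx u _ in Ows.
pose zs k : 'rV[R]_(n + m) := om + t k *: eta + (2^-1 * t k ^+ 2) *: ws k.
have zsom : zs k @[k --> \oo] --> om.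
  exact: (@cvg_second_point _ om eta th t ws tp wsth).
have [v [vv0 vP]] := param_graph_seq gd Ows zsom.
pose z k := lsubmx (ws k); pose x k := x0 + t k *: u + (2^-1 * t k ^+ 2) *: z k.
have zz : z k @[k --> \oo] --> lsubmx th by exact: cvg_lsubmx.
have lzs k : lsubmx (zs k) = x k.
  by rewrite /zs /om /eta !linearD !linearZ/= !row_mxKl.
have xx0 : x k @[k --> \oo] --> x0 by exact: (@cvg_second_point _ x0 u _ t z tp zz).
(* The multipliers are only known to tend to [v0]. That they follow the direction [e] up to second
   order is read off from the convergence of [xi k], proved below. *)
pose xi k := (2 * (t k)^-1 ^+ 2) *: (v k - v0 - t k *: e).
have vE k : v k = v0 + t k *: e + (2^-1 * t k ^+ 2) *: xi k.
  have tk : t k != 0 by rewrite gt_eqF.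
  by apply/rowP => j; rewrite !mxE; field.
have Gk k : G (row_mx (g (x k)) (v k)) by have [_] := vP k; rewrite lzs.
have xiB : \forall k \near \oo, (xi k <= B)%MS.
  have := good_near_sub gd xx0 Gk; apply: filterS => k vB.
  rewrite scalemx_sub// !addmx_sub// ?eqmx_opp ?(good_sub gd)//.
  by rewrite scalemx_sub.
have [Fa [FaC FaE]] := second_expand x0 u a2 tp zz.
have [Fb [FbC FbE]] := second_expand x0 u b2 tp zz.
have [Fg [FgC FgE]] := second_expand x0 u g2 tp zz.
have bx : b (x k) @[k --> \oo] --> b x0 by apply: (cvg_comp x b xx0); exact: cb.
have xib k : xi k *m b (x k) = rsubmx (ws k) -
    (Fa k + v0 *m Fb k + 2 *: (e *m 'D_u b x0) + t k *: (e *m Fb k)).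
  have H := (vP k).1.
  rewrite -/(zs k) lzs vE (second_order_value _ _ _ (FaE k) (FbE k)) in H.
  have zsE : rsubmx (zs k) = a x0 + v0 *m b x0 + t k *: (dir_deriv x0 v0 u + e *m b x0) +
      (2^-1 * t k ^+ 2) *: rsubmx (ws k).
    by rewrite /zs /om /eta -[ws k in LHS]hsubmxK !scale_row_mx !add_row_mx row_mxKr.
  rewrite zsE in H; have tk : 2^-1 * t k ^+ 2 != 0 by rewrite gt_eqF// mulr_gt0// exprn_gt0.
  by rewrite (scalerI tk (addrI _ H)) [RHS]addrC addKr.
have yC : xi k *m b (x k) @[k --> \oo] --> rsubmx th -
    (('D_(lsubmx th) a x0 + second_deriv a x0 u) +
     v0 *m ('D_(lsubmx th) b x0 + second_deriv b x0 u) + 2 *: (e *m 'D_u b x0) +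
     0 *: (e *m ('D_(lsubmx th) b x0 + second_deriv b x0 u))).
  under eq_fun do rewrite xib.
  apply: cvgB; first exact: cvg_rsubmx.
  apply: cvgD; last first.
    by apply: cvgZ; [exact: tc|apply: cvg_mulmx; [exact: cvg_cst|exact: FbC]].
  apply: cvgD; last exact: cvg_cst.
  by apply: cvgD; [exact: FaC|apply: cvg_mulmx; [exact: cvg_cst|exact: FbC]].
have [_ _ _ bf] := gd.
have [xi0 [xi0B xi0C xi0b]] := injective_cvg bf bx xiB yC.
exists (lsubmx th), xi0; split.
  rewrite xi0b -[LHS]hsubmxK; congr row_mx; rewrite scale0r addr0 /dir_deriv mulmxDr.
  have E (y1 y2 y3 y4 y5 : 'rV[R]_m) : y5 + (y1 + y3 + (y2 + y4)) = y1 + y2 + (y3 + y4) + y5.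
    by rewrite [LHS]addrC addrACA.
  by rewrite E addrC subrK.
exists t, (fun k => row_mx (Fg k) (xi k)); split=> //.
  by apply: cvg_row_mx => //; rewrite jacobianE.
move=> k; rewrite !scale_row_mx !add_row_mx -vE jacobianE// -FgE.
exact: Gk.
Qed.

Lemma local_lift (x0 : 'rV[R]_n) (v0 : 'rV[R]_l) (x : nat -> 'rV[R]_n)
    (y : nat -> 'rV[R]_l) : good x0 v0 ->
  x k @[k --> \oo] --> x0 -> y k @[k --> \oo] --> g x0 ->
  exists (kap : R) (x' : nat -> 'rV[R]_n), 0 < kap /\ \forall k \near \oo,
    `|x' k - x k| <= kap * `|y k - g (x k)| /\ g (x' k) *m B^T = y k *m B^T.
Proof.
move=> [G0 Gal Jf bf] xx0 yg.
have gx : g (x k) @[k --> \oo] --> g x0 by apply: (cvg_comp x g xx0); exact: cg.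
have [kap [del [kap0 del0 H]]] := local_solve (let: conj h _ := g2 in h) Jf.
have /choice[x' x'P] k : exists x', `|x k - x0| < del -> `|y k - g (x k)| < del ->
    `|x' - x k| <= kap * `|y k - g (x k)| /\ g x' *m B^T = y k *m B^T.
  have [h1|/negP nh] := boolP (`|x k - x0| < del); last by exists 0.
  have [h2|/negP nh] := boolP (`|y k - g (x k)| < del); last by exists 0.
  by have [x' ? ?] := H _ _ h1 h2; exists x'.
exists kap, x'; split=> //.
have h1 : \forall k \near \oo, `|x k - x0| < del.
  by have /cvgrPdist_lt/(_ _ del0) := xx0; apply: filterS => k; rewrite distrC.
have h2 : \forall k \near \oo, `|y k - g (x k)| < del.
  have : y k - g (x k) @[k --> \oo] --> (0 : 'rV[R]_l) by rewrite -(subrr (g x0)); exact: cvgB.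
  by move/cvgr0_norm_lt; apply.
by apply: filterS2 h1 h2 => k k1 k2; exact: x'P.
Qed.

Lemma cvg_dominated p (u : nat -> 'rV[R]_p) (c : 'rV[R]_p) (w : nat -> R) :
  (\forall k \near \oo, `|u k - c| <= w k) -> w k @[k --> \oo] --> (0 : R) ->
  u k @[k --> \oo] --> c.
Proof.
move=> uw w0; apply/cvgrPdist_lt => e e0.
have h : \forall k \near \oo, w k < e by apply: (cvgr_lt _ w0).
by apply: filterS2 uw h => k k1 k2; rewrite distrC (le_lt_trans k1).
Qed.

(* The point [(y, v)] of [G] is moved to [(y', v)] along the orthogonal
   complement of the row space of [B]. *)
Lemma good_shift (x0 : 'rV[R]_n) (v0 : 'rV[R]_l) (y y' v : nat -> 'rV[R]_l) :
  good x0 v0 -> y k @[k --> \oo] --> g x0 -> y' k @[k --> \oo] --> g x0 ->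
  v k @[k --> \oo] --> v0 ->
  \forall k \near \oo, y k *m B^T = y' k *m B^T -> G (row_mx (y k) (v k)) ->
    G (row_mx (y' k) (v k)).
Proof.
move=> [G0 [e e0 [_ GG]] _ _] yg y'g vv0.
have near (w : nat -> 'rV[R]_l) : w k @[k --> \oo] --> g x0 ->
    \forall k \near \oo, `|row_mx (w k) (v k) - row_mx (g x0) v0| < e.
  move=> wg; have wv : row_mx (w k) (v k) @[k --> \oo] --> row_mx (g x0) v0 by exact: cvg_row_mx.
  have /cvgrPdist_lt/(_ _ e0) := wv.
  by apply: filterS => k; rewrite distrC.
apply: filterS2 (near y yg) (near y' y'g) => k k1 k2 yy'.
by apply: GG => //; rewrite ?row_mxKl ?row_mxKr.
Qed.

(** The arc with acceleration [zeta] meets the constraint up to [o(t^2)]; [local_lift] corrects it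
    by as little, but only modulo the kernel of [B], and [good_shift] bridges that gap. *)
Lemma param_graph_second_tangent (x0 u zeta : 'rV[R]_n) (v0 e xi : 'rV[R]_l) :
  good x0 v0 ->
  second_tangent_set G (row_mx (g x0) v0) (row_mx (u *m 'J g x0) e)
      (row_mx (zeta *m 'J g x0 + second_deriv g x0 u) xi) ->
  second_tangent_set param_graph (row_mx x0 (a x0 + v0 *m b x0))
    (row_mx u (dir_deriv x0 v0 u + e *m b x0))
    (row_mx zeta (2 *: (e *m 'D_u b x0) +
      (dir_deriv x0 v0 zeta + (second_deriv a x0 u + v0 *m second_deriv b x0 u)) +
      xi *m b x0)).
Proof.
move=> gd [t [ps [tp psC Gps]]]; have [t0 tc] := tp.
pose p1 k := lsubmx (ps k); pose p2 k := rsubmx (ps k).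
have p1C : p1 k @[k --> \oo] --> zeta *m 'J g x0 + second_deriv g x0 u.
  by rewrite -[X in _ --> X](row_mxKl _ xi); exact: cvg_lsubmx.
have p2C : p2 k @[k --> \oo] --> xi.
  by rewrite -(row_mxKr (zeta *m 'J g x0 + second_deriv g x0 u) xi); exact: cvg_rsubmx.
have cz : (fun=> zeta) k @[k --> \oo] --> zeta by exact: cvg_cst.
have [Fg [FgC FgE]] := second_expand x0 u g2 tp cz.
pose x k : 'rV[R]_n := x0 + t k *: u + (2^-1 * t k ^+ 2) *: zeta.
pose y k : 'rV[R]_l := g x0 + t k *: (u *m 'J g x0) + (2^-1 * t k ^+ 2) *: p1 k.
pose v k : 'rV[R]_l := v0 + t k *: e + (2^-1 * t k ^+ 2) *: p2 k.
have xC : x k @[k --> \oo] --> x0 by exact: (@cvg_second_point _ x0 u zeta t (fun=> zeta) tp cz).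
have yC : y k @[k --> \oo] --> g x0 by exact: (@cvg_second_point _ (g x0) (u *m 'J g x0) _ t p1 tp p1C).
have vC : v k @[k --> \oo] --> v0 by exact: (@cvg_second_point _ v0 e _ t p2 tp p2C).
have Gk k : G (row_mx (y k) (v k)).
  by have := Gps k; rewrite -(hsubmxK (ps k)) !scale_row_mx !add_row_mx.
have [kap [x' [kap0 x'P]]] := local_lift gd xC yC.
(* Acceleration of the lifted arc. The residual is [(t^2 / 2) (p1 k - Fg k)], and [p1 k] and [Fg k]
   have the same limit, so [z k] still tends to [zeta]. *)
pose z k := zeta + (2 * (t k)^-1 ^+ 2) *: (x' k - x k).
have x'E k : x' k = x0 + t k *: u + (2^-1 * t k ^+ 2) *: z k.
  have tk : t k != 0 by rewrite gt_eqF.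
  by apply/rowP => j; rewrite !mxE; field.
have zC : z k @[k --> \oo] --> zeta.
  apply: (@cvg_dominated _ z zeta (fun k => kap * `|p1 k - Fg k|)); last first.
    rewrite -(mulr0 kap) -(@normr0 _ 'rV[R]_l); apply: cvgM; first exact: cvg_cst.
    apply: cvg_norm; rewrite -(subrr (zeta *m 'J g x0 + second_deriv g x0 u)).
    by apply: cvgB; [exact: p1C|rewrite jacobianE//].
  apply: filterS x'P => k [k1 _]; rewrite /z addrC addKr normrZ.
  have tk : 0 < 2 * (t k)^-1 ^+ 2 by rewrite mulr_gt0// exprn_gt0// invr_gt0.
  rewrite gtr0_norm// -ler_pdivlMl// (le_trans k1)//.
  rewrite [leRHS]mulrCA ler_wpM2l ?(ltW kap0)//.
  have -> : y k - g (x k) = (2^-1 * t k ^+ 2) *: (p1 k - Fg k).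
    by rewrite FgE /y jacobianE//; apply/rowP => j; rewrite !mxE; ring.
  have tk0 : 0 < 2^-1 * t k ^+ 2 by rewrite mulr_gt0// exprn_gt0.
  rewrite normrZ gtr0_norm// ler_wpM2r// invfM exprVn invrK//.
have x'C : x' k @[k --> \oo] --> x0.
  by under eq_fun do rewrite x'E; exact: (@cvg_second_point _ x0 u _ t z tp zC).
have gx' : g (x' k) @[k --> \oo] --> g x0 by apply: (cvg_comp x' g x'C); exact: cg.
have bx' : b (x' k) @[k --> \oo] --> b x0 by apply: (cvg_comp x' b x'C); exact: cb.
have [Fa [FaC FaE]] := second_expand x0 u a2 tp zC.
have [Fb [FbC FbE]] := second_expand x0 u b2 tp zC.
pose th k := row_mx (z k) (Fa k + v0 *m Fb k + 2 *: (e *m 'D_u b x0) +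
  t k *: (e *m Fb k) + p2 k *m b (x' k)).
have thC : th k @[k --> \oo] --> row_mx zeta
    (('D_zeta a x0 + second_deriv a x0 u) + v0 *m ('D_zeta b x0 + second_deriv b x0 u) +
     2 *: (e *m 'D_u b x0) + 0 *: (e *m ('D_zeta b x0 + second_deriv b x0 u)) + xi *m b x0).
  apply: cvg_row_mx; first exact: zC.
  apply: cvgD; last exact: (cvg_mulmx p2C bx').
  apply: cvgD; last first.
    by apply: cvgZ; [exact: tc|apply: cvg_mulmx; [exact: cvg_cst|exact: FbC]].
  apply: cvgD; last exact: cvg_cst.
  by apply: cvgD; [exact: FaC|apply: cvg_mulmx; [exact: cvg_cst|exact: FbC]].
have -> : 2 *: (e *m 'D_u b x0) +
      (dir_deriv x0 v0 zeta + (second_deriv a x0 u + v0 *m second_deriv b x0 u)) =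
    ('D_zeta a x0 + second_deriv a x0 u) + v0 *m ('D_zeta b x0 + second_deriv b x0 u) +
     2 *: (e *m 'D_u b x0) + 0 *: (e *m ('D_zeta b x0 + second_deriv b x0 u)).
  by rewrite scale0r addr0 /dir_deriv mulmxDr [LHS]addrC addrACA.
apply: (second_tangent_setI tp thC).
have := good_shift gd yC gx' vC; apply: filterS2 x'P => k [_ k1] k2.
exists (x' k), (v k); split; last by apply: k2; rewrite ?k1.
rewrite /th !scale_row_mx !add_row_mx -x'E; congr row_mx.
by rewrite (second_order_value _ _ _ (etrans (congr1 a (x'E k)) (FaE k))
  (etrans (congr1 b (x'E k)) (FbE k))).
Qed.

Lemma second_deriv0 p q (f : 'rV[R]_n -> 'M[R]_(p, q)) x : second_deriv f x 0 = 0.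
Proof. by apply/matrixP => i j; rewrite !mxE dotp0l. Qed.

Lemma dir_deriv0 x v : dir_deriv x v 0 = 0.
Proof. by rewrite /dir_deriv !derive_zero// mulmx0 addr0. Qed.

(** The two second-order inclusions for [u = 0] and [e = 0], where all second derivatives vanish. *)
Lemma tangent_param_graph (x0 : 'rV[R]_n) (v0 : 'rV[R]_l) : good x0 v0 ->
  tangent_cone param_graph (row_mx x0 (a x0 + v0 *m b x0)) =
  [set th | exists (zeta : 'rV[R]_n) (xi : 'rV[R]_l),
     th = row_mx zeta (dir_deriv x0 v0 zeta + xi *m b x0) /\
     tangent_cone G (row_mx (g x0) v0) (row_mx (zeta *m 'J g x0) xi)].
Proof.
move=> gd; rewrite !tangent_second.
have E0 : row_mx 0 (dir_deriv x0 v0 0 + 0 *m b x0) = 0 :> 'rV[R]_(n + m).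
  by rewrite dir_deriv0 mul0mx addr0 row_mx0.
have G0 : row_mx (0 *m 'J g x0) 0 = 0 :> 'rV[R]_(l + l) by rewrite mul0mx row_mx0.
have V zeta : 2 *: (0 *m 'D_0 b x0) +
    (dir_deriv x0 v0 zeta + (second_deriv a x0 0 + v0 *m second_deriv b x0 0)) =
    dir_deriv x0 v0 zeta.
  have -> : second_deriv a x0 0 = 0 by exact: second_deriv0.
  have -> : second_deriv b x0 0 = 0 by exact: second_deriv0.
  move: (dir_deriv x0 v0 zeta) ('D_0 b x0) => y1 y2.
  by rewrite mulmx0 !addr0 mul0mx scaler0 add0r.
have Vg zeta : zeta *m 'J g x0 + second_deriv g x0 0 = zeta *m 'J g x0.
  have -> : second_deriv g x0 0 = 0 by exact: second_deriv0.
  by rewrite addr0.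
apply/seteqP; split=> [th Tth|_ [zeta [xi [-> H]]]].
  have [|zeta [xi [-> H]]] := @second_tangent_param_graphP x0 0 v0 0 th gd (sub0mx _ _).
    by rewrite E0.
  exists zeta, xi; split.
    exact: (congr1 (fun y => row_mx zeta (y + xi *m b x0)) (V zeta)).
  rewrite -G0 -(Vg zeta); exact: H.
have := congr1 (fun y => row_mx zeta (y + xi *m b x0)) (V zeta) => /= <-.
rewrite -E0; apply: param_graph_second_tangent; first exact: gd.
rewrite G0 (Vg zeta); exact: H.
Qed.

Lemma covec_dotp x v r f zeta (xi : 'rV[R]_l) :
  dotp (covec x v r f) (row_mx zeta (dir_deriv x v zeta + xi *m b x)) =
  dotp (row_mx f (r *m (b x)^T)) (row_mx (zeta *m 'J g x) xi).
Proof.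
rewrite /covec !dotp_row_mx dotpDl dotpNl dotpDr -!dotp_mulmxr dir_derivE; ring.
Qed.

Lemma regular_normal_param_graph x v w : good x v ->
  regular_normal_cone param_graph (row_mx x (a x + v *m b x)) w <->
  exists (r : 'rV[R]_m) (f : 'rV[R]_l), [/\ (f <= B)%MS, w = covec x v r f &
    regular_normal_cone G (row_mx (g x) v) (row_mx f (r *m (b x)^T))].
Proof.
move=> gd; have [G0 Gal Jf bf] := gd; rewrite regular_normal_polar tangent_param_graph//.
split=> [[_ pol]|[r [f [fB -> /regular_normal_polar[_ pol]]]]]; last first.
  split; first by exists x, v.
  by move=> _ [zeta [xi [-> T]]]; rewrite covec_dotp; exact: pol.
pose r := rsubmx w.
have Ts (c : R) (p : 'rV[R]_(l + l)) : 0 < c -> tangent_cone G (row_mx (g x) v) p ->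
    tangent_cone G (row_mx (g x) v) (c *: p) by exact: tangent_cone_scale.
have bnd zeta xi : tangent_cone G (row_mx (g x) v) (row_mx (zeta *m 'J g x + 0) xi) ->
    dotp (lsubmx w + r *m (param_jacobian x v)^T) zeta + dotp (r *m (b x)^T) xi <= 0.
  rewrite addr0 => T.
  have : dotp w (row_mx zeta (dir_deriv x v zeta + xi *m b x)) <= 0.
    by apply: pol; exists zeta, xi.
  rewrite -{1}(hsubmxK w) dotp_row_mx dotpDr addrA -/r dotpDl.
  by rewrite -dir_derivE dotp_mulmxr [dotp r (xi *m _)]dotp_mulmxr.
have [f [fB fE fpol]] := covector_bounded (tangent_cone0 G0) Ts (aligned_tangent G0 Gal) Jf bnd.
exists r, f; split=> //; last by apply/regular_normal_polar.
by rewrite /covec -fE addrC addrK hsubmxK.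
Qed.

Lemma param_graph_expand (x0 : 'rV[R]_n) (v0 : 'rV[R]_l) (t : nat -> R)
    (us : nat -> 'rV[R]_(n + m)) (u0 : 'rV[R]_(n + m)) :
  good x0 v0 -> to0p t -> us k @[k --> \oo] --> u0 ->
  (forall k, param_graph (row_mx x0 (a x0 + v0 *m b x0) + t k *: us k)) ->
  exists (e : nat -> 'rV[R]_l) (e0 : 'rV[R]_l),
  [/\ (e0 <= B)%MS, e k @[k --> \oo] --> e0,
    rsubmx u0 = dir_deriv x0 v0 (lsubmx u0) + e0 *m b x0,
    forall k, a x0 + v0 *m b x0 + t k *: rsubmx (us k) =
      a (x0 + t k *: lsubmx (us k)) + (v0 + t k *: e k) *m b (x0 + t k *: lsubmx (us k)) &
    forall k, G (row_mx (g (x0 + t k *: lsubmx (us k))) (v0 + t k *: e k))].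
Proof.
move=> gd tp usC Ous; have [t0 tc] := tp.
set om := row_mx x0 _ in Ous.
pose zs k : 'rV[R]_(n + m) := om + t k *: us k.
have zsC : zs k @[k --> \oo] --> om.
  rewrite -[X in _ --> X]addr0 -(scale0r u0); apply: cvgD; first exact: cvg_cst.
  by apply: cvgZ; [exact: tc|exact: usC].
have [v [vC vP]] := param_graph_seq gd Ous zsC.
pose h k := lsubmx (us k); pose x k : 'rV[R]_n := x0 + t k *: h k.
have hC : h k @[k --> \oo] --> lsubmx u0 by exact: cvg_lsubmx.
have lzs k : lsubmx (zs k) = x k.
  by rewrite /zs /om -[us k in LHS]hsubmxK scale_row_mx add_row_mx row_mxKl.
have rzs k : rsubmx (zs k) = a x0 + v0 *m b x0 + t k *: rsubmx (us k).
  by rewrite /zs /om -[us k in LHS]hsubmxK scale_row_mx add_row_mx row_mxKr.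
have cx0 : (fun=> x0) k @[k --> \oo] --> x0 by exact: cvg_cst.
have xC : x k @[k --> \oo] --> x0.
  rewrite -[X in _ --> X]addr0 -(scale0r (lsubmx u0)); apply: cvgD; first exact: cvg_cst.
  by apply: cvgZ; [exact: tc|exact: hC].
pose e k := (t k)^-1 *: (v k - v0).
have vE k : v k = v0 + t k *: e k.
  by rewrite /e scalerA mulfV ?gt_eqF// scale1r addrC subrK.
have vP' k : a x0 + v0 *m b x0 + t k *: rsubmx (us k) = a (x k) + v k *m b (x k) /\
    G (row_mx (g (x k)) (v k)).
  by have := vP k; rewrite -/(zs k) lzs rzs.
have eB : \forall k \near \oo, (e k <= B)%MS.
  have := good_near_sub gd xC (fun k => (vP' k).2); apply: filterS => k vB.
  by rewrite scalemx_sub// addmx_sub// eqmx_opp (good_sub gd).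
have bx : b (x k) @[k --> \oo] --> b x0 by apply: (cvg_comp x b xC); exact: cb.
have eb k : e k *m b (x k) = rsubmx (us k) -
    ((t k)^-1 *: (a (x0 + t k *: h k) - a x0) + v0 *m ((t k)^-1 *: (b (x0 + t k *: h k) - b x0))).
  have [H _] := vP' k; have tk : t k != 0 by rewrite gt_eqF.
  apply: (scalerI tk); rewrite -/(x k).
  have -> : t k *: (e k *m b (x k)) = v k *m b (x k) - v0 *m b (x k).
    by rewrite -mulmxBl vE addrC addKr scalemxAl.
  have -> : v k *m b (x k) = a x0 + v0 *m b x0 + t k *: rsubmx (us k) - a (x k).
    by rewrite H addrC addKr.
  rewrite -scalemxAr -scalerDr scalerBr scalerA mulfV// scale1r mulmxBr.
  move: (v0 *m b x0) (v0 *m b (x k)) (a x0) (a (x k)) (t k *: rsubmx _) => y1 y2 y3 y4 y5.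
  by apply/rowP => j; rewrite !mxE; ring.
have ebC : e k *m b (x k) @[k --> \oo] --> rsubmx u0 - dir_deriv x0 v0 (lsubmx u0).
  under eq_fun do rewrite eb.
  apply: cvgB; first exact: cvg_rsubmx.
  apply: cvgD; first by apply: (first_order_quotient _ cx0 hC tp); case: a2.
  apply: cvg_mulmx; first exact: cvg_cst.
  by apply: (first_order_quotient _ cx0 hC tp); case: b2.
have [_ _ _ bf] := gd.
have [e0 [e0B eC e0b]] := injective_cvg bf bx eB ebC.
exists e, e0; split=> //.
- by rewrite e0b addrC subrK.
- by move=> k; have [H _] := vP' k; rewrite H -vE.
- by move=> k; have [_ H] := vP' k; rewrite -vE.
Qed.

(** By [covec_dotp] the first-order parts of the two pairings cancel, so division by [t k] leaves
    half of the second-order terms. The limit [u0] is arbitrary, since proximal normals in direction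
    zero require all tangent directions. *)
Lemma cvg_covec_pairing (x0 : 'rV[R]_n) (v0 e0 : 'rV[R]_l) (t : nat -> R)
    (us : nat -> 'rV[R]_(n + m)) (u0 : 'rV[R]_(n + m)) (e : nat -> 'rV[R]_l) r f :
  to0p t -> us k @[k --> \oo] --> u0 -> e k @[k --> \oo] --> e0 ->
  (forall k, a x0 + v0 *m b x0 + t k *: rsubmx (us k) =
      a (x0 + t k *: lsubmx (us k)) + (v0 + t k *: e k) *m b (x0 + t k *: lsubmx (us k))) ->
  (t k)^-1 * (dotp (covec x0 v0 r f) (us k) - dotp (row_mx f (r *m (b x0)^T))
    (row_mx ((t k)^-1 *: (g (x0 + t k *: lsubmx (us k)) - g x0)) (e k))) @[k --> \oo] -->
  2^-1 * (dotp r (2 *: (e0 *m 'D_(lsubmx u0) b x0) +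
      (second_deriv a x0 (lsubmx u0) + v0 *m second_deriv b x0 (lsubmx u0)))
    - dotp f (second_deriv g x0 (lsubmx u0))).
Proof.
move=> tp usC eC H; have [t0 tc] := tp.
pose h k := lsubmx (us k); set u := lsubmx u0.
have hC : h k @[k --> \oo] --> u by exact: cvg_lsubmx.
pose Q p q (F : 'rV[R]_n -> 'M[R]_(p, q)) k :=
  (2 * (t k)^-1 ^+ 2) *: (F (x0 + t k *: h k) - F x0 - t k *: 'D_(h k) F x0).
have QE p q (F : 'rV[R]_n -> 'M[R]_(p, q)) k : F (x0 + t k *: h k) =
    F x0 + t k *: 'D_(h k) F x0 + (2^-1 * t k ^+ 2) *: Q p q F k.
  have tk : t k != 0 by rewrite gt_eqF.
  rewrite /Q; move: (F (x0 + _)) (F x0) ('D_(h k) F x0) => y1 y2 y3.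
  by apply/matrixP => i j; rewrite !mxE; field.
have QaC : Q _ _ a k @[k --> \oo] --> second_deriv a x0 u by exact: second_order_quotient.
have QbC : Q _ _ b k @[k --> \oo] --> second_deriv b x0 u by exact: second_order_quotient.
have QgC : Q _ _ g k @[k --> \oo] --> second_deriv g x0 u by exact: second_order_quotient.
pose S k : 'rV[R]_m := Q _ _ a k + v0 *m Q _ _ b k + 2 *: (e k *m 'D_(h k) b x0) +
  t k *: (e k *m Q _ _ b k).
have SC : S k @[k --> \oo] --> second_deriv a x0 u + v0 *m second_deriv b x0 u +
    2 *: (e0 *m 'D_u b x0) + 0 *: (e0 *m second_deriv b x0 u).
  apply: cvgD; last by apply: cvgZ; [exact: tc|exact: cvg_mulmx].
  apply: cvgD.
    by apply: cvgD; [exact: QaC|apply: cvg_mulmx; [exact: cvg_cst|exact: QbC]].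
  apply: cvgZ; first exact: cvg_cst.
  apply: cvg_mulmx; first exact: eC.
  by apply: cvg_derive; [case: b2|exact: cvg_cst|exact: hC].
have usE k : rsubmx (us k) = dir_deriv x0 v0 (h k) + e k *m b x0 + (2^-1 * t k) *: S k.
  have tk : t k != 0 by rewrite gt_eqF.
  have := H k; rewrite -/(h k) -[v0 + t k *: e k]addr0 -(scaler0 _ (2^-1 * t k ^+ 2)).
  rewrite (second_order_value _ _ _ (QE _ _ a k) (QE _ _ b k)) mul0mx addr0 -/(S k) => Hk.
  rewrite -[RHS]addrA in Hk; move/addrI : Hk.
  rewrite (_ : 2^-1 * t k ^+ 2 = t k * (2^-1 * t k)); last by ring.
  by rewrite -(scalerA (t k)) -scalerDr => /(scalerI tk).
have E k : (t k)^-1 * (dotp (covec x0 v0 r f) (us k) - dotp (row_mx f (r *m (b x0)^T))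
    (row_mx ((t k)^-1 *: (g (x0 + t k *: h k) - g x0)) (e k))) =
    2^-1 * (dotp r (S k) - dotp f (Q _ _ g k)).
  have tk : t k != 0 by rewrite gt_eqF.
  have gE : (t k)^-1 *: (g (x0 + t k *: h k) - g x0) = h k *m 'J g x0 + (2^-1 * t k) *: Q _ _ g k.
    rewrite (QE _ _ g k) jacobianE//; move: (g x0) ('D_(h k) g x0) (Q _ _ g k) => y1 y2 y3.
    by apply/rowP => j; rewrite !mxE; field.
  have -> : us k = row_mx (h k) (dir_deriv x0 v0 (h k) + e k *m b x0) +
      row_mx 0 ((2^-1 * t k) *: S k) by rewrite add_row_mx addr0 -usE hsubmxK.
  have -> : row_mx ((t k)^-1 *: (g (x0 + t k *: h k) - g x0)) (e k) =
      row_mx (h k *m 'J g x0) (e k) + row_mx ((2^-1 * t k) *: Q _ _ g k) 0.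
    by rewrite add_row_mx addr0 gE.
  move: (S k) (Q _ _ g k) => S1 Q1.
  rewrite !dotpDr covec_dotp /covec !dotp_row_mx !dotp0r !dotpZr.
  by field.
rewrite (_ : (fun k => _) = (fun k => 2^-1 * (dotp r (S k) - dotp f (Q _ _ g k)))); last first.
  by apply/funext => k; exact: E.
apply: cvgM; first exact: cvg_cst.
apply: cvgB; last by apply: cvg_dotp; [exact: cvg_cst|exact: QgC].
apply: cvg_dotp; first exact: cvg_cst.
by rewrite scale0r addr0 [X in _ --> X](addrC _ (2 *: _)) in SC.
Qed.

Lemma covec_continuous (x : nat -> 'rV[R]_n) (v : nat -> 'rV[R]_l)
    (r : nat -> 'rV[R]_m) (f : nat -> 'rV[R]_l) x0 v0 r0 f0 :
  x k @[k --> \oo] --> x0 -> v k @[k --> \oo] --> v0 ->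
  r k @[k --> \oo] --> r0 -> f k @[k --> \oo] --> f0 ->
  covec (x k) (v k) (r k) (f k) @[k --> \oo] --> covec x0 v0 r0 f0.
Proof.
move=> xC vC rC fC; apply: cvg_row_mx; last exact: rC.
apply: cvgD.
  by apply: cvgN; apply: cvg_mulmx; [exact: rC|apply: cvg_trmx; exact: cvg_param_jacobian].
by apply: cvg_mulmx; [exact: fC|apply: cvg_trmx; apply: cvg_jacobian => //; case: g2].
Qed.

(** Regular normals at the nearby good points have the form [covec]; the first rank condition,
    through [injective_cvg], makes their components [f k] converge. *)
Lemma directional_normal_param_graphP (x0 u : 'rV[R]_n) (v0 e : 'rV[R]_l) w :
  good x0 v0 -> (e <= B)%MS ->
  directional_normal_cone param_graph (row_mx x0 (a x0 + v0 *m b x0))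
    (row_mx u (dir_deriv x0 v0 u + e *m b x0)) w ->
  exists (r : 'rV[R]_m) (f : 'rV[R]_l), [/\ (f <= B)%MS, w = covec x0 v0 r f &
    directional_normal_cone G (row_mx (g x0) v0) (row_mx (u *m 'J g x0) e)
      (row_mx f (r *m (b x0)^T))].
Proof.
move=> gd eB [t [us [ws [tp usC wsC Nws]]]]; have [t0 tc] := tp.
have [_ _ Jf bf] := gd.
have [ee [e0 [e0B eC e0E aE Gk]]] := param_graph_expand gd tp usC (fun k => (Nws k).1).
have ee0 : e = e0.
  apply: (injective_eq bf eB e0B); apply: (@addrI _ (dir_deriv x0 v0 u)).
  have := e0E; rewrite row_mxKr row_mxKl; exact.
pose h k := lsubmx (us k).
have hC : h k @[k --> \oo] --> u by rewrite -[X in _ --> X](row_mxKl _ (dir_deriv x0 v0 u + e *m b x0)); exact: cvg_lsubmx.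
pose x k : 'rV[R]_n := x0 + t k *: h k; pose v k : 'rV[R]_l := v0 + t k *: ee k.
have xC : x k @[k --> \oo] --> x0.
  rewrite -[X in _ --> X]addr0 -(scale0r u); apply: cvgD; first exact: cvg_cst.
  by apply: cvgZ; [exact: tc|exact: hC].
have vC : v k @[k --> \oo] --> v0.
  rewrite -[X in _ --> X]addr0 -(scale0r e0); apply: cvgD; first exact: cvg_cst.
  by apply: cvgZ; [exact: tc|exact: eC].
have bx : b (x k) @[k --> \oo] --> b x0 by apply: (cvg_comp x b xC); exact: cb.
have JC : ('J g (x k))^T @[k --> \oo] --> ('J g x0)^T.
  by apply: cvg_trmx; apply: cvg_jacobian xC; case: g2.
have gdk : \forall k \near \oo, good (x k) (v k).
  by have := good_near gd xC vC; apply: filterS => k; apply; exact: Gk.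
have zE k : row_mx x0 (a x0 + v0 *m b x0) + t k *: us k = row_mx (x k) (a (x k) + v k *m b (x k)).
  by rewrite -[us k in LHS]hsubmxK scale_row_mx add_row_mx aE.
pose r k := rsubmx (ws k).
have /choice[f fP] k : exists f : 'rV[R]_l, good (x k) (v k) ->
    [/\ (f <= B)%MS, ws k = covec (x k) (v k) (r k) f &
    regular_normal_cone G (row_mx (g (x k)) (v k)) (row_mx f (r k *m (b (x k))^T))].
  have [gk|ngk] := pselect (good (x k) (v k)); last by exists 0.
  have := Nws k; rewrite zE => /(regular_normal_param_graph _ gk)[r' [f [fB wE Nf]]].
  by exists f => _; rewrite /r wE row_mxKr.
have rC : r k @[k --> \oo] --> rsubmx w by exact: cvg_rsubmx.
have fB : \forall k \near \oo, (f k <= B)%MS.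
  by apply: filterS gdk => k /fP[].
have fJ : f k *m ('J g (x k))^T @[k --> \oo] -->
    lsubmx w + rsubmx w *m (param_jacobian x0 v0)^T.
  have H : lsubmx (ws k) + r k *m (param_jacobian (x k) (v k))^T @[k --> \oo] -->
      lsubmx w + rsubmx w *m (param_jacobian x0 v0)^T.
    apply: cvgD; first exact: cvg_lsubmx.
    by apply: cvg_mulmx; [exact: rC|apply: cvg_trmx; exact: cvg_param_jacobian].
  apply: cvg_trans H; apply: near_eq_cvg; apply: filterS gdk => k /fP[_ wE _].
  by rewrite {1}wE /covec row_mxKl addrC addrA subrr add0r.
have [f0 [f0B fC f0E]] := injective_cvg Jf JC fB fJ.
exists (rsubmx w), f0; split=> //.
  by rewrite /covec f0E addrC addrK hsubmxK.
pose q k : 'rV[R]_(l + l) := row_mx ((t k)^-1 *: (g (x0 + t k *: h k) - g x0)) (ee k).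
have qC : q k @[k --> \oo] --> row_mx (u *m 'J g x0) e.
  apply: cvg_row_mx; last by rewrite ee0.
  rewrite jacobianE//.
  have cx0 : (fun=> x0) k @[k --> \oo] --> x0 by exact: cvg_cst.
  by apply: (first_order_quotient _ cx0 hC tp); case: g2.
have NC : row_mx (f k) (r k *m (b (x k))^T) @[k --> \oo] --> row_mx f0 (rsubmx w *m (b x0)^T).
  apply: cvg_row_mx; first exact: fC.
  by apply: cvg_mulmx; [exact: rC|exact: cvg_trmx].
apply: (directional_normalI tp qC NC); apply: filterS gdk => k /fP[_ _].
have -> : row_mx (g x0) v0 + t k *: q k = row_mx (g (x k)) (v k).
  rewrite /q scale_row_mx add_row_mx scalerA mulfV ?gt_eqF// scale1r.
  by rewrite [g x0 + _]addrC subrK.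
exact.
Qed.

(** Both the base points and the normals of [G] have to be lifted: the former by [local_lift], the
    latter by adjusting [r]. *)
Lemma param_graph_directional_normal (x0 u : 'rV[R]_n) (v0 e : 'rV[R]_l) r f :
  good x0 v0 ->
  directional_normal_cone G (row_mx (g x0) v0) (row_mx (u *m 'J g x0) e)
      (row_mx f (r *m (b x0)^T)) ->
  directional_normal_cone param_graph (row_mx x0 (a x0 + v0 *m b x0))
    (row_mx u (dir_deriv x0 v0 u + e *m b x0)) (covec x0 v0 r f).
Proof.
move=> gd [t [qs [ps [tp qsC psC Nps]]]]; have [t0 tc] := tp.
have [G0 Gal Jf bf] := gd.
pose q1 k := lsubmx (qs k); pose q2 k := rsubmx (qs k).
have q1C : q1 k @[k --> \oo] --> u *m 'J g x0.
  by rewrite -[X in _ --> X](row_mxKl _ e); exact: cvg_lsubmx.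
have q2C : q2 k @[k --> \oo] --> e.
  by rewrite -(row_mxKr (u *m 'J g x0) e); exact: cvg_rsubmx.
pose x k : 'rV[R]_n := x0 + t k *: u.
pose y k : 'rV[R]_l := g x0 + t k *: q1 k.
pose v k : 'rV[R]_l := v0 + t k *: q2 k.
have lineC p (z0 z1 : 'rV[R]_p) (z : nat -> 'rV[R]_p) : z k @[k --> \oo] --> z1 ->
    z0 + t k *: z k @[k --> \oo] --> z0.
  move=> zC; rewrite -[X in _ --> X]addr0 -(scale0r z1); apply: cvgD; first exact: cvg_cst.
  by apply: cvgZ; [exact: tc|exact: zC].
have cu : (fun=> u) k @[k --> \oo] --> u by exact: cvg_cst.
have cx0 : (fun=> x0) k @[k --> \oo] --> x0 by exact: cvg_cst.
have xC : x k @[k --> \oo] --> x0 by exact: (lineC _ x0 u (fun=> u) cu).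
have yC : y k @[k --> \oo] --> g x0 by exact: (lineC _ _ _ _ q1C).
have vC : v k @[k --> \oo] --> v0 by exact: (lineC _ _ _ _ q2C).
have qsE k : row_mx (g x0) v0 + t k *: qs k = row_mx (y k) (v k).
  by rewrite -[qs k in LHS]hsubmxK scale_row_mx add_row_mx.
have Gk k : G (row_mx (y k) (v k)) by have [] := Nps k; rewrite qsE.
have [kap [x' [kap0 x'P]]] := local_lift gd xC yC.
pose h k : 'rV[R]_n := u + (t k)^-1 *: (x' k - x k).
have x'E k : x' k = x0 + t k *: h k.
  by rewrite scalerDr scalerA mulfV ?gt_eqF// scale1r addrA addrC subrK.
have gq : (t k)^-1 *: (g (x k) - g x0) @[k --> \oo] --> u *m 'J g x0.
  by rewrite jacobianE//; apply: (first_order_quotient _ cx0 cu tp); case: g2.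
have hC : h k @[k --> \oo] --> u.
  apply: (@cvg_dominated _ h u (fun k => kap * `|q1 k - (t k)^-1 *: (g (x k) - g x0)|)); last first.
    rewrite -(mulr0 kap) -(@normr0 _ 'rV[R]_l); apply: cvgM; first exact: cvg_cst.
    by apply: cvg_norm; rewrite -(subrr (u *m 'J g x0)); apply: cvgB; [exact: q1C|exact: gq].
  apply: filterS x'P => k [k1 _]; rewrite /h addrC addKr normrZ.
  have tk : 0 < (t k)^-1 by rewrite invr_gt0.
  rewrite gtr0_norm// -ler_pdivlMl// invrK (le_trans k1)//.
  rewrite [leRHS]mulrCA ler_wpM2l ?(ltW kap0)//.
  have -> : y k - g (x k) = t k *: (q1 k - (t k)^-1 *: (g (x k) - g x0)).
    rewrite scalerBr scalerA mulfV ?gt_eqF// scale1r /y.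
    by move: (t k *: q1 k) (g (x k)) (g x0) => y1 y2 y3; apply/rowP => j; rewrite !mxE; ring.
  by rewrite normrZ gtr0_norm.
have x'C : x' k @[k --> \oo] --> x0.
  by under eq_fun do rewrite x'E; exact: (lineC _ _ _ _ hC).
have gx' : g (x' k) @[k --> \oo] --> g x0 by apply: (cvg_comp x' g x'C); exact: cg.
have bx' : b (x' k) @[k --> \oo] --> b x0 by apply: (cvg_comp x' b x'C); exact: cb.
have BbC : B *m b (x' k) @[k --> \oo] --> B *m b x0 by apply: cvg_mulmx; [exact: cvg_cst|exact: bx'].
have [kap' kap'0 stab] := row_free_stable bf BbC.
pose f_ k := lsubmx (ps k); pose w_ k := rsubmx (ps k).
have fC : f_ k @[k --> \oo] --> f.
  by rewrite -[X in _ --> X](row_mxKl _ (r *m (b x0)^T)); exact: cvg_lsubmx.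
have wC : w_ k @[k --> \oo] --> r *m (b x0)^T.
  by rewrite -(row_mxKr f (r *m (b x0)^T)); exact: cvg_rsubmx.
(* By alignment [w_ k] only has to agree with some [r_ k *m (b (x' k))^T] after multiplication by
   [B^T]. The defect [del k] tends to zero, and the second rank condition removes it by a correction
   [d k] of comparable size. *)
pose del k : 'rV[R]_s := (w_ k - r *m (b (x' k))^T) *m B^T.
have delC : del k @[k --> \oo] --> (0 : 'rV[R]_s).
  rewrite -(mul0mx _ B^T) -(subrr (r *m (b x0)^T)); apply: cvg_mulmx; last exact: cvg_cst.
  apply: cvgB; first exact: wC.
  by apply: cvg_mulmx; [exact: cvg_cst|exact: cvg_trmx].
have /choice[d dP] k : exists d : 'rV[R]_m,
    ((forall u : 'rV[R]_s, `|u| <= kap' * `|u *m (B *m b (x' k))|) /\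
    (forall e : 'rV[R]_s, exists2 d : 'rV[R]_m, d *m (B *m b (x' k))^T = e & `|d| <= kap' * `|e|)) ->
    d *m (B *m b (x' k))^T = del k /\ `|d| <= kap' * `|del k|.
  have [[H1 H2]|nH] := pselect ((forall u : 'rV[R]_s, `|u| <= kap' * `|u *m (B *m b (x' k))|) /\
    (forall e : 'rV[R]_s, exists2 d : 'rV[R]_m, d *m (B *m b (x' k))^T = e & `|d| <= kap' * `|e|)); last by exists 0.
  by have [d ? ?] := H2 (del k); exists d.
have {}dP : \forall k \near \oo, d k *m (B *m b (x' k))^T = del k /\ `|d k| <= kap' * `|del k|.
  by apply: filterS stab => k; exact: dP.
pose r_ k : 'rV[R]_m := r + d k.
have rC : r_ k @[k --> \oo] --> r.
  apply: (@cvg_dominated _ r_ r (fun k => kap' * `|del k|)).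
    by apply: filterS dP => k [_ k1]; rewrite /r_ addrC addKr.
  rewrite -(mulr0 kap') -(@normr0 _ 'rV[R]_s); apply: cvgM; first exact: cvg_cst.
  exact: cvg_norm.
pose us k : 'rV[R]_(n + m) := row_mx (h k) ((t k)^-1 *:
  (a (x' k) + v k *m b (x' k) - (a x0 + v0 *m b x0))).
have usE k : row_mx x0 (a x0 + v0 *m b x0) + t k *: us k =
    row_mx (x' k) (a (x' k) + v k *m b (x' k)).
  rewrite /us scale_row_mx add_row_mx -x'E scalerA mulfV ?gt_eqF// scale1r.
  by rewrite [X in row_mx _ X]addrC subrK.
have usC : us k @[k --> \oo] --> row_mx u (dir_deriv x0 v0 u + e *m b x0).
  apply: cvg_row_mx; first exact: hC.
  have E k : (t k)^-1 *: (a (x' k) + v k *m b (x' k) - (a x0 + v0 *m b x0)) =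
      (t k)^-1 *: (a (x0 + t k *: h k) - a x0) +
      v0 *m ((t k)^-1 *: (b (x0 + t k *: h k) - b x0)) + q2 k *m b (x' k).
    have tk : t k != 0 by rewrite gt_eqF.
    have D (z : 'rV[R]_m) : t k *: ((t k)^-1 *: z) = z by rewrite scalerA mulfV// scale1r.
    have D3 (z1 z2 z3 : 'rV[R]_m) :
      t k *: ((t k)^-1 *: z1 + (t k)^-1 *: z2 + z3) = z1 + z2 + t k *: z3 by rewrite !scalerDr !D.
    apply: (scalerI tk); rewrite -x'E -scalemxAr [LHS]D [RHS]D3.
    rewrite mulmxBr /v mulmxDl -scalemxAl.
    move: (v0 *m b x0) (v0 *m b (x' k)) (a x0) (a (x' k)) (t k *: (q2 k *m b (x' k))) => y1 y2 y3 y4 y5.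
    by apply/rowP => j; rewrite !mxE; ring.
  under eq_fun do rewrite E.
  apply: cvgD; last by apply: cvg_mulmx; [exact: q2C|exact: bx'].
  apply: cvgD; first by apply: (first_order_quotient _ cx0 hC tp); case: a2.
  apply: cvg_mulmx; first exact: cvg_cst.
  by apply: (first_order_quotient _ cx0 hC tp); case: b2.
apply: (directional_normalI tp usC (covec_continuous x'C vC rC fC)).
have al : \forall k \near \oo, aligned_at B G (row_mx (g (x' k)) (v k)).
  by apply: (aligned_near Gal); apply: cvg_row_mx; [exact: gx'|exact: vC].
have gdk := good_near gd x'C vC.
have sh1 := good_shift gd yC gx' vC.
(* Near [(g x0, v0)] the set [G] is unchanged by the translation from [y k] to [g (x' k)], so the
   germs of [G] at both points, and hence the regular normals, agree. *)
have shift : \forall k \near \oo, y k *m B^T = g (x' k) *m B^T ->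
    forall p, regular_normal_cone G (row_mx (y k) (v k)) p ->
      regular_normal_cone G (row_mx (g (x' k)) (v k)) p.
  have [e' e'0 [_ GG]] := Gal.
  have e2 : 0 < e' / 2 by rewrite divr_gt0.
  have near (z : nat -> 'rV[R]_l) : z k @[k --> \oo] --> g x0 ->
      \forall k \near \oo, `|row_mx (z k) (v k) - row_mx (g x0) v0| < e' / 2.
    move=> zg; have zv : row_mx (z k) (v k) @[k --> \oo] --> row_mx (g x0) v0.
      by apply: cvg_row_mx; [exact: zg|exact: vC].
    by have /cvgrPdist_lt/(_ _ e2) := zv; apply: filterS => k; rewrite distrC.
  apply: filterS2 (near y yC) (near _ gx') => k k1 k2 yB p.
  apply: (iffLR (@regular_normal_local _ _ G G _ _ 1 p ltr01 _)).
  exists (e' / 2) => // p' p'e; rewrite scale1r.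
  have tri (z : 'rV[R]_(l + l)) : `|z - row_mx (g x0) v0| < e' / 2 ->
      `|z + p' - row_mx (g x0) v0| < e'.
    by move=> ze; rewrite addrAC (le_lt_trans (ler_normD _ _))// [ltRHS]splitr ltrD.
  have lE (z : 'rV[R]_l) : lsubmx (row_mx z (v k) + p') = z + lsubmx p'.
    by rewrite linearD/= row_mxKl.
  have rE (z : 'rV[R]_l) : rsubmx (row_mx z (v k) + p') = v k + rsubmx p'.
    by rewrite linearD/= row_mxKr.
  have LE : lsubmx (row_mx (y k) (v k) + p') *m B^T = lsubmx (row_mx (g (x' k)) (v k) + p') *m B^T.
    by rewrite 2!lE (mulmxDl (y k)) (mulmxDl (g (x' k))) yB.
  have RE : rsubmx (row_mx (y k) (v k) + p') = rsubmx (row_mx (g (x' k)) (v k) + p') by rewrite 2!rE.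
  by split; [exact: (GG _ _ (tri _ k1) (tri _ k2) LE RE)
            |exact: (GG _ _ (tri _ k2) (tri _ k1) (esym LE) (esym RE))].
near=> k.
have [x'k1 x'k2] : `|x' k - x k| <= kap * `|y k - g (x k)| /\ g (x' k) *m B^T = y k *m B^T.
  by near: k.
have [dk _] : d k *m (B *m b (x' k))^T = del k /\ `|d k| <= kap' * `|del k| by near: k.
have Gk' : G (row_mx (g (x' k)) (v k)).
  have H : y k *m B^T = g (x' k) *m B^T -> G (row_mx (y k) (v k)) -> G (row_mx (g (x' k)) (v k)).
    by near: k.
  by apply: H.
have gk : good (x' k) (v k).
  have H : G (row_mx (g (x' k)) (v k)) -> good (x' k) (v k) by near: k.
  exact: H.
have Nk : regular_normal_cone G (row_mx (g (x' k)) (v k)) (row_mx (f_ k) (w_ k)).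
  have H : y k *m B^T = g (x' k) *m B^T ->
    forall p, regular_normal_cone G (row_mx (y k) (v k)) p ->
      regular_normal_cone G (row_mx (g (x' k)) (v k)) p by near: k.
  by apply: H => //; rewrite /f_ /w_ hsubmxK -qsE; exact: Nps.
have alk : aligned_at B G (row_mx (g (x' k)) (v k)) by near: k.
have [fB NH] := aligned_regular_normal (r_ k *m (b (x' k))^T) Gk' alk Nk.
rewrite usE; apply/regular_normal_param_graph => //.
exists (r_ k), (f_ k); split=> //; apply: NH.
rewrite /r_ mulmxDl mulmxDl -[d k *m _ *m _]mulmxA -trmx_mul dk /del mulmxBl.
by rewrite addrC subrK.
Unshelve. all: by end_near. Qed.

End ParametrizedGraph.

(** * Graphs of polyhedral normal cone mappings *)

Section FinitelyGeneratedCones.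
Context {R : realType} {l : nat}.
Implicit Types (u v w a D : 'rV[R]_l) (s L : seq 'rV[R]_l).

(** Adding one generator amounts to projecting out one nonnegative parameter, that is, to one
    elimination step. *)
Fixpoint gen_cone s : set 'rV[R]_l :=
  if s is a :: s' then [set v | exists2 t : R, 0 <= t & gen_cone s' (v - t *: a)]
  else [set 0].

Definition seq_polar L : set 'rV[R]_l := [set v | all (fun D => dotp D v <= 0) L].

(** The combinations in the second list are positive and orthogonal to [a]. *)
Definition eliminate a L :=
  [seq D <- L | dotp D a <= 0] ++
  [seq (- (dotp D' a)) *: D + dotp D a *: D' |
     D <- [seq D <- L | 0 < dotp D a], D' <- [seq D <- L | dotp D a < 0]].

(* Fourier-Motzkin elimination of [t]: the bounds [dotp D v / dotp D a] on [t]
   are lower ones if [dotp D a > 0] and upper ones if [dotp D a < 0]. *)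
Lemma seq_polar_eliminate a L v :
  (exists2 t : R, 0 <= t & seq_polar L (v - t *: a)) <-> seq_polar (eliminate a L) v.
Proof.
split=> [[t t0 /allP Lt]|].
  have Lt' D : D \in L -> dotp D v <= t * dotp D a.
    by move/Lt; rewrite dotpDr dotpNr dotpZr subr_le0.
  apply/allP => D; rewrite mem_cat => /orP[|].
    rewrite mem_filter => /andP[Da DL]; apply: le_trans (Lt' _ DL) _.
    by rewrite mulr_ge0_le0.
  move=> /allpairsP[[D1 D2]/= []]; rewrite !mem_filter => /andP[D1a D1L] /andP[D2a D2L] ->.
  rewrite dotpDl !dotpZl.
  apply: (@le_trans _ _ (- (dotp D2 a) * (t * dotp D1 a) + dotp D1 a * (t * dotp D2 a))).
    by apply: lerD; apply: ler_wpM2l; rewrite ?Lt' ?oppr_ge0// ltW.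
  by rewrite le_eqVlt; apply/orP; left; apply/eqP; ring.
move=> /allP H.
have H1 D : D \in L -> dotp D a <= 0 -> dotp D v <= 0.
  by move=> DL Da; apply: H; rewrite mem_cat mem_filter Da DL.
have H2 D D' : D \in L -> D' \in L -> 0 < dotp D a -> dotp D' a < 0 ->
    dotp D v / dotp D a <= dotp D' v / dotp D' a.
  move=> DL D'L Da D'a.
  have := H (- (dotp D' a) *: D + dotp D a *: D').
  rewrite mem_cat => /(_ _)/wrap[].
    by apply/orP; right; apply/allpairsP; exists (D, D'); rewrite !mem_filter Da DL D'a.
  rewrite dotpDl !dotpZl => K.
  rewrite ler_pdivrMr// mulrAC ler_ndivlMr//; nra.
(* The largest lower bound, floored at [0]: [H2] puts it below the upper bounds, and [H1] makes
   those nonnegative. *)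
pose t := \big[Num.max/0]_(D <- L | 0 < dotp D a) (dotp D v / dotp D a).
have t0 : 0 <= t by apply: bigmax_ge_id.
exists t => //; apply/allP => D DL; rewrite dotpDr dotpNr dotpZr subr_le0.
have [Da|Da|Da] := ltgtP (dotp D a) 0.
- rewrite -ler_ndivlMr//.
  rewrite /t big_seq_cond; apply: bigmax_le => [|D' /andP[D'L D'a]]; last exact: H2.
  by rewrite nmulr_lge0 ?invr_lt0//; apply: H1 => //; exact: ltW.
- by rewrite -ler_pdivrMr//; exact: (@le_bigmax_seq _ R _ L 0 D (fun D => 0 < dotp D a) (fun D => dotp D v / dotp D a)).
- by rewrite Da mulr0 H1// Da.
Qed.

(** Weyl's theorem. The cone without generators is cut out by the unit vectors and their
    negatives. *)
Lemma gen_cone_polar s : exists L, gen_cone s = seq_polar L.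
Proof.
elim: s => [|a s [L sL]].
  exists ([seq delta_mx 0 i | i <- enum 'I_l] ++ [seq - delta_mx 0 i | i <- enum 'I_l]).
  apply/seteqP; split=> v /= => [->|/allP H].
    by apply/allP => D _; rewrite dotp0r.
  apply/rowP => i; rewrite mxE; apply/le_anti/andP; split.
    rewrite -dotp_delta dotpC; apply: H; rewrite mem_cat; apply/orP; left.
    by apply/mapP; exists i; rewrite ?mem_enum.
  rewrite -oppr_le0 -dotp_delta -dotpNr dotpC; apply: H; rewrite mem_cat; apply/orP; right.
  by apply/mapP; exists i; rewrite ?mem_enum.
exists (eliminate a L); apply/seteqP; split=> v /=; rewrite sL.
  by move/seq_polar_eliminate.
by move=> vL; apply/seq_polar_eliminate.
Qed.

Lemma gen_cone_dotp_le0 s v w : gen_cone s v ->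
  (forall a, a \in s -> dotp a w <= 0) -> dotp v w <= 0.
Proof.
elim: s v => [|a s IH] v /=; first by move=> -> _; rewrite dotp0l.
move=> [t t0 sv] H; have /IH : gen_cone s (v - t *: a) by [].
move=> /(_ _)/wrap[]; first by move=> b bs; apply: H; rewrite inE bs orbT.
rewrite dotpDl dotpNl dotpZl subr_le0 => /le_trans; apply.
by rewrite mulr_ge0_le0// H// mem_head.
Qed.

Lemma gen_cone0 s : gen_cone s 0.
Proof. by elim: s => //= a s IH; exists 0; rewrite // scale0r subrr. Qed.

Lemma gen_cone_mem s a : a \in s -> gen_cone s a.
Proof.
elim: s => //= b s IH; rewrite inE => /predU1P[<-|/IH as_].
  by exists 1; rewrite ?ler01// scale1r subrr; exact: gen_cone0.
by exists 0; rewrite ?lexx// scale0r subr0.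
Qed.

End FinitelyGeneratedCones.

(** * Local structure of the graph of [N_P] *)

Section PolyhedralNormalCone.
Context {R : realType} {l q : nat}.
Variables (a : 'I_q -> 'rV[R]_l) (c : 'I_q -> R).

Local Notation P := [set y : 'rV[R]_l | forall i, dotp (a i) y <= c i].
Local Notation G := (gph (convex_normal_cone P)).

Definition active (y : 'rV[R]_l) : {set 'I_q} := [set i | dotp (a i) y == c i].

Lemma near_forall {I : finType} k (x : 'rV[R]_k) (Q : I -> 'rV[R]_k -> Prop) :
  (forall i, \forall p \near x, Q i p) -> \forall p \near x, forall i, Q i p.
Proof. exact: (@filter_forall _ I Q (nbhs x)). Qed.

Lemma cvg_dotp_near k (h z : 'rV[R]_k) :
  dotp h (z + p) @[p --> (0 : 'rV[R]_k)] --> dotp h z.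
Proof.
have FF : Filter (nbhs (0 : 'rV[R]_k)) by exact: nbhs_filter.
apply: (@cvg_dotp _ _ _ FF k (fun=> h) (fun p => z + p)).
  exact: (@cvg_cst _ _ _ _ FF).
rewrite -[X in _ --> X]addr0; apply: (@cvgD _ _ _ _ FF (fun=> z) id); last exact: cvg_id.
exact: (@cvg_cst _ _ _ _ FF).
Qed.

Lemma gphP p k (F : 'rV[R]_p -> set 'rV[R]_k) y v : gph F (row_mx y v) <-> F y v.
Proof.
split=> [[y' [v' [/eq_row_mx[-> ->]]]]//|Fyv].
by exists y, v.
Qed.

Lemma cvg0_scale (u : 'rV[R]_l) : s *: u @[s --> (0 : R)^'+] --> (0 : 'rV[R]_l).
Proof.
apply: cvg_at_right_filter; rewrite -[X in _ --> X](scale0r u).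
by apply: cvgZ; [exact: cvg_id|exact: cvg_cst].
Qed.

Lemma inactive_near (y : 'rV[R]_l) : P y ->
  \forall d \near (0 : 'rV[R]_l), forall i, i \notin active y -> dotp (a i) (y + d) < c i.
Proof.
move=> Py; apply: near_forall => i; have [|iy] := boolP (i \in active y).
  by move=> iy; apply: filterS filterT => ? _.
have yi : dotp (a i) y < c i by rewrite lt_neqAle Py andbT; move: iy; rewrite inE.
have := @cvg_dotp_near _ (a i) y; move=> /(cvgr_lt (dotp (a i) y))/(_ _ yi).
by apply: filterS => d ? _.
Qed.

Lemma feasible_direction (y u : 'rV[R]_l) : P y ->
  (forall i, i \in active y -> dotp (a i) u <= 0) ->
  exists2 s : R, 0 < s & P (y + s *: u).
Proof.
move=> Py ua.
have [s [s0 H]] : exists s : R, 0 < s /\ forall i, i \notin active y -> dotp (a i) (y + s *: u) < c i.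
  near (0 : R)^'+ => s; exists s; split; first by near: s; exact: nbhs_right_gt.
  by near: s; exact: (cvg0_scale u (inactive_near Py)).
exists s => // i; have [iy|/H/ltW//] := boolP (i \in active y).
rewrite dotpDr dotpZr; move: (iy); rewrite inE => /eqP ->.
by rewrite gerDl mulr_ge0_le0 ?(ltW s0)// ua.
Unshelve. all: by end_near. Qed.

(** Farkas: every inequality [D] describing the generated cone is nonpositive on the active
    gradients, hence a feasible direction at [y], on which normals are nonpositive. *)
Lemma normal_cone_gen y : P y ->
  convex_normal_cone P y = gen_cone [seq a i | i <- enum (active y)].
Proof.
move=> Py; apply/seteqP; split=> v.
  move=> [_ Nv]; have [L LE] := gen_cone_polar [seq a i | i <- enum (active y)].
  rewrite LE; apply/allP => D DL.
  have aD i : i \in active y -> dotp (a i) D <= 0.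
    move=> iy; have : gen_cone [seq a i | i <- enum (active y)] (a i).
      by apply: gen_cone_mem; apply/mapP; exists i; rewrite ?mem_enum.
    by rewrite LE dotpC => /allP; exact.
  have [s s0 /Nv] := feasible_direction Py aD.
  by rewrite addrC addKr dotpZr pmulr_rle0// dotpC.
move=> gv; split=> // z' Pz'; apply: (gen_cone_dotp_le0 gv) => b /mapP[i]; rewrite mem_enum => iy ->.
by rewrite dotpDr dotpNr subr_le0; move: iy; rewrite inE => /eqP ->.
Qed.

Lemma closed_gph_normal : closed G.
Proof.
apply: seq_closed => us u usu Gus.
have yC : lsubmx (us k) @[k --> \oo] --> lsubmx u by exact: cvg_lsubmx.
have vC : rsubmx (us k) @[k --> \oo] --> rsubmx u by exact: cvg_rsubmx.
have GE k : convex_normal_cone P (lsubmx (us k)) (rsubmx (us k)).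
  by apply/gphP; rewrite hsubmxK.
rewrite -[u]hsubmxK; apply/gphP; split=> [i|z' Pz'].
  have dC : dotp (a i) (lsubmx (us k)) @[k --> \oo] --> dotp (a i) (lsubmx u).
    by apply: cvg_dotp => //; exact: cvg_cst.
  by apply: (cvgr_to_le dC); apply: nearW => k; have [] := GE k.
have dC : dotp (rsubmx (us k)) (z' - lsubmx (us k)) @[k --> \oo] --> dotp (rsubmx u) (z' - lsubmx u).
  by apply: cvg_dotp; [exact: vC|apply: cvgB; [exact: cvg_cst|exact: yC]].
by apply: (cvgr_to_le dC); apply: nearW => k; have [_] := GE k; apply.
Qed.

(** An affine function vanishing at [z] is only multiplied by [s]; one that does not vanish keeps
    its sign nearby. *)
Lemma sg_affine_conic k (h z : 'rV[R]_k) (ga : R) :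
  \forall p \near (0 : 'rV[R]_k), forall s : R, 0 < s <= 1 ->
    Num.sg (dotp h (z + p) - ga) = Num.sg (dotp h (z + s *: p) - ga).
Proof.
have [hz|hz] := eqVneq (dotp h z) ga.
  apply: filterS filterT => p _ s /andP[s0 _]; rewrite !dotpDr dotpZr hz ![ga + _]addrC !addrK.
  by rewrite sgrM (gtr0_sg s0) mul1r.
have dC : dotp h p @[p --> (0 : 'rV[R]_k)] --> (0 : R).
  by have := @cvg_dotp_near k h 0; rewrite dotp0r; under eq_fun do rewrite add0r.
have e0 : 0 < `|dotp h z - ga| by rewrite normr_gt0 subr_eq0.
move/cvgr0_norm_lt : dC => /(_ _ e0); apply: filterS => p pe s /andP[s0 s1].
have H (x : R) : `|x| < `|dotp h z - ga| -> Num.sg (dotp h z + x - ga) = Num.sg (dotp h z - ga).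
  move=> xe; rewrite addrAC; move: xe; have [y0|y0|//] := ltgtP (dotp h z - ga) 0.
  - rewrite (ltr0_norm y0) ltr_norml => /andP[_ ?]; rewrite !ltr0_sg//; lra.
  - rewrite (gtr0_norm y0) ltr_norml => /andP[? _]; rewrite !gtr0_sg//; lra.
  by move=> ->; rewrite normr0 ltNge normr_ge0.
rewrite !dotpDr dotpZr !H// normrM (gtr0_norm s0) (le_lt_trans _ pe)//.
by rewrite ler_piMl.
Qed.

(** The inequalities for the normal depend on the active set, so those of all subsets [J] are
    controlled at once; signs of the constraints fix feasibility and the active set itself. *)
Lemma conic_gph_normal z : conic_at G z.
Proof.
have /choice[L LP] (J : {set 'I_q}) := gen_cone_polar [seq a i | i <- enum J].
have h1 : \forall p \near (0 : 'rV[R]_(l + l)), forall i, forall s : R, 0 < s <= 1 ->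
    Num.sg (dotp (row_mx (a i) 0) (z + p) - c i) = Num.sg (dotp (row_mx (a i) 0) (z + s *: p) - c i).
  by apply: near_forall => i; exact: sg_affine_conic.
have h2 : \forall p \near (0 : 'rV[R]_(l + l)), forall J (j : 'I_(size (L J))), forall s : R, 0 < s <= 1 ->
    Num.sg (dotp (row_mx 0 (tnth (in_tuple (L J)) j)) (z + p) - 0) =
    Num.sg (dotp (row_mx 0 (tnth (in_tuple (L J)) j)) (z + s *: p) - 0).
  by apply: near_forall => J; apply: near_forall => j; exact: sg_affine_conic.
have /nbhs_norm0P[e /= e0 H] : \forall p \near (0 : 'rV[R]_(l + l)), forall s : R, 0 < s <= 1 ->
    G (z + p) <-> G (z + s *: p); last by exists e => // p s pe s01; exact: H.
apply: filterS2 h1 h2 => p H1 H2 s s01.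
have lE w i : dotp (row_mx (a i) 0) w = dotp (a i) (lsubmx w).
  by rewrite -[w in LHS]hsubmxK dotp_row_mx dotp0l addr0.
have rE w D : dotp (row_mx 0 D) w = dotp D (rsubmx w).
  by rewrite -[w in LHS]hsubmxK dotp_row_mx dotp0l add0r.
have le_sg (x y : R) : Num.sg x = Num.sg y -> (x <= 0) = (y <= 0).
  by move=> xy; rewrite -sgr_le0 xy sgr_le0.
set w := z + p; set w' := z + s *: p.
have E1 i : (dotp (a i) (lsubmx w) <= c i) = (dotp (a i) (lsubmx w') <= c i).
  by rewrite -!lE -subr_le0 -[RHS]subr_le0; apply: le_sg; exact: H1.
have E2 : active (lsubmx w) = active (lsubmx w').
  apply/setP => i; rewrite !inE -!lE -subr_eq0 -[RHS]subr_eq0 -sgr_eq0 (H1 i s s01).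
  by rewrite sgr_eq0.
have E3 J D : D \in L J -> (dotp D (rsubmx w) <= 0) = (dotp D (rsubmx w') <= 0).
  move=> DL; have [j ->] : exists j, D = tnth (in_tuple (L J)) j.
    by have [j ->] := seq_tnthP DL; exists j.
  by rewrite -!rE; apply: le_sg; have := H2 J j s s01; rewrite !subr0.
have GE x : G x <-> (forall i, dotp (a i) (lsubmx x) <= c i) /\
    seq_polar (L (active (lsubmx x))) (rsubmx x).
  rewrite -[x in G x]hsubmxK gphP; split.
    by move=> Nx; have Px := Nx.1; move: Nx; rewrite normal_cone_gen// LP.
  by move=> [Px]; rewrite -LP -normal_cone_gen.
rewrite !GE E2; split=> -[Pw /allP Lw]; split.
- by move=> i; rewrite -E1.
- by apply/allP => D DL; rewrite -(E3 _ _ DL) Lw.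
- by move=> i; rewrite E1.
- by apply/allP => D DL; rewrite (E3 _ _ DL) Lw.
Qed.

(** No constraint becomes active near [y], so [z' - y] is a feasible direction at [y + d] for every
    [z'] in [P]. *)
Lemma normal_cone_near y : P y -> \forall d \near (0 : 'rV[R]_l),
  forall v, convex_normal_cone P (y + d) v -> convex_normal_cone P y v.
Proof.
move=> Py; apply: filterS (inactive_near Py) => d Hd v [Pyd Nv]; split=> // z' Pz'.
have [s s0 /Nv] : exists2 s : R, 0 < s & P (y + d + s *: (z' - y)).
  apply: feasible_direction => // i; have [iy _|/Hd] := boolP (i \in active y); last first.
    by rewrite inE => /lt_eqF ->.
  by rewrite dotpDr dotpNr subr_le0; move: iy; rewrite inE => /eqP ->.
by rewrite addrC addKr dotpZr pmulr_rle0.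
Qed.

Definition active_matrix (y : 'rV[R]_l) : 'M[R]_(q, l) :=
  \matrix_i (if i \in active y then a i else 0).

Lemma active_row y i : i \in active y -> (a i <= active_matrix y)%MS.
Proof. by move=> iy; rewrite -[a i](_ : row i (active_matrix y) = _) ?row_sub// rowK iy. Qed.

Lemma normal_cone_sub y v : convex_normal_cone P y v -> (v <= active_matrix y)%MS.
Proof.
move=> Nv; apply: submx_perp => d dA.
have ad i : i \in active y -> dotp (a i) d = 0.
  by move=> /active_row ai; exact: perp_submx ai dA.
have gv : gen_cone [seq a i | i <- enum (active y)] v.
  by rewrite -normal_cone_gen//; case: Nv.
apply/le_anti/andP; split.
  by apply: (gen_cone_dotp_le0 gv) => b /mapP[i]; rewrite mem_enum => iy ->; rewrite ad.
rewrite -oppr_le0 -dotpNr.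
by apply: (gen_cone_dotp_le0 gv) => b /mapP[i]; rewrite mem_enum => iy ->; rewrite dotpNr ad// oppr0.
Qed.

Lemma active_span y v : P y -> (v <= active_matrix y)%MS ->
  span_diff (convex_normal_cone P y) v.
Proof.
move=> Py /submxP[w ->]; exists q, (fun i => w 0 i), (fun i => row i (active_matrix y)).
split; last by rewrite mulmx_sum_row.
have N0 : convex_normal_cone P y 0 by split=> // z' _; rewrite dotp0l.
move=> i; exists (row i (active_matrix y)); last by exists 0 => //; rewrite subr0.
rewrite rowK; case: ifP => // iy; rewrite normal_cone_gen//.
by apply: gen_cone_mem; apply/mapP; exists i; rewrite ?mem_enum.
Qed.

(** A displacement orthogonal to the rows of [B] keeps the constraints active at [y] at their values
    and is orthogonal to all nearby normals; the other constraints stay strict by continuity. *)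
Lemma aligned_gph_normal s (B : 'M[R]_(s, l)) y v : (active_matrix y <= B)%MS ->
  P y -> aligned_at B G (row_mx y v).
Proof.
move=> AB Py.
have /nbhs_norm0P[e1 /= e10 H1] := normal_cone_near Py.
have /nbhs_norm0P[e2 /= e20 H2] := inactive_near Py.
exists (Num.min e1 e2); first by rewrite lt_min e10.
have sub p : `|lsubmx p - lsubmx (row_mx y v)| < Num.min e1 e2 -> G p -> (rsubmx p <= B)%MS.
  rewrite row_mxKl lt_min => /andP[pe1 _] Gp; apply: submx_trans AB; apply: normal_cone_sub.
  apply: (H1 (lsubmx p - y)) => //; rewrite addrC subrK.
  by apply/gphP; rewrite hsubmxK.
split=> // p p' pe p'e pp' pp2 Gp.
have le w : `|w - row_mx y v| < Num.min e1 e2 -> `|lsubmx w - lsubmx (row_mx y v)| < Num.min e1 e2.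
  by apply: le_lt_trans; rewrite -linearB lsubmx_norm_le.
have /gphP[Pp Np] : G (row_mx (lsubmx p) (rsubmx p)) by rewrite hsubmxK.
have dB : (lsubmx p' - lsubmx p) *m B^T = 0 by rewrite mulmxBl pp' subrr.
rewrite -[p']hsubmxK -pp2; apply/gphP; split=> [i|z' Pz'].
  have [/active_row aB|iy] := boolP (i \in active y).
    have := perp_submx (submx_trans aB AB) dB.
    by rewrite dotpDr dotpNr => /subr0_eq ->.
  have := H2 (lsubmx p' - y); rewrite [y + _]addrC subrK => H; apply/ltW/H => //.
  by have := le _ p'e; rewrite row_mxKl lt_min => /andP[].
have pB := sub _ (le _ pe) Gp.
have -> : z' - lsubmx p' = (z' - lsubmx p) - (lsubmx p' - lsubmx p).
  by rewrite opprB addrA subrK.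
by rewrite dotpDr dotpNr (perp_submx pB dB) subr0 Np.
Qed.

End PolyhedralNormalCone.

(** * Support functions of second-order tangent sets *)

Section SecondOrderSupport.
Context {R : realType} {k : nat}.
Implicit Types (C T : set 'rV[R]_k) (z u v w th q : 'rV[R]_k).

Lemma second_tangent_step (t : nat -> R) (ws : nat -> 'rV[R]_k) u w :
  to0p t -> ws i @[i --> \oo] --> w -> u + (2^-1 * t i) *: ws i @[i --> \oo] --> u.
Proof.
move=> [_ tc] wsw; rewrite -[X in _ --> X]addr0 -(scale0r w) -(mulr0 2^-1).
apply: cvgD; first exact: cvg_cst.
by apply: cvgZ; [apply: cvgM; [exact: cvg_cst|exact: tc]|exact: wsw].
Qed.

(** On the arc [z + t h] with [h = u + (t / 2) w], orthogonality to [u] makes the pairing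
    [(t^2 / 2) dotp v w], which the proximal inequality bounds by [ga t^2 |h|^2]. *)
Lemma prox_support_fun C z u v : directional_proximal_normal_cone C z u v ->
  (support_fun (second_tangent_set C z u) v < +oo)%E.
Proof.
move=> [[del [rho [ga [del0 rho0 ga0 H]]]]/= vu].
apply: (@le_lt_trans _ _ (2 * ga * enorm u ^+ 2)%:E); last exact: ltry.
apply: ge_ereal_sup => _ [w [t [ws [tp wsw Cw]]] <-]; rewrite lee_fin.
pose h i : 'rV[R]_k := u + (2^-1 * t i) *: ws i; have [t0 tc] := tp.
have hu : h i @[i --> \oo] --> u by exact: (second_tangent_step tp wsw).
have zE i : z + t i *: u + (2^-1 * t i ^+ 2) *: ws i - z = t i *: h i.
  by apply/rowP => j; rewrite !mxE; ring.
have small : \forall i \near \oo, enorm (t i *: h i) < del.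
  have : enorm (t i *: h i) @[i --> \oo] --> enorm (0 *: u).
    by apply: cvg_enorm; apply: cvgZ; [exact: tc|exact: hu].
  by rewrite scale0r enorm0 => /(cvgr_lt (0 : R))/(_ _ del0).
have hC : enorm (h i) @[i --> \oo] --> enorm u by exact: cvg_enorm.
have dir : \forall i \near \oo,
    enorm (enorm u *: h i - enorm (h i) *: u) <= rho * enorm (h i) * enorm u.
  have := enorm_ge0 u; rewrite le_eqVlt => /predU1P[u0|u0].
    apply: nearW => i; have u00 := enorm_eq0 (esym u0).
    by rewrite u00 enorm0 scale0r scaler0 subrr enorm0 mulr0.
  have lC : rho * enorm (h i) * enorm u - enorm (enorm u *: h i - enorm (h i) *: u) @[i --> \oo] -->
      rho * enorm u * enorm u - enorm (enorm u *: u - enorm u *: u).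
    apply: cvgB.
      apply: cvgM; last exact: cvg_cst.
      by apply: cvgM; [exact: cvg_cst|exact: hC].
    apply: cvg_enorm; apply: cvgB; apply: cvgZ;
      [exact: cvg_cst|exact: hu|exact: hC|exact: cvg_cst].
  have l0 : 0 < rho * enorm u * enorm u - enorm (enorm u *: u - enorm u *: u).
    by rewrite subrr enorm0 subr0 !mulr_gt0.
  have : \forall i \near \oo, 0 < rho * enorm (h i) * enorm u -
      enorm (enorm u *: h i - enorm (h i) *: u) by exact: (cvgr_gt _ lC _ l0).
  by apply: filterS => i; rewrite subr_gt0; exact: ltW.
have dC : dotp v (ws i) @[i --> \oo] --> dotp v w by apply: cvg_dotp; [exact: cvg_cst|exact: wsw].
have bC : 2 * ga * enorm (h i) ^+ 2 @[i --> \oo] --> 2 * ga * enorm u ^+ 2.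
  apply: cvgM; first exact: cvg_cst.
  by rewrite !expr2; apply: cvgM.
apply: (ler_cvg_to dC bC); apply: filterS2 small dir => i k1 k2.
have := H _ (Cw i); rewrite zE => /(_ _)/wrap[].
  split; first exact: k1.
  rewrite !enormZ (gtr0_norm (t0 i)) -scalerA scalerA [_ * t i]mulrC -scalerA -scalerBr enormZ.
  rewrite (gtr0_norm (t0 i)) mulrCA -!mulrA ler_pM2l// ?mulrA//.
rewrite enormZ gtr0_norm// dotpZr /h dotpDr vu add0r dotpZr exprMn -/(h i).
have ti := t0 i; rewrite !mulrA => K.
have t2 : 0 < 2^-1 * t i ^+ 2 by rewrite mulr_gt0// exprn_gt0.
by rewrite -(ler_pM2l t2); lra.
Qed.

Lemma limf_einf_le (F : set_system (R * 'rV[R]_k)) (f : R * 'rV[R]_k -> \bar R)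
    (p : nat -> R * 'rV[R]_k) (y : nat -> R) (l : R) :
  (forall V, F V -> \forall i \near \oo, V (p i)) -> (forall i, f (p i) = (y i)%:E) ->
  y i @[i --> \oo] --> l -> (limf_einf f F <= l%:E)%E.
Proof.
move=> pF fp yl; rewrite limf_einfE; apply: ge_ereal_sup => _ [V FV <-].
have H : \forall i \near \oo, (ereal_inf (f @` V) <= (y i)%:E)%E.
  by apply: filterS (pF _ FV) => i Vi; rewrite -fp; apply: ereal_inf_lbound; exists (p i).
move: (ereal_inf _) H => [x|//|] H.
- rewrite lee_fin; apply: (cvgr_to_ge yl); apply: filterS H => i; by rewrite lee_fin.
- by have [N _ /(_ N (leqnn N))] := H.
- exact: leNye.
Qed.

Lemma second_subderivative_le C z u v w : dotp v u = 0 ->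
  second_tangent_set C z u w ->
  (second_subderivative_indicator C z v u <= (- (dotp v w))%:E)%E.
Proof.
move=> vu [t [ws [tp wsw Cw]]]; have [t0 tc] := tp.
pose h i : 'rV[R]_k := u + (2^-1 * t i) *: ws i.
have hu : h i @[i --> \oo] --> u by exact: (second_tangent_step tp wsw).
apply: (@limf_einf_le _ _ (fun i => (t i, h i)) (fun i => - (dotp v (ws i)))).
- move=> V [[V1 V2]/= [V1n V2n] V12].
  have h2 : \forall i \near \oo, V2 (h i) by exact: hu.
  have h1 : \forall i \near \oo, V1 (t i).
    have : \forall i \near \oo, 0 < t i -> V1 (t i) by exact: (tc (fun x => 0 < x -> V1 x) V1n).
    by apply: filterS => i; apply.
  apply: filterS2 h1 h2 => i k1 k2; apply: (V12 (t i, h i)) => //=.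
  rewrite /h (_ : _ + _ = z + t i *: u + (2^-1 * t i ^+ 2) *: ws i)//.
  by apply/rowP => j; rewrite !mxE; ring.
- move=> i /=; congr (_%:E); rewrite /h dotpDr vu dotpZr.
  have ti : t i != 0 by rewrite gt_eqF.
  by field.
by apply: cvgN; apply: cvg_dotp; [exact: cvg_cst|exact: wsw].
Qed.

(** A liminf below [- c] would give steps and directions within [1 / (i + 1)] of their limits whose
    quotients stay on the wrong side of some [M > c], against the hypothesis. *)
Lemma second_subderivative_ge C z u v (c : R) :
  (forall (t : nat -> R) (us : nat -> 'rV[R]_k) (M : R), to0p t -> us i @[i --> \oo] --> u ->
     (forall i, C (z + t i *: us i)) -> c < M ->
     \forall i \near \oo, (t i)^-1 * dotp v (us i) <= 2^-1 * M) ->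
  ((- c)%:E <= second_subderivative_indicator C z v u)%E.
Proof.
move=> H; rewrite /second_subderivative_indicator limf_einfE; apply/lee_subgt0Pr => eps eps0.
pose f (p : R * 'rV[R]_k) : \bar R := (- 2 * dotp v p.2 / p.1)%:E.
set F := within _ _.
have [[V FV Vf]|nV] := pselect (exists2 V, F V & forall p, V p -> ((- c - eps)%:E <= f p)%E).
  apply: (@le_trans _ _ (ereal_inf (f @` V))); last by apply: ereal_sup_ubound; exists V.
  by apply: le_ereal_inf_tmp => _ [p Vp <-]; rewrite -EFinB; exact: Vf.
exfalso.
have /choice[p pP] i : exists p : R * 'rV[R]_k, [/\ 0 < p.1 < i.+1%:R^-1, `|p.2 - u| < i.+1%:R^-1,
    C (z + p.1 *: p.2) & 2^-1 * (c + eps) < p.1^-1 * dotp v p.2].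
  apply: contrapT => nP; apply: nV.
  exists [set p : R * 'rV[R]_k | C (z + p.1 *: p.2) /\ 0 < p.1 < i.+1%:R^-1 /\ `|p.2 - u| < i.+1%:R^-1].
    have i0 : 0 < i.+1%:R^-1 :> R by rewrite invr_gt0 ltr0n.
    rewrite /F /within/=.
    exists ([set x | 0 < x < i.+1%:R^-1], [set y | `|y - u| < i.+1%:R^-1]); first split=> /=.
    - near=> x; rewrite /=; apply/andP; split; near: x; first exact: nbhs_right_gt.
      exact: nbhs_right_lt.
    - apply/nbhs_ballP; exists i.+1%:R^-1 => //= y; rewrite -ball_normE/= distrC; exact.
    by move=> [x y]/= [k1 k2] k3.
  move=> [x y]/= [Cxy [x01 yu]]; rewrite /f/= lee_fin leNgt; apply/negP => lt.
  apply: nP; exists (x, y); split=> //=.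
  have x0 : 0 < x by case/andP: x01.
  by rewrite [ltRHS]mulrC ltr_pdivlMr//; move: lt; rewrite ltr_pdivrMr//; lra.
have i0 i : 0 < i.+1%:R^-1 :> R by rewrite invr_gt0 ltr0n.
have tp : to0p (fun i => (p i).1).
  split=> [i|]; first by have [/andP[]] := pP i.
  apply: (@squeeze_cvgr _ _ _ _ (fun=> 0) (fun i => i.+1%:R^-1)); last exact: cvg_harmonicE.
    by apply: nearW => i; have [/andP[k1 k2] _ _ _] := pP i; rewrite !ltW.
  exact: cvg_cst.
have uC : (p i).2 @[i --> \oo] --> u.
  apply/cvgrPdist_lt => e e0; have /(cvgr_lt (0 : R))/(_ _ e0) := @cvg_harmonicE R.
  by apply: filterS => i ie; have [_ k1 _ _] := pP i; rewrite distrC (lt_trans k1).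
have [N _ /(_ N (leqnn N))] := H _ _ (c + eps) tp uC (fun i => let: And4 _ _ k _ := pP i in k)
  (ltr_pwDr eps0 (lexx c)).
by have [_ _ _ H1] := pP N; rewrite leNgt H1.
Unshelve. all: by end_near. Qed.

(* For [u = 0] the directional neighbourhood is a whole ball, so that the
   normalised violating points only converge along a subsequence, to an
   unknown direction [u']. *)
Lemma prenormal_bounded C z u v :
  (forall (t : nat -> R) (us : nat -> 'rV[R]_k) u', to0p t -> us i @[i --> \oo] --> u' ->
     (forall i, C (z + t i *: us i)) -> u' = u \/ u = 0 ->
     exists M : R, \forall i \near \oo, (t i)^-1 * dotp v (us i) <= M) ->
  directional_proximal_prenormal_cone C z u v.
Proof.
move=> H; apply: contrapT => nP.
have i0 i : 0 < i.+1%:R^-1 :> R by rewrite invr_gt0 ltr0n.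
have /choice[y yP] i : exists y, [/\ C (z + y), enorm y < i.+1%:R^-1,
    enorm (enorm u *: y - enorm y *: u) <= i.+1%:R^-1 * enorm y * enorm u &
    i.+1%:R * enorm y ^+ 2 < dotp v y].
  apply: contrapT => nQ; apply: nP; exists i.+1%:R^-1, i.+1%:R^-1, i.+1%:R.
  split=> [|||z' Cz' [k1 k2]]; rewrite ?ltr0n//.
  by rewrite leNgt; apply/negP => k3; apply: nQ; exists (z' - z); rewrite addrC subrK.
have y0 i : 0 < enorm (y i).
  rewrite lt_neqAle enorm_ge0 andbT; apply/eqP => /esym/enorm_eq0 yi0.
  by have [_ _ _] := yP i; rewrite yi0 enorm0 dotp0r expr0n mulr0 ltxx.
(* Normalising to length [|u|] makes the violating directions tend to [u] itself; for [u = 0] any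
   positive length will do. *)
pose c' : R := if u == 0 then 1 else enorm u.
have c0 : 0 < c' by rewrite /c'; case: eqP => [_|/eqP/enorm_gt0//]; exact: ltr01.
pose t i := enorm (y i) / c'; pose us i : 'rV[R]_k := (t i)^-1 *: y i.
have tp : to0p t.
  split=> [i|]; first by rewrite divr_gt0.
  rewrite -(mul0r c'^-1); apply: cvgM; last exact: cvg_cst.
  apply: (@squeeze_cvgr _ _ _ _ (fun=> 0) (fun i => i.+1%:R^-1)); last exact: cvg_harmonicE.
    by apply: nearW => i; have [_ k1 _ _] := yP i; rewrite enorm_ge0 ltW.
  exact: cvg_cst.
have tE i : t i *: us i = y i by rewrite scalerA mulfV ?scale1r// gt_eqF// divr_gt0.
have usn i : enorm (us i) = c'.
  have ti : 0 < t i by rewrite divr_gt0.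
  rewrite enormZ gtr0_norm ?invr_gt0// /t invf_div divfK// gt_eqF//.
have vE i : i.+1%:R * c' ^+ 2 < (t i)^-1 * dotp v (us i).
  have [_ _ _] := yP i; rewrite -tE dotpZr enormZ usn gtr0_norm ?divr_gt0//.
  have ti : 0 < t i by rewrite divr_gt0.
  rewrite exprMn ltr_pdivlMl// => H1.
  by rewrite -(ltr_pM2l ti); lra.
suff [f [u' [ff usu' uu']]] : exists (f : nat -> nat) u', [/\ forall i, (i <= f i)%N,
    us (f i) @[i --> \oo] --> u' & u' = u \/ u = 0].
  have [M HM] := H _ _ u' (to0p_subseq ff tp) usu'
    (fun i => let: And4 k _ _ _ := yP (f i) in eq_ind_r (fun x => C (z + x)) k (tE (f i))) uu'.
  have c20 : 0 < c' ^+ 2 by rewrite exprn_gt0.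
  near \oo => N.
  have h1 : (t (f N))^-1 * dotp v (us (f N)) <= M by near: N.
  have h2 : M / c' ^+ 2 <= N.+1%:R.
    apply: (@le_trans _ _ N%:R); last by rewrite ler_nat.
    by near: N; exact: nbhs_infty_ger.
  have := lt_le_trans (vE (f N)) h1; rewrite ltNge => /negP; apply.
  rewrite ler_pdivrMr// in h2; apply: le_trans h2 _.
  by rewrite ler_pM2r// ler_nat ltnS.
have [u0|u0] := eqVneq u 0.
  have [i|f [u' [ff usu']]] := @bounded_seq_subseq _ _ us 1.
    by rewrite (le_trans (norm_le_enorm _))// usn /c' u0 eqxx.
  by exists f, u'; split=> //; right.
exists id, u; split=> //; last by left.
have cE : c' = enorm u by rewrite /c' (negbTE u0).
apply/cvgrPdist_le => e e0.
have eu : 0 < e / enorm u by rewrite divr_gt0// enorm_gt0.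
have /(cvgr_lt (0 : R))/(_ _ eu) := @cvg_harmonicE R; apply: filterS => i ie.
have [_ _ k1 _] := yP i; rewrite distrC (le_trans (norm_le_enorm _))//.
have -> : us i - u = (enorm (y i))^-1 *: (enorm u *: y i - enorm (y i) *: u).
  rewrite /us /t cE invf_div scalerBr !scalerA mulVf ?gt_eqF// scale1r.
  by rewrite mulrC.
rewrite enormZ gtr0_norm ?invr_gt0// ler_pdivrMl//.
apply: le_trans k1 _; rewrite ltr_pdivlMr ?enorm_gt0// in ie.
by rewrite mulrAC [leLHS]mulrC ler_pM2l// ltW.
Unshelve. all: by end_near. Qed.

(** Near [q] the cone [T] coincides with [q] plus its tangent cone, so the normal inequality holds
    without error term. *)
Lemma regular_normal_cone_near T q v : closed T -> conic_at T q ->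
  (forall (s : R) p, 0 < s -> T p -> T (s *: p)) -> regular_normal_cone T q v ->
  exists2 e : R, 0 < e & forall p, T p -> `|p - q| < e -> dotp v p <= 0.
Proof.
move=> cT Tcon Ts Nv; have [e e0 TW] := conic_tangent cT Tcon.
have vq := cone_regular_normal_perp Ts Nv.
have /regular_normal_polar[_ pol] := Nv.
exists e => // p Tp pq; rewrite -[p](subrK q) dotpDr vq addr0; apply: pol.
by apply/TW => //; rewrite addrC subrK.
Qed.

Lemma limiting_normal_closed C z : closed (limiting_normal_cone C z).
Proof.
apply: seq_closed => vs v vsv Nvs.
have i0 i : 0 < i.+1%:R^-1 :> R by rewrite invr_gt0 ltr0n.
have /choice[p pP] i : exists p : 'rV[R]_k * 'rV[R]_k, [/\ `|p.1 - z| < i.+1%:R^-1,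
    `|p.2 - vs i| < i.+1%:R^-1 & regular_normal_cone C p.1 p.2].
  have [_ [zs [ws [zsz wsv Nw]]]] := Nvs i.
  have h1 : \forall j \near \oo, `|zs j - z| < i.+1%:R^-1.
    by have /cvgrPdist_lt/(_ _ (i0 i)) := zsz; apply: filterS => j; rewrite distrC.
  have h2 : \forall j \near \oo, `|ws j - vs i| < i.+1%:R^-1.
    by have /cvgrPdist_lt/(_ _ (i0 i)) := wsv; apply: filterS => j; rewrite distrC.
  near \oo => N; exists (zs N, ws N); split=> //=; near: N => //.
split; first by have [] := Nvs 0%N.
exists (fun i => (p i).1), (fun i => (p i).2); split=> [||i]; last by have [] := pP i.
  apply/cvgrPdist_lt => e e0; have /(cvgr_lt (0 : R))/(_ _ e0) := @cvg_harmonicE R.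
  by apply: filterS => i ie; have [k1 _ _] := pP i; rewrite distrC (lt_trans k1).
have dC : (p i).2 - vs i @[i --> \oo] --> (0 : 'rV[R]_k).
  apply/cvgr0Pnorm_lt => e e0; have /(cvgr_lt (0 : R))/(_ _ e0) := @cvg_harmonicE R.
  by apply: filterS => i ie; have [_ k1 _] := pP i; rewrite (lt_trans k1).
have H : (p i).2 - vs i + vs i @[i --> \oo] --> 0 + v by exact: cvgD.
by move: H; rewrite add0r; under eq_fun do rewrite subrK.
Unshelve. all: by end_near. Qed.

Lemma cone_limiting_normal D x v : (forall (s : R) p, 0 < s -> D p -> D (s *: p)) -> D 0 ->
  limiting_normal_cone D x v -> dotp v x = 0 /\ directional_normal_cone D 0 0 v.
Proof.
move=> Ds D0 [_ [zs [vs [zsx vsv Nv]]]]; split.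
  have dC : dotp (vs i) (zs i) @[i --> \oo] --> dotp v x by exact: cvg_dotp.
  have perp i : dotp (vs i) (zs i) = 0 by exact: cone_regular_normal_perp Ds (Nv i).
  by apply/le_anti; rewrite (cvgr_to_le dC)/= ?(cvgr_to_ge dC)//; apply: nearW => i; rewrite perp.
have tp : to0p (fun i => 1 * i.+1%:R^-1 : R) by exact: to0p_harmonic.
(* Normals of a cone are constant along rays, so the base points can be pulled to the vertex; one
   factor [t] is the step, the other sends the directions to zero. *)
exists (fun i => 1 * i.+1%:R^-1), (fun i => (1 * i.+1%:R^-1) *: zs i), vs.
split=> // [|i].
  by rewrite -(scale0r x); apply: cvgZ => //; case: tp.
have [t0 _] := tp; set t := 1 * _; have ti : 0 < t by exact: (t0 i).
rewrite add0r scalerA; have tt : 0 < t * t by rewrite mulr_gt0.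
apply: (iffLR _ (Nv i)); apply: iff_sym; apply: (regular_normal_local _ tt).
exists 1 => [|p _]; first exact: ltr01.
rewrite -scalerDr; split; last exact: Ds.
move=> /(Ds (t * t)^-1); rewrite invr_gt0 => /(_ tt).
by rewrite scalerA mulVf ?scale1r// gt_eqF.
Qed.

(** By homogeneity every normal [w] at any [x] satisfies [dotp w x = dotp w z0] and is also a normal
    at the vertex [z0]. The inner infimum is therefore linear on a closed set of covectors and
    infinite off it, and its liminf equals itself. *)
Lemma lower_support_fun_translate C D z0 v :
  (forall (s : R) p, 0 < s -> D p -> D (s *: p)) -> D 0 -> (forall p, C p <-> D (p - z0)) ->
  (directional_normal_cone D 0 0 v -> lower_support_fun C v = (dotp v z0)%:E) /\
  (~ directional_normal_cone D 0 0 v -> lower_support_fun C v = +oo%E).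
Proof.
move=> Ds D0 CD.
have Cz0 : C z0 by apply/CD; rewrite subrr.
have NCD x w : regular_normal_cone C x w <-> regular_normal_cone D (x - z0) w.
  apply: (regular_normal_local _ ltr01); exists 1 => [|p _]; first exact: ltr01.
  by rewrite scale1r CD addrAC.
have lim x w : limiting_normal_cone C x w -> dotp w x = dotp w z0 /\ directional_normal_cone D 0 0 w.
  move=> [Cx [zs [vs [zsx vsw Nv]]]].
  have [] := @cone_limiting_normal D (x - z0) w Ds D0.
    split; first exact/CD.
    exists (fun i => zs i - z0), vs; split=> //; last by move=> i; exact/NCD.
    by apply: cvgB => //; exact: cvg_cst.
  by rewrite dotpDr dotpNr => /subr0_eq.
have lim0 w : directional_normal_cone D 0 0 w -> limiting_normal_cone C z0 w.
  move=> [t [us [vs [[t0 tc] us0 vsw Nv]]]]; split=> //.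
  exists (fun i => z0 + t i *: us i), vs; split=> // [|i].
    rewrite -[X in _ --> X]addr0 -(scale0r (0 : 'rV[R]_k)); apply: cvgD; first exact: cvg_cst.
    exact: cvgZ.
  by apply/NCD; rewrite addrC addKr; have := Nv i; rewrite add0r.
have NE : directional_normal_cone D 0 0 = limiting_normal_cone C z0.
  by apply/seteqP; split=> w; [exact: lim0|move=> /lim[]].
pose h v' : \bar R := ereal_inf [set (dotp v' u)%:E | u in [set u | limiting_normal_cone C u v']].
have hE w : directional_normal_cone D 0 0 w -> h w = (dotp w z0)%:E.
  move=> Nw; apply/le_anti/andP; split.
    by apply: ereal_inf_lbound; exists z0 => //; exact: lim0.
  by apply: le_ereal_inf_tmp => _ [x /lim[xE _] <-]; rewrite xE.
have hN w : ~ directional_normal_cone D 0 0 w -> h w = +oo%E.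
  move=> Nw; rewrite /h (_ : image _ _ = set0) ?ereal_inf0//.
  by apply/seteqP; split=> // y [x /lim[_ /Nw]].
rewrite /lower_support_fun; case: ifPn => [/eqP C0|_]; first by move: Cz0; rewrite C0.
rewrite -/h limf_einfE; split=> Nv; last first.
  apply/eqP; rewrite -leye_eq; apply: ereal_sup_ubound.
  exists (~` directional_normal_cone D 0 0).
    apply: open_nbhs_nbhs; split=> //; apply: closed_openC.
    by rewrite NE; exact: limiting_normal_closed.
  by apply/eqP; rewrite -leye_eq; apply: le_ereal_inf_tmp => _ [w Nw <-]; rewrite hN.
apply/le_anti/andP; split.
  apply: ge_ereal_sup => _ [V nV <-]; rewrite -hE//; apply: ereal_inf_lbound.
  by exists v => //; exact: nbhs_singleton.
apply/lee_subgt0Pr => e e0; apply: le_trans; last first.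
  apply: ereal_sup_ubound; exists [set w | dotp v z0 - e < dotp w z0]; last by [].
  have dC : dotp w z0 @[w --> v] --> dotp v z0.
    have FF : Filter (nbhs v) by exact: nbhs_filter.
    apply: (@cvg_dotp _ _ _ FF k id (fun=> z0)); first exact: cvg_id.
    exact: (@cvg_cst _ _ _ _ FF).
  by apply: (cvgr_gt _ dC); rewrite ltrBlDr ltrDl.
apply: le_ereal_inf_tmp => _ [w /= wlt <-].
have [Nw|Nw] := pselect (directional_normal_cone D 0 0 w); last by rewrite hN// leey.
by rewrite hE// -EFinB lee_fin ltW.
Qed.

End SecondOrderSupport.

(** * Smoothness and derivatives of linear and constant maps *)

Section LinearMaps.
Context {R : realType} {n : nat}.

Lemma mulmx_ext p (A A' : 'M[R]_(n, p)) :
  (forall u : 'rV[R]_n, u *m A = u *m A') -> A = A'.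
Proof. by move=> AA; apply/row_matrixP => i; rewrite !rowE. Qed.

Lemma is_diff_mulmxr p (A : 'M[R]_(n, p)) (x : 'rV[R]_n) :
  differentiable (fun z : 'rV[R]_n => z *m A) x /\
  forall u : 'rV[R]_n, 'D_u (fun z : 'rV[R]_n => z *m A) x = u *m A.
Proof.
have FF : Filter (nbhs x) by exact: nbhs_filter.
have cA : continuous (mulmxr A : 'rV[R]_n -> 'rV[R]_p).
  move=> y; have Fy : Filter (nbhs y) by exact: nbhs_filter.
  apply: (@cvg_mulmx _ _ _ Fy _ _ _ id (fun=> A)); first exact: cvg_id.
  exact: (@cvg_cst _ _ _ _ Fy).
have dA : differentiable (mulmxr A : 'rV[R]_n -> 'rV[R]_p) x by exact: linear_differentiable.
split=> // u; rewrite deriveE; last exact: dA.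
by have := @diff_lin _ _ _ (mulmxr A : {linear 'rV[R]_n -> 'rV[R]_p}) x (cA); move=> ->.
Qed.

Lemma derive_mulmxl l m (v : 'rV[R]_l) (b : 'rV[R]_n -> 'M[R]_(l, m)) (x : 'rV[R]_n) :
  differentiable b x -> differentiable (fun y => v *m b y) x /\
  forall u : 'rV[R]_n, 'D_u (fun y => v *m b y) x = v *m 'D_u b x.
Proof.
move=> db.
have cv : continuous (mulmx v : 'M[R]_(l, m) -> 'rV[R]_m).
  move=> y; have Fy : Filter (nbhs y) by exact: nbhs_filter.
  apply: (@cvg_mulmx _ _ _ Fy _ _ _ (fun=> v) id); last exact: cvg_id.
  exact: (@cvg_cst _ _ _ _ Fy).
have dv y : differentiable (mulmx v : 'M[R]_(l, m) -> 'rV[R]_m) y by exact: linear_differentiable.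
have dvb : differentiable (mulmx v \o b) x by exact: differentiable_comp.
split=> [|u]; first exact: dvb.
rewrite (deriveE _ db) -[LHS]/('D_u (mulmx v \o b) x) (deriveE _ dvb) (diff_comp db (dv (b x))).
by rewrite /= (diff_lin _ cv).
Qed.

Lemma contdiff_cst (V : normedModType R) (c : V) : contdiff (fun _ : 'rV[R]_n => c).
Proof.
split=> [x|v x]; first exact: differentiable_cst.
have -> : 'D_v (fun _ : 'rV[R]_n => c) = fun=> 0 by apply/funext => y; exact: derive_cst.
exact: cst_continuous.
Qed.

Lemma twice_contdiff_cst (V : normedModType R) (c : V) :
  twice_contdiff (fun _ : 'rV[R]_n => c).
Proof.
split=> [|v]; first exact: contdiff_cst.
have -> : 'D_v (fun _ : 'rV[R]_n => c) = fun=> 0 by apply/funext => y; exact: derive_cst.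
exact: contdiff_cst.
Qed.

Lemma twice_contdiff_mulmxr p (A : 'M[R]_(n, p)) :
  twice_contdiff (fun z : 'rV[R]_n => z *m A).
Proof.
have DE v : (fun x => 'D_v (fun z : 'rV[R]_n => z *m A) x) = fun=> v *m A.
  by apply/funext => x; have [_ ->] := is_diff_mulmxr A x.
split; first split=> [x|v]; first by have [] := is_diff_mulmxr A x.
  by rewrite DE; exact: cst_continuous.
by move=> v; rewrite DE; exact: contdiff_cst.
Qed.

Lemma jacobian_mulmxr p (A : 'M[R]_(n, p)) x : 'J (fun z : 'rV[R]_n => z *m A) x = A.
Proof.
apply: mulmx_ext => u; have [d DE] := is_diff_mulmxr A x.
by rewrite jacobianE.
Qed.

Lemma second_deriv_cst p q (c : 'M[R]_(p, q)) x u :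
  second_deriv (fun _ : 'rV[R]_n => c) x u = 0.
Proof.
apply/matrixP => i j; rewrite !mxE (_ : hessian _ x = 0) ?trmx0 ?mulmx0 ?dotp0r//.
have D0 v : 'D_v (fun _ : 'rV[R]_n => c i j) = fun=> 0.
  by apply/funext => y; exact: derive_cst.
apply/matrixP => i' j'; rewrite mxE [RHS]mxE D0; exact: derive_cst.
Qed.

End LinearMaps.

(** * Parametrized graphs with linear data over a cone *)

Section LinearParamGraph.
Context {R : realType} {n m l s : nat}.
Variables (W : set 'rV[R]_(l + l)) (J : 'M[R]_(n, l)) (M : 'M[R]_(n, m))
  (b0 : 'M[R]_(l, m)) (B : 'M[R]_(s, l)).
Hypothesis W0 : W 0.
Hypothesis W_scale : forall (c : R) p, 0 < c -> W p -> W (c *: p).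
Hypothesis W_aligned : aligned B W.
Hypothesis J_free : row_free (B *m J^T).
Hypothesis b_free : row_free (B *m b0).

Definition linear_graph : set 'rV[R]_(n + m) :=
  param_graph W (fun z : 'rV[R]_n => z *m J) (fun=> b0) (fun z : 'rV[R]_n => z *m M).

Lemma linear_graph0 : linear_graph 0.
Proof. by exists 0, 0; rewrite !mul0mx addr0 !row_mx0. Qed.

Lemma linear_graph_scale (c : R) p : 0 < c -> linear_graph p -> linear_graph (c *: p).
Proof.
move=> c0 [zeta [xi [-> Wzx]]]; exists (c *: zeta), (c *: xi); split.
  by rewrite scale_row_mx scalerDr !scalemxAl.
by rewrite -scalemxAl -scale_row_mx; exact: W_scale.
Qed.

Lemma linear_graph_good :
  good W (fun z : 'rV[R]_n => z *m J) (fun=> b0) B 0 0.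
Proof.
split; [by rewrite mul0mx row_mx0|exact: aligned_atT|by rewrite jacobian_mulmxr|exact: b_free].
Qed.

Lemma linear_dir_deriv u :
  dir_deriv (fun _ : 'rV[R]_n => b0) (fun z : 'rV[R]_n => z *m M) 0 0 u = u *m M.
Proof. by rewrite /dir_deriv mul0mx addr0; have [_ ->] := is_diff_mulmxr M 0. Qed.

Lemma linear_param_jacobian :
  param_jacobian (fun _ : 'rV[R]_n => b0) (fun z : 'rV[R]_n => z *m M) 0 0 = M.
Proof.
apply: mulmx_ext => w; rewrite dir_derivE; first exact: linear_dir_deriv.
  exact: twice_contdiff_cst.
exact: twice_contdiff_mulmxr.
Qed.

Lemma linear_graph_normal w : directional_normal_cone linear_graph 0 0 w <->
  exists (r : 'rV[R]_m) (f : 'rV[R]_l), w = row_mx (- (r *m M^T) + f *m J^T) r /\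
    directional_normal_cone W 0 0 (row_mx f (r *m b0^T)).
Proof.
have lg2 := @twice_contdiff_mulmxr R n l J.
have lb2 := @twice_contdiff_cst R n 'M[R]_(l, m) b0.
have la2 := @twice_contdiff_mulmxr R n m M.
have covE r f : covec (fun z : 'rV[R]_n => z *m J) (fun=> b0) (fun z : 'rV[R]_n => z *m M) 0 0 r f
    = row_mx (- (r *m M^T) + f *m J^T) r.
  by rewrite /covec jacobian_mulmxr linear_param_jacobian.
have om0 : row_mx (0 : 'rV[R]_n) (0 *m M + (0 : 'rV[R]_l) *m b0) = 0.
  by rewrite !mul0mx addr0 row_mx0.
have eta0 : row_mx (0 : 'rV[R]_n)
    (dir_deriv (fun=> b0) (fun z : 'rV[R]_n => z *m M) 0 0 0 + (0 : 'rV[R]_l) *m b0) = 0.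
  by rewrite linear_dir_deriv.
have z0 : row_mx ((0 : 'rV[R]_n) *m J) (0 : 'rV[R]_l) = 0 by rewrite mul0mx row_mx0.
have q0 : row_mx ((0 : 'rV[R]_n) *m 'J (fun z : 'rV[R]_n => z *m J) 0) (0 : 'rV[R]_l) = 0.
  by rewrite mul0mx row_mx0.
split=> [N|[r [f [-> N]]]].
  have := @directional_normal_param_graphP _ _ _ _ _ W _ _ _ B lg2 lb2 la2 0 0 0 0 w
    linear_graph_good (sub0mx _ _).
  rewrite om0 eta0 z0 q0 => /(_ N)[r [f [_ wE Nrf]]].
  by exists r, f; rewrite wE covE.
have := @param_graph_directional_normal _ _ _ _ _ W _ _ _ B lg2 lb2 la2 0 0 0 0 r f
  linear_graph_good.
by rewrite om0 eta0 z0 q0 covE; exact.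
Qed.

(** [z1] solves [z1 *m J = - y] modulo the kernel of [B], to which [W] is insensitive; replacing
    [zeta] by [zeta - z1] thus absorbs the shift [y]. *)
Lemma linear_graph_translate (c : 'rV[R]_m) (y : 'rV[R]_l) (z1 : 'rV[R]_n) p :
  (z1 *m J + y) *m B^T = 0 ->
  (exists (zeta : 'rV[R]_n) (xi : 'rV[R]_l),
    p = row_mx zeta (zeta *m M + xi *m b0) + row_mx 0 c /\ W (row_mx (zeta *m J + y) xi)) <->
  linear_graph (p - (row_mx z1 (z1 *m M) + row_mx 0 c)).
Proof.
move=> z1B.
have shift (zeta : 'rV[R]_n) (xi : 'rV[R]_l) :
    W (row_mx (zeta *m J + y) xi) <-> W (row_mx ((zeta - z1) *m J) xi).
  have eqB : (zeta *m J + y) *m B^T = (zeta - z1) *m J *m B^T.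
    have -> : zeta *m J + y = (zeta - z1) *m J + (z1 *m J + y).
      by rewrite mulmxBl addrA subrK.
    by rewrite mulmxDl z1B addr0.
  by split; apply: W_aligned.2; rewrite ?row_mxKl ?row_mxKr.
split=> -[zeta [xi [pE Wzx]]].
  exists (zeta - z1), xi; split; last exact/shift.
  rewrite pE mulmxBl opprD addrACA subrr addr0 opp_row_mx add_row_mx.
  by congr row_mx; rewrite addrAC.
exists (zeta + z1), xi; split; last by apply/shift; rewrite addrK.
rewrite -[p](subrK (row_mx z1 (z1 *m M) + row_mx 0 c)) pE mulmxDl.
by rewrite addrA add_row_mx; congr (row_mx _ _ + _); rewrite addrAC.
Qed.

End LinearParamGraph.

(** * Second-order objects of a parametrized graph over a locally conic set *)

Section SecondOrderParamGraph.
Context {R : realType} {n m l s : nat}.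
Variables (G : set 'rV[R]_(l + l)) (g : 'rV[R]_n -> 'rV[R]_l)
  (b : 'rV[R]_n -> 'M[R]_(l, m)) (a : 'rV[R]_n -> 'rV[R]_m) (B : 'M[R]_(s, l)).
Hypothesis g2 : twice_contdiff g.
Hypothesis b2 : twice_contdiff b.
Hypothesis a2 : twice_contdiff a.
Hypothesis Gclosed : closed G.
Hypothesis Gconic : forall z, conic_at G z.
Variables (x0 u : 'rV[R]_n) (v0 e : 'rV[R]_l).
Hypothesis gd : good G g b B x0 v0.
Local Notation T := (tangent_cone G (row_mx (g x0) v0)).
Local Notation q := (row_mx (u *m 'J g x0) e).
Local Notation W := (tangent_cone T q).
Hypothesis Tq : T q.
Local Notation PG := (param_graph G g b a).
Local Notation om := (row_mx x0 (a x0 + v0 *m b x0)).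
Local Notation eta := (row_mx u (dir_deriv b a x0 v0 u + e *m b x0)).
Local Notation cov := (covec g b a x0 v0).
Local Notation lam r f := (row_mx f (r *m (b x0)^T)).
Local Notation T2 := (second_tangent_set PG om eta).

Definition second_shift : 'rV[R]_m :=
  2 *: (e *m 'D_u b x0) + (second_deriv a x0 u + v0 *m second_deriv b x0 u).

Definition support_value (r : 'rV[R]_m) (f : 'rV[R]_l) : R :=
  dotp r second_shift - dotp f (second_deriv g x0 u).

Lemma aligned_T : aligned B T.
Proof. by have [Gz Gal _ _] := gd; exact: aligned_tangent. Qed.

Lemma aligned_W : aligned B W.
Proof. by apply: aligned_tangent => //; exact: aligned_atT aligned_T. Qed.

Lemma T_scale (r : R) p : 0 < r -> T p -> T (r *: p).
Proof. exact: tangent_cone_scale. Qed.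

Lemma T_closed : closed T. Proof. exact: tangent_cone_closed. Qed.

Lemma T_conic p : conic_at T p. Proof. exact: tangent_cone_conic. Qed.

Lemma tangent_dir_sub : (e <= B)%MS.
Proof. by have := aligned_T.1 _ Tq; rewrite row_mxKr. Qed.

Lemma second_tangentE : T2 = [set th | exists (zeta : 'rV[R]_n) (xi : 'rV[R]_l),
    th = row_mx zeta (2 *: (e *m 'D_u b x0) +
      (dir_deriv b a x0 v0 zeta + (second_deriv a x0 u + v0 *m second_deriv b x0 u)) +
      xi *m b x0) /\
    second_tangent_set G (row_mx (g x0) v0) q
      (row_mx (zeta *m 'J g x0 + second_deriv g x0 u) xi)].
Proof.
apply/seteqP; split=> th.
  exact: (second_tangent_param_graphP g2 b2 a2 gd tangent_dir_sub).
by move=> [zeta [xi [-> H]]]; exact: (param_graph_second_tangent g2 b2 a2 gd).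
Qed.

Lemma second_tangent_coneE th : T2 th <-> exists (zeta : 'rV[R]_n) (xi : 'rV[R]_l),
    th = row_mx zeta (zeta *m param_jacobian b a x0 v0 + xi *m b x0) + row_mx 0 second_shift /\
    W (row_mx (zeta *m 'J g x0 + second_deriv g x0 u) xi).
Proof.
have E zeta (xi : 'rV[R]_l) : row_mx zeta (2 *: (e *m 'D_u b x0) +
      (dir_deriv b a x0 v0 zeta + (second_deriv a x0 u + v0 *m second_deriv b x0 u)) +
      xi *m b x0) =
    row_mx zeta (zeta *m param_jacobian b a x0 v0 + xi *m b x0) + row_mx 0 second_shift.
  rewrite (dir_derivE b2 a2) add_row_mx addr0 /second_shift; congr row_mx.
  move: (2 *: _) (dir_deriv _ _ _ _ _) (_ + _ *m second_deriv _ _ _) (xi *m _) => y1 y2 y3 y4.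
  by rewrite [RHS]addrC -!addrA; congr (_ + _); rewrite addrC -!addrA; congr (_ + _); rewrite addrC.
rewrite second_tangentE second_tangent_conic//.
by split=> -[zeta [xi [-> H]]]; exists zeta, xi; split=> //; rewrite E.
Qed.

Lemma covec_second_dotp r f zeta (xi : 'rV[R]_l) :
  dotp (cov r f) (row_mx zeta (zeta *m param_jacobian b a x0 v0 + xi *m b x0) + row_mx 0 second_shift) =
  support_value r f +
    dotp (lam r f) (row_mx (zeta *m 'J g x0 + second_deriv g x0 u) xi).
Proof.
rewrite (dir_derivE b2 a2) dotpDr (covec_dotp g b2 a2) /covec !dotp_row_mx dotp0r add0r /support_value.
move: second_shift (second_deriv g x0 u) => y1 y2; rewrite dotpDr.
by move: (dotp r y1) (dotp f y2) (dotp f _) (dotp _ xi) => y3 y4 y5 y6; ring.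
Qed.

(** Determines the apex of the translated cone [T2]. There the normal part of the pairing vanishes,
    so the support value is attained at this point. *)
Lemma base_point : exists2 z1 : 'rV[R]_n,
  W (row_mx (z1 *m 'J g x0 + second_deriv g x0 u) 0) &
  (z1 *m 'J g x0 + second_deriv g x0 u) *m B^T = 0.
Proof.
have [_ _ /row_freeP[N BN] _] := gd.
have NB : N^T *m 'J g x0 *m B^T = 1%:M.
  by rewrite -mulmxA -[RHS]trmx1 -BN !trmx_mul trmxK mulmxA.
have z1B : (- (second_deriv g x0 u *m B^T *m N^T) *m 'J g x0 + second_deriv g x0 u) *m B^T = 0.
  rewrite mulmxDl !mulNmx -!mulmxA (mulmxA N^T) NB mulmx1; exact: addNr.
exists (- (second_deriv g x0 u *m B^T *m N^T)); last exact: z1B.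
apply: (aligned_W.2 0); last exact: tangent_cone0.
  by rewrite linear0 row_mxKl mul0mx z1B.
by rewrite linear0 row_mxKr.
Qed.

Lemma covec_injective r r' f f' : (f <= B)%MS -> (f' <= B)%MS ->
  cov r f = cov r' f' -> (r, f) = (r', f').
Proof.
move=> fB f'B /eq_row_mx[H rr]; rewrite rr in H *; congr pair.
have [_ _ Jf _] := gd; apply: (injective_eq Jf fB f'B).
by apply: (addrI _ H).
Qed.

Lemma normal_sub r f : regular_normal_cone T q (lam r f) -> (f <= B)%MS.
Proof.
move=> N; exact: (aligned_regular_normal 0 Tq (aligned_atT _ aligned_T) N).1.
Qed.

Lemma directional_normal_sub p (v : 'rV[R]_l) f :
  directional_normal_cone G (row_mx (g x0) v0) p (row_mx f v) -> (f <= B)%MS.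
Proof.
move=> [t [us [vs [tp usp vsv Nv]]]]; have [Gz Gal _ _] := gd; have [t0 tc] := tp.
have fC : lsubmx (vs k) @[k --> \oo] --> f.
  by rewrite -[X in _ --> X](row_mxKl f v); exact: cvg_lsubmx.
apply: (cvg_submx fC).
have zC : row_mx (g x0) v0 + t k *: us k @[k --> \oo] --> row_mx (g x0) v0.
  rewrite -[X in _ --> X]addr0 -(scale0r p); apply: cvgD; first exact: cvg_cst.
  by apply: cvgZ; [exact: tc|exact: usp].
apply: filterS (aligned_near Gal zC) => k al.
have Nk := Nv k; rewrite -[vs k]hsubmxK in Nk.
exact: (aligned_regular_normal 0 Nk.1 al Nk).1.
Qed.

Lemma directional_normalE w : directional_normal_cone PG om eta w <->
  exists (r : 'rV[R]_m) (f : 'rV[R]_l), w = cov r f /\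
    directional_normal_cone G (row_mx (g x0) v0) q (lam r f).
Proof.
split=> [|[r [f [-> N]]]]; last exact: (param_graph_directional_normal g2 b2 a2 gd).
move=> /(directional_normal_param_graphP g2 b2 a2 gd tangent_dir_sub)[r [f [_ wE N]]].
by exists r, f.
Qed.

Lemma support_fun_value r f : regular_normal_cone T q (lam r f) ->
  support_fun T2 (cov r f) = (support_value r f)%:E.
Proof.
move=> N; have fB := normal_sub N; have /regular_normal_polar[_ pol] := N.
apply/le_anti/andP; split.
  apply: ge_ereal_sup => _ [th /second_tangent_coneE[zeta [xi [-> Wz]]] <-].
  by rewrite lee_fin covec_second_dotp gerDl; exact: pol.
have [z1 Wz z1B] := base_point; apply: ereal_sup_ubound.
exists (row_mx z1 (z1 *m param_jacobian b a x0 v0 + 0 *m b x0) + row_mx 0 second_shift).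
  by apply/second_tangent_coneE; exists z1, 0; split.
congr (_%:E); rewrite covec_second_dotp dotp_row_mx dotp0r (perp_submx fB z1B).
by rewrite addr0; exact: addr0.
Qed.

(** [T2] is nonempty, so a support value below infinity is a real bound on the pairing, and
    [covector_bounded] turns this bound into a multiplier. *)
Lemma support_fun_lty w : (support_fun T2 w < +oo)%E ->
  exists (r : 'rV[R]_m) (f : 'rV[R]_l), w = cov r f /\ regular_normal_cone T q (lam r f).
Proof.
move=> wlt; have [z1 Wz z1B] := base_point.
have [c cE] : exists c : R, support_fun T2 w = c%:E.
  exists (fine (support_fun T2 w)); rewrite fineK// fin_numElt wlt andbT.
  apply: (@lt_le_trans _ _ (dotp w
    (row_mx z1 (z1 *m param_jacobian b a x0 v0 + 0 *m b x0) + row_mx 0 second_shift))%:E).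
    exact: ltNyr.
  apply: ereal_sup_ubound; eexists; last reflexivity.
  by apply/second_tangent_coneE; exists z1, 0; split.
have bnd th : T2 th -> dotp w th <= c.
  by move=> Tth; rewrite -lee_fin -cE; apply: ereal_sup_ubound; exists th.
pose r := rsubmx w; pose w1 := lsubmx w + r *m (param_jacobian b a x0 v0)^T.
have [_ _ Jf _] := gd.
have W0 : W 0 by exact: tangent_cone0.
have Ws (d : R) p : 0 < d -> W p -> W (d *: p) by exact: tangent_cone_scale.
have [zeta xi Wzx|f [fB fE fpol]] := @covector_bounded _ _ _ B n W ('J g x0) (second_deriv g x0 u)
  (r *m (b x0)^T) w1 (c - dotp r second_shift) W0 Ws aligned_W Jf.
  have := bnd _ ((second_tangent_coneE _).2 (ex_intro _ zeta (ex_intro _ xi (conj erefl Wzx)))).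
  rewrite -[w]hsubmxK -/r dotpDr !dotp_row_mx dotp0r add0r dotpDr.
  rewrite dotp_mulmxr dotp_mulmxr /w1 dotpDl => H.
  by rewrite lerBrDr; apply: le_trans H; rewrite le_eqVlt; apply/orP; left; apply/eqP;
    ring.
exists r, f; split.
  by rewrite /covec -fE /w1 [X in row_mx X _]addrC addrK hsubmxK.
by apply/regular_normal_polar.
Qed.

Lemma normal_perp r f : regular_normal_cone T q (lam r f) -> dotp (cov r f) eta = 0.
Proof. by rewrite covec_dotp//; apply: cone_regular_normal_perp; exact: T_scale. Qed.

Lemma directional_normal_perp r f :
  directional_normal_cone G (row_mx (g x0) v0) q (lam r f) -> dotp (cov r f) eta = 0.
Proof. by rewrite covec_dotp//; exact: conic_directional_normal_perp. Qed.

(** The quotient is the convergent term of [cvg_covec_pairing] plus the pairing of the normal with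
    [qs k], which lies in [T] and contributes nothing positive. The case [u' = eta] gives the second
    subderivative; [eta = 0] is the extra case raised by [prenormal_bounded]. *)
Lemma tangent_quotient_bound (t : nat -> R) (us : nat -> 'rV[R]_(n + m)) u' r f :
  regular_normal_cone T q (lam r f) ->
  to0p t -> us k @[k --> \oo] --> u' -> (forall k, PG (om + t k *: us k)) ->
  u' = eta \/ eta = 0 ->
  exists M0 : R, (u' = eta -> M0 = 2^-1 * support_value r f) /\
    forall M, M0 < M -> \forall k \near \oo, (t k)^-1 * dotp (cov r f) (us k) <= M.
Proof.
move=> N tp usC Pus u'E; have [t0 tc] := tp.
have [ee [e0 [e0B eC e0E aE Gk]]] := param_graph_expand g2 b2 a2 gd tp usC Pus.
have pC := cvg_covec_pairing g2 b2 a2 tp usC eC aE.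
have [_ _ _ bf] := gd.
have ee0 : u' = eta -> lsubmx u' = u /\ e0 = e.
  move=> uE; have lu : lsubmx u' = u by rewrite uE row_mxKl.
  split=> //; apply/esym/(injective_eq bf tangent_dir_sub e0B).
  apply: (@addrI _ (dir_deriv b a x0 v0 u)).
  by have := e0E; rewrite lu uE row_mxKr; exact: id.
have {}pC := pC r f.
exists (2^-1 * (dotp r (2 *: (e0 *m 'D_(lsubmx u') b x0) +
      (second_deriv a x0 (lsubmx u') + v0 *m second_deriv b x0 (lsubmx u')))
    - dotp f (second_deriv g x0 (lsubmx u')))); split.
  move=> /ee0[luE e0e]; rewrite luE e0e; reflexivity.
move=> M MM.
pose qs k : 'rV[R]_(l + l) := row_mx ((t k)^-1 *: (g (x0 + t k *: lsubmx (us k)) - g x0)) (ee k).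
have qC : qs k @[k --> \oo] --> row_mx (lsubmx u' *m 'J g x0) e0.
  apply: cvg_row_mx; last exact: eC.
  rewrite jacobianE; last by case: g2 => -[].
  have cx0 : (fun=> x0) k @[k --> \oo] --> x0 by exact: cvg_cst.
  apply: (first_order_quotient _ cx0 _ tp); first by case: g2.
  exact: cvg_lsubmx.
have Tqs : \forall k \near \oo, T (qs k).
  have [d d0 GT] := conic_tangent Gclosed (Gconic (row_mx (g x0) v0)).
  apply: filterS (near0_scale d0 tp qC) => k k1.
  apply: (iffLR (tangent_cone_scaleE _ _ _ (t0 k))); apply: (iffLR (GT _ k1)).
  have := Gk k; rewrite /qs scale_row_mx add_row_mx scalerA mulfV ?gt_eqF// scale1r.
  by rewrite [X in _ -> G (row_mx X _)]addrC subrK.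
have [d d0 dP] := regular_normal_cone_near T_closed (T_conic q) T_scale N.
have neg : \forall k \near \oo, dotp (lam r f) (qs k) <= 0.
  case: u'E => [uE|eta0].
    have [luE e0e] := ee0 uE.
    have near_q : \forall k \near \oo, `|qs k - q| < d.
      have /cvgrPdist_lt/(_ _ d0) := qC; rewrite luE e0e.
      by apply: filterS => k; rewrite distrC.
    by apply: filterS2 Tqs near_q => k k1 k2; exact: dP.
  have q0 : q = 0.
    have u0 : u = 0 by have := congr1 lsubmx eta0; rewrite row_mxKl linear0.
    have eb : e *m b x0 = 0.
      have := congr1 rsubmx eta0; rewrite row_mxKr linear0 u0 (dir_deriv0 b2 a2) add0r; exact: id.
    rewrite u0 mul0mx (_ : e = 0) ?row_mx0//.
    by apply: (injective_eq bf tangent_dir_sub (sub0mx _ _)); rewrite mul0mx.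
  (* [qs k] need not be close to [q = 0], but [T] is a cone: scaling moves [qs k] into the ball
     without changing the sign of the pairing. *)
  apply: filterS Tqs => k k1; have [c /andP[c0 _] cd] := scale_small (qs k) d0.
  have := dP (c *: qs k) (T_scale c0 k1).
  rewrite q0 subr0 normrZ gtr0_norm// => /(_ cd).
  by rewrite dotpZr pmulr_rle0.
have h : \forall k \near \oo, (t k)^-1 * (dotp (cov r f) (us k) - dotp (lam r f) (qs k)) < M.
  exact: (cvgr_lt _ pC _ MM).
apply: filterS2 neg h => k k1 k2; apply: le_trans (ltW k2).
by rewrite ler_pM2l ?invr_gt0// lerBrDr gerDl.
Qed.

Lemma prox_normalE w : directional_proximal_normal_cone PG om eta w <->
  exists (r : 'rV[R]_m) (f : 'rV[R]_l), w = cov r f /\ regular_normal_cone T q (lam r f).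
Proof.
split=> [/prox_support_fun/support_fun_lty//|[r [f [-> N]]]].
split; last exact: normal_perp.
apply: prenormal_bounded => t us u' tp usC Pus u'E.
have [M0 [_ H]] := tangent_quotient_bound N tp usC Pus u'E.
by exists (M0 + 1); apply: H; rewrite ltrDl.
Qed.

Lemma second_subderivativeE w : dotp w eta = 0 ->
  second_subderivative_indicator PG om w eta = (- support_fun T2 w)%E.
Proof.
move=> weta; apply/le_anti/andP; split.
  rewrite leeNr; apply: ge_ereal_sup => _ [th Tth <-].
  by rewrite leeNr; exact: second_subderivative_le.
have [/support_fun_lty[r [f [wE N]]]|] := boolP (support_fun T2 w < +oo)%E; last first.
  by rewrite -leNgt leye_eq => /eqP ->; exact: leNye.
rewrite wE support_fun_value//; apply: second_subderivative_ge => t us M tp usC Pus cM.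
have [M0 [M0E H]] := tangent_quotient_bound N tp usC Pus (or_introl erefl).
by apply: H; rewrite M0E// ltr_pM2l.
Qed.

Lemma lower_support_fun_cases w :
  (directional_normal_cone PG om eta w -> forall r f, w = cov r f -> (f <= B)%MS ->
     lower_support_fun T2 w = (support_value r f)%:E) /\
  (~ directional_normal_cone PG om eta w -> lower_support_fun T2 w = +oo%E).
Proof.
have [z1 Wz z1B] := base_point; have [_ _ Jf bf] := gd.
have W0 : W 0 by exact: tangent_cone0.
have Ws (c : R) p : 0 < c -> W p -> W (c *: p) by exact: tangent_cone_scale.
have T2L p := iff_trans (second_tangent_coneE p)
  (linear_graph_translate (param_jacobian b a x0 v0) (b x0) aligned_W second_shift p z1B).
(* The chain rule for the linear graph gives normals of [W] at its vertex, and by conicity these are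
   the normals of [G] in direction [q]. *)
have N0 : directional_normal_cone (linear_graph W ('J g x0) (param_jacobian b a x0 v0) (b x0)) 0 0 w
    <-> directional_normal_cone PG om eta w.
  rewrite (linear_graph_normal _ W0 aligned_W Jf bf) directional_normalE (directional_normal_conic (row_mx (g x0) v0) q Gclosed Gconic).
  exact: iff_refl.
have L0 := linear_graph0 ('J g x0) (param_jacobian b a x0 v0) (b x0) W0.
have Ls (c : R) p := @linear_graph_scale _ _ _ _ W ('J g x0) (param_jacobian b a x0 v0) (b x0) Ws c p.
have [H1 H2] := lower_support_fun_translate w Ls L0 T2L.
split=> [N r f wE fB|N]; last by apply: H2 => /N0.
rewrite H1; last exact/N0.
have := covec_second_dotp r f z1 0; rewrite mul0mx addr0 -wE => ->.
congr (_%:E); rewrite dotp_row_mx dotp0r (perp_submx fB z1B) addr0; exact: addr0.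
Qed.

End SecondOrderParamGraph.

(** * Specialisation to [a = 0] and the graph of [N_P] *)

Theorem theorem4p2 (R : realType) (n m l : nat) (P : set 'rV[R]_l)
    (g : 'rV[R]_n -> 'rV[R]_l) (b : 'rV[R]_n -> 'M[R]_(l, m))
    (xbar : 'rV[R]_n) (dbar : 'rV[R]_l) :
  polyhedral P -> twice_contdiff g -> twice_contdiff b ->
  P (g xbar) -> convex_normal_cone P (g xbar) dbar ->
  (forall d : 'rV[R]_l, d *m ('J g xbar)^T = 0 ->
     span_diff (convex_normal_cone P (g xbar)) d -> d = 0) ->
  (forall d : 'rV[R]_l, d *m b xbar = 0 ->
     span_diff (convex_normal_cone P (g xbar)) d -> d = 0) ->
  let Om := Omega P g b in
  let omega := row_mx xbar (dbar *m b xbar) in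
  let G := gph (convex_normal_cone P) in
  let gd := row_mx (g xbar) dbar in
  (* (u, e) represents the tangent vector eta *)
  let tangent_repr (eta : 'rV[R]_(n + m)) (u : 'rV[R]_n) (e : 'rV[R]_l) :=
    eta = row_mx u (dbar *m 'D_u b xbar + e *m b xbar) /\
    tangent_cone G gd (row_mx (u *m 'J g xbar) e) in
  let covector (r : 'rV[R]_m) (f : 'rV[R]_l) : 'rV[R]_(n + m) :=
    row_mx (- (r *m ('J (fun x => dbar *m b x) xbar)^T)
            + f *m ('J g xbar)^T) r in
  (* (r, f) represents the covector omega_s through the cone K *)
  let normal_repr (K : set 'rV[R]_(l + l)) (omega_s : 'rV[R]_(n + m))
      (r : 'rV[R]_m) (f : 'rV[R]_l) :=
    omega_s = covector r f /\ K (row_mx f (r *m (b xbar)^T)) in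
  (* (i) *)
  tangent_cone Om omega = [set eta | exists u e, tangent_repr eta u e] /\
  forall eta, tangent_cone Om omega eta ->
  (exists! ue : 'rV[R]_n * 'rV[R]_l, tangent_repr eta ue.1 ue.2) /\
  forall u e, tangent_repr eta u e ->
  let q := row_mx (u *m 'J g xbar) e in
  let T2 := second_tangent_set Om omega eta in
  let KF := regular_normal_cone (tangent_cone G gd) q in
  let KL := directional_normal_cone G gd q in
  let value (r : 'rV[R]_m) (f : 'rV[R]_l) : R :=
    dotp r (2 *: (e *m 'D_u b xbar) + dbar *m second_deriv b xbar u)
    - dotp f (second_deriv g xbar u) in
  [/\ (* (ii) *)
      directional_normal_cone Om omega eta =
        [set omega_s | exists r f, normal_repr KL omega_s r f] /\
      T2 = [set theta | exists (zeta : 'rV[R]_n) (xi : 'rV[R]_l),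
             theta = row_mx zeta
               (2 *: (e *m 'D_u b xbar)
                + dbar *m ('D_zeta b xbar + second_deriv b xbar u)
                + xi *m b xbar) /\
             second_tangent_set G gd q
               (row_mx (zeta *m 'J g xbar + second_deriv g xbar u) xi)],
      (* (iii) *)
      [/\ edom (support_fun T2) = directional_proximal_normal_cone Om omega eta,
          directional_proximal_normal_cone Om omega eta =
            [set omega_s | exists r f, normal_repr KF omega_s r f]
        & edom (lower_support_fun T2) = directional_normal_cone Om omega eta],
      (* (iv), support function *)
      forall omega_s, edom (support_fun T2) omega_s ->
        (exists! rf : 'rV[R]_m * 'rV[R]_l, normal_repr KF omega_s rf.1 rf.2) /\
        forall r f, normal_repr KF omega_s r f ->
          support_fun T2 omega_s = (value r f)%:E /\
          second_subderivative_indicator Om omega omega_s eta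
            = (- support_fun T2 omega_s)%E
    & (* (iv), lower generalized support function *)
      forall omega_s, edom (lower_support_fun T2) omega_s ->
        (exists! rf : 'rV[R]_m * 'rV[R]_l, normal_repr KL omega_s rf.1 rf.2) /\
        forall r f, normal_repr KL omega_s r f ->
          lower_support_fun T2 omega_s = (value r f)%:E /\
          second_subderivative_indicator Om omega omega_s eta
            = (- support_fun T2 omega_s)%E].
Proof.
move=> [k [a [c PE]]] g2 b2 Pg Nd hJ hb Om omega G gd tangent_repr covector normal_repr.
have a2 := @twice_contdiff_cst R n _ (0 : 'rV[R]_m).
(* A basis of the row space in place of the active matrix: full row rank of the products also needs
   [w *m B = 0] to imply [w = 0]. *)
pose B := row_base (active_matrix a c (g xbar)).
have BA : (B :=: active_matrix a c (g xbar))%MS := eq_row_base _.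
have Bspan w : span_diff (convex_normal_cone P (g xbar)) (w *m B).
  rewrite PE; apply: active_span; first by move: Pg; rewrite PE.
  by rewrite (submx_trans (submxMl w B))// BA.
have Binj (w : 'rV[R]_(\rank (active_matrix a c (g xbar)))) : w *m B = 0 -> w = 0.
  by move=> wB; apply: (row_free_inj (row_base_free (active_matrix a c (g xbar)))); rewrite mul0mx.
have Jfree : row_free (B *m ('J g xbar)^T).
  by apply: row_free_kernel => w; rewrite mulmxA => /hJ/(_ (Bspan w))/Binj.
have bfree : row_free (B *m b xbar).
  by apply: row_free_kernel => w; rewrite mulmxA => /hb/(_ (Bspan w))/Binj.
have good0 : good G g b B xbar dbar.
  split; [exact/gphP| |exact: Jfree|exact: bfree].
  rewrite /G PE; apply: aligned_gph_normal; first by rewrite BA.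
  by move: Pg; rewrite PE.
have Gclosed : closed G by rewrite /G PE; exact: closed_gph_normal.
have Gconic z : conic_at G z by rewrite /G PE; exact: conic_gph_normal.
have OmE : Om = param_graph G g b (fun=> 0).
  apply/seteqP; split=> w [x [v [-> H]]]; exists x, v; split=> //.
  - by rewrite add0r.
  - exact/gphP.
  - by rewrite add0r.
  - exact/gphP.
have omE : omega = row_mx xbar (0 + dbar *m b xbar) by rewrite add0r.
have dirE v u : dir_deriv b (fun=> 0) xbar v u = v *m 'D_u b xbar.
  rewrite /dir_deriv -[RHS]add0r; congr (_ + _); exact: derive_cst.
have db : differentiable b xbar by case: b2 => -[].
have JE : 'J (fun x => dbar *m b x) xbar = param_jacobian b (fun=> 0) xbar dbar.
  apply: mulmx_ext => u; rewrite (dir_derivE b2 a2) dirE.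
  have [dd DE] := derive_mulmxl dbar db; rewrite jacobianE//.
have covE r f : covector r f = covec g b (fun=> 0) xbar dbar r f by rewrite /covector JE.
have tangentE : tangent_cone Om omega = [set eta | exists u e, tangent_repr eta u e].
  rewrite OmE omE (tangent_param_graph g2 b2 a2 good0); apply/seteqP.
  by split=> th [u [e [-> Te]]]; exists u, e; split=> //; rewrite dirE.
split=> [|eta]; first exact: tangentE.
rewrite tangentE => -[u0 [e0 rep0]].
have eB u e : tangent_repr eta u e -> (e <= B)%MS.
  by move=> [_ Te]; exact: (tangent_dir_sub good0 Te).
split.
  exists (u0, e0); split=> // -[u e]/= rep.
  have [etaE0 _] := rep0; have [etaE _] := rep; move: etaE0; rewrite etaE.
  move=> /eq_row_mx[uu]; rewrite uu => /addrI H; congr pair.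
  by apply/esym; exact: (injective_eq bfree (eB _ _ rep) (eB _ _ rep0) H).
move=> u e rep q T2 KF KL value; have [etaE Tq] := rep.
have valE r f : value r f = support_value g b (fun=> 0) xbar u dbar e r f.
  by rewrite /support_value /second_shift second_deriv_cst add0r.
have T2E : T2 = second_tangent_set (param_graph G g b (fun=> 0))
    (row_mx xbar (0 + dbar *m b xbar))
    (row_mx u (dir_deriv b (fun=> 0) xbar dbar u + e *m b xbar)).
  by rewrite /T2 OmE omE etaE dirE.
have proxE w : directional_proximal_normal_cone Om omega eta w <->
    exists r f, normal_repr KF w r f.
  rewrite OmE omE etaE -dirE (prox_normalE g2 b2 a2 Gclosed Gconic good0 Tq).
  by split=> -[r [f [-> H]]]; exists r, f; split; rewrite ?covE.
have normalE w : directional_normal_cone Om omega eta w <->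
    exists r f, normal_repr KL w r f.
  rewrite OmE omE etaE -dirE (directional_normalE g2 b2 a2 good0 Tq).
  by split=> -[r [f [-> H]]]; exists r, f; split; rewrite ?covE.
have suppE w : edom (support_fun T2) w <-> exists r f, normal_repr KF w r f.
  rewrite T2E; split=> [/(support_fun_lty g2 b2 a2 Gclosed Gconic good0 Tq)|].
    by move=> [r [f [-> H]]]; exists r, f; split; rewrite ?covE.
  move=> [r [f [-> H]]].
  by rewrite /edom/= covE (support_fun_value g2 b2 a2 Gclosed Gconic good0 Tq H) ltry.
have lowE w : edom (lower_support_fun T2) w <-> directional_normal_cone Om omega eta w.
  have [H1 H2] := lower_support_fun_cases g2 b2 a2 Gclosed Gconic good0 Tq w.
  rewrite T2E normalE /edom/=; split=> [wlt|/normalE N].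
    apply/normalE; apply: contrapT => N; move: wlt; rewrite H2 ?ltxx//.
    by rewrite dirE -etaE -OmE -omE.
  have /normalE[r [f [wE Nrf]]] := N.
  rewrite (H1 _ r f) ?ltry//; first by rewrite dirE -etaE -OmE -omE.
    by rewrite -covE.
  exact: (directional_normal_sub good0 Nrf).
have subE w : dotp w eta = 0 ->
    second_subderivative_indicator Om omega w eta = (- support_fun T2 w)%E.
  rewrite T2E OmE omE etaE -dirE; exact: (second_subderivativeE g2 b2 a2 Gclosed Gconic good0 Tq).
have uniq (K : set 'rV[R]_(l + l)) w r f r' f' :
    (forall r f, K (row_mx f (r *m (b xbar)^T)) -> (f <= B)%MS) ->
    normal_repr K w r f -> normal_repr K w r' f' -> (r, f) = (r', f').
  move=> KB [wE Kf] [wE' Kf'].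
  have E : covec g b (fun=> 0) xbar dbar r f = covec g b (fun=> 0) xbar dbar r' f'.
    by rewrite -!covE -wE.
  exact: (covec_injective good0 (KB _ _ Kf) (KB _ _ Kf') E).
have KFB r f : KF (row_mx f (r *m (b xbar)^T)) -> (f <= B)%MS.
  exact: (normal_sub good0 Tq).
have KLB r f : KL (row_mx f (r *m (b xbar)^T)) -> (f <= B)%MS.
  exact: (directional_normal_sub good0).
split.
- split; first by apply/seteqP; split=> w /normalE.
  rewrite T2E (second_tangentE g2 b2 a2 good0 Tq).
  apply/seteqP; split=> th [zeta [xi [-> H]]]; exists zeta, xi; split=> //.
    by rewrite dirE second_deriv_cst add0r mulmxDr.
  by rewrite dirE second_deriv_cst add0r mulmxDr.
- split; first by apply/seteqP; split=> w; [move=> /suppE/proxE|move=> /proxE/suppE].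
    by apply/seteqP; split=> w /proxE.
  by apply/seteqP; split=> w /lowE.
- move=> w /suppE[r0 [f0 N0]]; split.
    by exists (r0, f0); split=> // -[r f] /=; apply: uniq N0.
  move=> r f [wE N]; split.
    by rewrite wE covE T2E valE; exact: (support_fun_value g2 b2 a2 Gclosed Gconic good0 Tq N).
  apply: subE; rewrite wE covE etaE -dirE.
  exact: (normal_perp b2 a2 N).
- move=> w /lowE wN; have /normalE[r0 [f0 N0]] := wN; split.
    by exists (r0, f0); split=> // -[r f] /=; apply: uniq N0.
  move=> r f [wE N]; split.
    have [H1 _] := lower_support_fun_cases g2 b2 a2 Gclosed Gconic good0 Tq w.
    rewrite T2E valE; apply: H1; last exact: KLB N.
      by rewrite dirE -etaE -OmE -omE.
    by rewrite wE covE.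
  apply: subE; rewrite wE covE etaE -dirE.
  exact: (directional_normal_perp b2 a2 Gclosed Gconic N).
Qed.
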